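(* For every positive integer $c$ and every integer $n$, $$|S(0,n,2c,\psi)|\le 2^{\omega_o(c)}\sqrt{\frac{2c}{(3,c)}},$$ where $\omega_o(c)$ is the number of distinct odd prime divisors of $c$ and $(3,c)$ is the greatest common divisor of $3$ and $c$.
   Context: Notation: $e(x):=\exp(2\pi i x)$. The eta-multiplier $\nu_\eta$ on $\mathrm{SL}_2(\mathbb Z)$ is defined by $\eta(\gamma\tau)=\nu_\eta(\gamma)\sqrt{c\tau+d}\,\eta(\tau)$ (principal branch), $\gamma=\begin{pmatrix}a&b\\c&d\end{pmatrix}$, where $\eta(\tau)=q^{1/24}\prod_{n\ge1}(1-q^n)$, $q=e(\tau)$. For $\gamma=\begin{pmatrix}a&b\\c&d\end{pmatrix}\in\Gamma_0(2)$ define $$\psi(\gamma)=\begin{cases} i^{c/2}\left(\frac{-1}{d}\right)\overline{\nu_\eta}(\gamma)& c\equiv0\pmod 4,\\ i^{c/2}\,\overline{\nu_\eta}(\gamma)& c\equiv2\pmod 4;\end{cases}$$ this is a multiplier system of weight $\frac12$ on $\Gamma_0(2)$. For integers $m,n$ and even $c>0$ the Kloosterman sum is $$S(m,n,c,\psi):=\sum_{\substack{0\le a,d<c\\ \gamma=\left(\begin{smallmatrix}a&b\\c&d\end{smallmatrix}\right)\in\Gamma_0(2)}}\overline{\psi}(\gamma)\,e\left(\frac{(m-\frac1{24})a+(n-\frac1{24})d}{c}\right).$$ *)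

(* Defs.v *)
From HB Require Import structures.
From mathcomp Require Import all_boot all_order all_algebra.
From mathcomp Require Import all_classical all_reals all_analysis.
From mathcomp Require Import complex.
Set Implicit Arguments.
Unset Strict Implicit.
Unset Printing Implicit Defensive.
Import Order.TTheory GRing.Theory Num.Theory.
Import numFieldNormedType.Exports.
Local Open Scope ring_scope.
Local Open Scope complex_scope.

Definition cexp {R : realType} (z : R[i]) : R[i] :=
  (expR (complex.Re z))%:C * (cos (complex.Im z) +i* sin (complex.Im z)).

Definition e {R : realType} (z : R[i]) : R[i] :=
  cexp (2%:R * pi%:C * 'i%C * z).

(* q^(1/24) means e(tau / 24).  The ascription R[i]^o selects the topology
   given by the complex norm. *)
Definition eta {R : realType} (tau : R[i]) : R[i] :=
  e (tau / 24%:R) *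
  lim ((fun N : nat => \prod_(1 <= n < N) (1 - e tau ^+ n) : R[i]^o)
         @ \oo)%classic.

Definition mx2 (a b c d : int) : 'M[int]_2 :=
  \matrix_(i < 2, j < 2)
    (if i == 0 then (if j == 0 then a else b) else (if j == 0 then c else d)).

Definition SL2Z : {pred 'M[int]_2} := [pred g | \det g == 1].

Definition Gamma0 (N : nat) : {pred 'M[int]_2} :=
  [pred g | (g \in SL2Z) && (N %| g 1%R 0%R)%Z].

(* The automorphy factor c tau + d and the action of g on tau. *)
Definition cocyc {R : realType} (g : 'M[int]_2) (tau : R[i]) : R[i] :=
  (g 1%R 0%R)%:~R * tau + (g 1%R 1%R)%:~R.

Definition moebius {R : realType} (g : 'M[int]_2) (tau : R[i]) : R[i] :=
  ((g 0%R 0%R)%:~R * tau + (g 0%R 1%R)%:~R)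
  / cocyc g tau.

(* The number w such that eta(g tau) = w sqrt(c tau + d) eta(tau) for all tau
   in the upper half-plane (for g in SL2Z it exists and is unique).  Note that
   sqrtc is the principal branch: its real part is nonnegative, and
   sqrtc (- x) = i sqrt x for x > 0.  This is unlike sqrtC of numClosedFieldType,
   whose imaginary part is nonnegative. *)
Definition nu_eta {R : realType} (g : 'M[int]_2) : R[i] :=
  xget 0 [set w : R[i] | forall tau : R[i], 0 < complex.Im tau ->
    eta (moebius g tau) = w * sqrtc (cocyc g tau) * eta tau]%classic.

(* Legendre symbol, for an odd prime p. *)
Definition legendre (a : int) (p : nat) : int :=
  if (p %| a)%Z then 0
  else if [exists x : 'I_p, (x%:Z ^+ 2 == a %[mod p])%Z] then 1 else -1.

Definition kronecker2 (a : int) : int :=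
  if (2 %| a)%Z then 0
  else if (a == 1 %[mod 8])%Z || (a == -1 %[mod 8])%Z then 1 else -1.

(* Kronecker symbol (a/n), extending the Jacobi symbol to all integers n by
   (a/-1) = -1 if a < 0 and 1 otherwise, and (a/0) = 1 if a = 1 or a = -1
   and 0 otherwise. *)
Definition kronecker (a n : int) : int :=
  if n == 0 then (if `|a|%N == 1%N then 1 else 0)
  else (if (n < 0) && (a < 0) then -1 else 1) *
       \prod_(p <- primes `|n|%N)
          (if p == 2%N then kronecker2 a else legendre a p) ^+ logn p `|n|%N.

(* On Gamma0 2 the lower left entry c is even, so the second branch is the
   case c = 2 mod 4. *)
Definition psi {R : realType} (g : 'M[int]_2) : R[i] :=
  let c := g 1%R 0%R in
  let d := g 1%R 1%R in
  if (4 %| c)%Z then 'i%C ^ (c %/ 2)%Z * (kronecker (-1) d)%:~R * (nu_eta g)^*%C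
  else 'i%C ^ (c %/ 2)%Z * (nu_eta g)^*%C.

(* The only candidate for a matrix of determinant 1 with entries a, c, d:
   its determinant is 1 exactly when c divides a d - 1. *)
Definition kl_mx (a d c : nat) : 'M[int]_2 :=
  mx2 a ((a%:Z * d%:Z - 1) %/ c%:Z)%Z c d.

(* S(m, n, c, psi), for even c > 0. *)
Definition kloosterman {R : realType} (m n : int) (c : nat)
    (chi : 'M[int]_2 -> R[i]) : R[i] :=
  \sum_(a < c) \sum_(d < c | kl_mx a d c \in Gamma0 2)
    (chi (kl_mx a d c))^*%C *
    e (((m%:~R - 24%:R^-1) * a%:R + (n%:~R - 24%:R^-1) * d%:R) / c%:R).

Definition omega_odd (c : nat) : nat := size [seq p <- primes c | odd p].

(* Main.v *)
(** Proof idea.  Let k = 2c and let chi be the even real primitive character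
    modulo 12.  By the pentagonal number theorem, 2 eta(tau) is the sum over all
    integers N of chi(N) e(N^2 tau / 24); Poisson summation in each residue class
    modulo 12k then gives, for gamma = (a, b; k, d),

      nu_eta(gamma) = e(-1/8) (12k)^(-1/2) e((a + d) / 24k) f(d),
      f(d) = sum over r mod 12k of chi(r) e((d (r^2 - 1) + 2r) / 24k).

    Poisson summation is needed for Gaussians exp(-pi lam^2 y^2) with complex lam;
    it follows from the discrete Fourier inversion formula, because the Riemann
    sums of such a Gaussian have a limit that depends on lam only through the
    factor 1 / lam.  As f(d) = 0 when gcd(d, k) > 1, the sum over the pairs (a, d)
    becomes a sum over all d modulo k, in which the Kronecker symbol only shifts n
    by k / 4.  Orthogonality leaves k times the sum of chi(r) e(r / 12k) over the
    r mod 12k such that r^2 = 1 - 24m mod 24k, where m is n or n + k / 4.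
    This sum is zero if p^2 | k and p | 1 - 24m for some prime p; otherwise the
    number of its terms is at most 2 * 2^(number of odd primes dividing 12k),
    and for k prime to 3 a pairing of the terms gains a further factor
    |1 - e(1/3)| / 2. *)

(* The case m = 0 is explicit because the factor e((a + d) / 24k) of nu_eta cancels the shifts -1/24
   in the exponent: after that nothing contains a, and each d prime to k has one inverse a.

   Complex lam is forced by the definition of nu_eta, whose identity must hold at every tau: with z
   = -i (tau + d / k), the series of eta at gamma tau is a Gaussian sum with lam^2 = 12 / z.

   The dual series is a multiple of eta only if the Gauss sum twisted by e(2jr / 24k) is
   proportional to chi(j) e(-d j^2 / 24k) as j varies. Completing the square, and then substituting
   square roots of 1 modulo 24k that lie in the classes 5 and 7 modulo 12, gives this for all j at
   once.

   The constant arises as k (12k)^(-1/2) sqrt(12 / (3,c)) = sqrt(k / (3,c)). If 3 divides c, the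
   leading 2 of the count is sqrt(12 / 3). Otherwise the prime 3 of 12k doubles the count, and the
   pairing factor sqrt 3 / 2 turns 4 into sqrt 12. *)
Require Import Defs.
From mathcomp Require Import all_boot all_order all_algebra.
From mathcomp Require Import all_classical all_reals all_analysis.
From mathcomp Require Import finfield complex.
From mathcomp Require Import ring lra zify.
Set Implicit Arguments.
Unset Strict Implicit.
Unset Printing Implicit Defensive.
Import Order.TTheory GRing.Theory Num.Theory.
Import numFieldNormedType.Exports.
Local Open Scope ring_scope.
Local Open Scope complex_scope.
Local Notation normc := ComplexField.Normc.normc.
Local Notation normcM := ComplexField.Normc.normcM.

(** * Complex exponential *)

Section ComplexBasics.
Variable R : realType.
Implicit Types (x y : R) (z w : R[i]).

Lemma normrE z : `|z| = (normc z)%:C.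
Proof. by rewrite normc_def; case: z. Qed.

Lemma normc_ge0 z : 0 <= normc z.
Proof. by case: z => a b; rewrite sqrtr_ge0. Qed.

Lemma normcR x : normc x%:C = `|x|.
Proof. by rewrite /= expr0n addr0 sqrtr_sqr. Qed.

Lemma normc_le_add z w : normc (z + w) <= normc z + normc w.
Proof. exact: le_normcD. Qed.

Lemma normc_opp z : normc (- z) = normc z.
Proof. exact: normcN. Qed.

Lemma normc_distC z w : normc (z - w) = normc (w - z).
Proof. by rewrite -normc_opp opprB. Qed.

Lemma normcX z n : normc (z ^+ n) = normc z ^+ n.
Proof.
elim: n => [|n IH]; first by rewrite !expr0 ComplexField.Normc.normc1.
by rewrite !exprS normcM IH.
Qed.

Lemma normc_sum (I : Type) (r : seq I) (P : pred I) (F : I -> R[i]) :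
  normc (\sum_(i <- r | P i) F i) <= \sum_(i <- r | P i) normc (F i).
Proof.
elim/big_rec2: _ => [|i y z _ h]; first by rewrite ComplexField.Normc.normc0.
by apply: le_trans (normc_le_add _ _) _; rewrite lerD2l.
Qed.

Lemma normc_Re z : `|complex.Re z| <= normc z.
Proof.
by case: z => a b /=; rewrite -sqrtr_sqr ler_wsqrtr // lerDl sqr_ge0.
Qed.

Lemma normc_Im z : `|complex.Im z| <= normc z.
Proof.
by case: z => a b /=; rewrite -sqrtr_sqr ler_wsqrtr // lerDr sqr_ge0.
Qed.

Lemma normc_le_ReIm z : normc z <= `|complex.Re z| + `|complex.Im z|.
Proof.
case: z => a b /=; rewrite -[leRHS]ger0_norm ?addr_ge0 // -sqrtr_sqr.
rewrite ler_wsqrtr // sqrrD !real_normK ?num_real // -addrA lerD2l lerDr.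
by rewrite mulrn_wge0 // mulr_ge0.
Qed.

Lemma ReD z w : complex.Re (z + w) = complex.Re z + complex.Re w.
Proof. by case: z w => [a b] []. Qed.
Lemma ImD z w : complex.Im (z + w) = complex.Im z + complex.Im w.
Proof. by case: z w => [a b] []. Qed.
Lemma ReN z : complex.Re (- z) = - complex.Re z.
Proof. by case: z. Qed.
Lemma ImN z : complex.Im (- z) = - complex.Im z.
Proof. by case: z. Qed.
Lemma ReM z w : complex.Re (z * w) =
  complex.Re z * complex.Re w - complex.Im z * complex.Im w.
Proof. by case: z w => [a b] []. Qed.
Lemma ImM z w : complex.Im (z * w) =
  complex.Re z * complex.Im w + complex.Im z * complex.Re w.
Proof. by case: z w => [a b] []. Qed.

Lemma complex_natr n : (n%:R : R[i]) = (n%:R : R)%:C.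
Proof. by rewrite rmorph_nat. Qed.

Lemma complex_intr (n : int) : (n%:~R : R[i]) = (n%:~R : R)%:C.
Proof. by rewrite rmorph_int. Qed.

Lemma cexpD z w : cexp (z + w) = cexp z * cexp w.
Proof.
case: z w => [a b] [c d]; rewrite /cexp /= expRD cosD sinD.
by apply/eqP; rewrite eq_complex /=; apply/andP; split; apply/eqP; ring.
Qed.

Lemma cexpR x : cexp x%:C = (expR x)%:C.
Proof. by rewrite /cexp /= cos0 sin0 mulr1. Qed.

Lemma cexp0 : cexp 0 = 1 :> R[i].
Proof. by rewrite (cexpR 0) expR0. Qed.

Lemma normc_cexp z : normc (cexp z) = expR (complex.Re z).
Proof.
rewrite /cexp normcM normcR /= cos2Dsin2 sqrtr1 mulr1.
by rewrite ger0_norm // expR_ge0.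
Qed.

Lemma cexp_neq0 z : cexp z != 0.
Proof.
apply/eqP => h; have := normc_cexp z; rewrite h ComplexField.Normc.normc0 => h1.
by have := expR_gt0 (complex.Re z); rewrite -h1 ltxx.
Qed.

Lemma cexpN z : cexp (- z) = (cexp z)^-1.
Proof.
apply: (mulfI (cexp_neq0 z)); rewrite -cexpD subrr cexp0 divff //.
exact: cexp_neq0.
Qed.

Lemma cexpX z n : cexp (z *+ n) = cexp z ^+ n.
Proof.
elim: n => [|n IH]; first by rewrite mulr0n cexp0 expr0.
by rewrite mulrS cexpD IH exprS.
Qed.

Lemma abs_sin_le x : `|sin x| <= `|x|.
Proof.
wlog x0 : x / 0 < x.
  move=> H; have [h|h|<-] := ltrgtP 0 x; first exact: H.
    by rewrite -normrN -sinN -[leRHS]normrN; apply: H; rewrite oppr_gt0.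
  by rewrite sin0 normr0.
have [|c _] := @MVT R sin cos 0 x x0.
  by apply: continuous_subspaceT => y; exact: continuous_sin.
rewrite sin0 !subr0 => ->; rewrite normrM ler_piMl //; exact: cos_max.
Qed.

Lemma one_sub_cos_le x : `|1 - cos x| <= x ^+ 2 / 2.
Proof.
rewrite ger0_norm; last by rewrite subr_ge0 cos_le1.
have -> : x = (x / 2) *+ 2 by rewrite -mulr_natr divfK.
rewrite cos_mulr2n cos2sin2.
have : sin (x / 2) ^+ 2 <= (x / 2) ^+ 2.
  by rewrite -[leLHS]real_normK ?num_real // -[leRHS]real_normK ?num_real // lerXn2r ?nnegrE // abs_sin_le.
move: (x / 2) (sin _) => a b; lra.
Qed.

Lemma abs_sin_sub_le x : `|sin x - x| <= x ^+ 2.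
Proof.
wlog x0 : x / 0 < x.
  move=> H; have [h|h|<-] := ltrgtP 0 x; first exact: H.
    by have := H (- x); rewrite oppr_gt0 sinN sqrrN -opprD normrN; exact.
  by rewrite sin0 subrr normr0 expr0n.
have [|c] := @MVT R (fun y => sin y - y) (fun y => cos y - 1) 0 x x0.
  apply: continuous_subspaceT => y; apply: cvgB; [exact: continuous_sin|exact: cvg_id].
rewrite in_itv /= => /andP[c0 cx]; rewrite sin0 !subr0 => ->; rewrite normrM (gtr0_norm x0) expr2 ler_pM2r //.
have [xl|xl] := leP 2 x.
  apply: le_trans xl; have := cos_max c; rewrite ler_norml => /andP[? ?].
  rewrite ler_norml; apply/andP; split; lra.
rewrite distrC; apply: le_trans (one_sub_cos_le _) _; nra.
Qed.

Lemma abs_expR_sub1_le x : `|expR x - 1| <= `|x| * expR `|x|.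
Proof.
have h1 := expR_ge1Dx x; have h2 := expR_ge1Dx (- x).
have e0 := expR_gt0 x.
have eN : expR x * expR (- x) = 1 by rewrite -expRD subrr expR0.
have h3 : expR x - 1 <= x * expR x by nra.
have [x0|x0] := leP 0 x.
  rewrite ger0_norm ?(ger0_norm x0) //; lra.
rewrite (ltr0_norm x0) ler0_norm; last by rewrite subr_le0 expR_le1 ltW.
have := expR_ge1Dx (-x); nra.
Qed.

Lemma abs_expR_sub_le x : `|expR x - 1 - x| <= x ^+ 2 * expR `|x|.
Proof.
have h1 := expR_ge1Dx x; have h2 := expR_ge1Dx (- x).
have e0 := expR_gt0 x.
have eN : expR x * expR (- x) = 1 by rewrite -expRD subrr expR0.
have h3 : expR x - 1 <= x * expR x by nra.
rewrite ger0_norm; last lra.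
have [x0|x0] := leP 0 x; first by rewrite ger0_norm //; nra.
rewrite (ltr0_norm x0).
have : 1 <= expR (- x) by lra.
nra.
Qed.

Lemma normc_cis_sub x : normc ((cos x +i* sin x) - 1 - 'i%C * x%:C) <= 2 * x ^+ 2.
Proof.
apply: le_trans (normc_le_ReIm _) _; rewrite /=.
have := one_sub_cos_le x; have := abs_sin_sub_le x.
rewrite [`|1 - _|]distrC.
rewrite !(mul0r, mulr0, mul1r, subr0, addr0, sub0r, oppr0, add0r).
move: `|sin x - x| `|cos x - 1| => a b; have := sqr_ge0 x; lra.
Qed.

(** The factor [expR (normc z)] makes the bound global: [gauss_taylor] applies it to increments that
    grow with [y] and pays for that factor with Gaussian decay. The constant is 4 = 2 + 1 + 1, one
    summand for each piece of the decomposition. *)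
Lemma normc_cexp_sub_le z :
  normc (cexp z - 1 - z) <= 4 * normc z ^+ 2 * expR (normc z).
Proof.
case: z => a b; set z := a +i* b.
have -> : cexp z - 1 - z = (expR a)%:C * ((cos b +i* sin b) - 1 - 'i%C * b%:C)
   + (expR a - 1 - a)%:C + 'i%C * (b * (expR a - 1))%:C.
  rewrite /cexp /z /=; apply/eqP; rewrite eq_complex /=.
  by apply/andP; split; apply/eqP; ring.
apply: le_trans (normc_le_add _ _) _.
have nz := normc_ge0 z.
have ha : `|a| <= normc z by exact: (normc_Re z).
have hb : `|b| <= normc z by exact: (normc_Im z).
have h1 := abs_expR_sub_le a; have h2 := abs_expR_sub1_le a.
have h3 := normc_cis_sub b.
have hea : expR a <= expR (normc z) by rewrite ler_expR (le_trans (ler_norm _)).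
have heA : expR `|a| <= expR (normc z) by rewrite ler_expR.
have e0 := expR_gt0 (normc z); have ea0 := expR_gt0 a; have eA0 := expR_gt0 `|a|.
have sa : a ^+ 2 <= normc z ^+ 2.
  by rewrite -[a ^+ 2]real_normK ?num_real // lerXn2r ?nnegrE.
have sb : b ^+ 2 <= normc z ^+ 2.
  by rewrite -[b ^+ 2]real_normK ?num_real // lerXn2r ?nnegrE.
have t1 : normc ((expR a)%:C * ((cos b +i* sin b) - 1 - 'i%C * b%:C)) <=
   expR (normc z) * (2 * normc z ^+ 2).
  rewrite normcM normcR (gtr0_norm ea0); apply: ler_pM => //; [exact: normc_ge0|].
  apply: le_trans h3 _; lra.
have t2 : normc (expR a - 1 - a)%:C <= normc z ^+ 2 * expR (normc z).
  rewrite normcR; apply: le_trans h1 _; apply: ler_pM => //; rewrite ?sqr_ge0 ?ltW //.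
have t3 : normc ('i%C * (b * (expR a - 1))%:C) <= normc z * (normc z * expR (normc z)).
  rewrite normcM normcR /= expr0n expr1n add0r sqrtr1 mul1r normrM.
  apply: ler_pM => //; apply: le_trans h2 _; apply: ler_pM => //; exact: ltW.
have := normc_le_add ((expR a)%:C * ((cos b +i* sin b) - 1 - 'i%C * b%:C)) (expR a - 1 - a)%:C.
rewrite -/z; lra.
Qed.

End ComplexBasics.

(** * Two-sided series and the eta function *)

Section ZSum.
Variable V : zmodType.
Implicit Types f g : int -> V.

(** The window -A <= n < B is half-open, so that a window with ends divisible by M splits exactly
    into residue classes modulo M. The reflection compatible with it is n -> -1 - n. *)
Definition zsum (A B : nat) (f : int -> V) := \sum_(i < A + B) f (i%:Z - A%:Z).

Lemma zsumE A B f :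
  zsum A B f = \sum_(i < B) f i%:Z + \sum_(i < A) f (- i.+1%:Z).
Proof.
rewrite /zsum big_split_ord /= addrC; congr (_ + _).
  by apply: eq_bigr => i _; congr f; rewrite PoszD addrC addKr.
rewrite (reindex_inj rev_ord_inj) /=; apply: eq_bigr => i _; congr f.
by have := ltn_ord i; lia.
Qed.

Lemma zsum_rev A B f : zsum A B (fun n => f (- 1 - n)) = zsum B A f.
Proof.
rewrite !zsumE addrC; congr (_ + _); apply: eq_bigr => i _; congr f; lia.
Qed.

Lemma big_ord_mulD (M n : nat) (F : nat -> V) :
  \sum_(i < M * n) F i = \sum_(r < M) \sum_(m < n) F (r + M * m)%N.
Proof.
elim: n => [|n IH].
  by rewrite muln0 big_ord0 big1 // => r _; rewrite big_ord0.
rewrite mulnS addnC big_split_ord /= IH.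
under [RHS]eq_bigr do rewrite big_ord_recr /=.
rewrite big_split /=; congr (_ + _); apply: eq_bigr => r _; by rewrite addnC.
Qed.

Lemma zsum_mod M A B f :
  zsum (M * A) (M * B) f = \sum_(r < M) zsum A B (fun m => f (r%:Z + M%:Z * m)).
Proof.
rewrite /zsum -mulnDr (big_ord_mulD _ _ (fun i => f (i%:Z - (M * A)%N%:Z))).
by apply: eq_bigr => r _; apply: eq_bigr => m _; congr f; lia.
Qed.

Lemma zsum_telescope A B f :
  zsum A B (fun n => f (n + 1) - f n) = f B%:Z - f (- A%:Z).
Proof.
rewrite /zsum; have h : forall n, \sum_(i < n) (f (i%:Z - A%:Z + 1) - f (i%:Z - A%:Z)) =
   f (n%:Z - A%:Z) - f (- A%:Z).
  elim=> [|n IH]; first by rewrite big_ord0 sub0r subrr.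
  rewrite big_ord_recr /= IH addrC addrA subrK; congr (f _ - _); lia.
by rewrite h; congr (f _ - _); lia.
Qed.

Lemma zsum_sym n f :
  zsum n n.+1 f = f 0 + \sum_(i < n) (f i.+1%:Z + f (- i.+1%:Z)).
Proof. by rewrite zsumE big_ord_recl big_split /= addrA. Qed.

Lemma zsum_symD K n f : zsum (K + n) (K + n).+1 f =
  zsum K K.+1 f + \sum_(i < n) (f (K + i).+1%:Z + f (- (K + i).+1%:Z)).
Proof. by rewrite !zsum_sym big_split_ord addrA. Qed.

Lemma zsumD A B f g : zsum A B (fun n => f n + g n) = zsum A B f + zsum A B g.
Proof. by rewrite /zsum big_split. Qed.

Lemma zsumB A B f g : zsum A B (fun n => f n - g n) = zsum A B f - zsum A B g.
Proof. by rewrite /zsum sumrB. Qed.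

Lemma eq_zsum A B f g : f =1 g -> zsum A B f = zsum A B g.
Proof. by move=> h; apply: eq_bigr => i _. Qed.

End ZSum.

Section Limits.
Variable R : realType.
Implicit Types (u v : nat -> R[i]) (l : R[i]) (f g : int -> R[i]).

Definition ccvg u l := forall eps : R, 0 < eps ->
  exists N, forall n, (N <= n)%N -> normc (u n - l) <= eps.

Lemma ccvg_lim u l : ccvg u l -> lim ((u : nat -> R[i]^o) @ \oo)%classic = l.
Proof.
move=> h; apply: cvg_lim; first exact: norm_hausdorff.
apply/cvgrPdist_le => eps eps0.
have [r er] : exists r : R, eps = r%:C.
  by exists (complex.Re eps); move: eps0; case: (eps) => a b; rewrite ltcE /= => /andP[/eqP -> _].
move: eps0; rewrite er ltcR => r0; have [N hN] := h _ r0.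
exists N => // n /= hn; rewrite normrE lecR normc_distC; exact: hN.
Qed.

(** The two ends go to infinity independently. This makes the notion stable under reflection and
    covers the symmetric windows [zsum n n.+1]. *)
Definition zcvg f l := forall eps : R, 0 < eps ->
  exists N, forall A B, (N <= A)%N -> (N <= B)%N -> normc (zsum A B f - l) <= eps.

Lemma normc_eq0_le (z : R[i]) : (forall eps : R, 0 < eps -> normc z <= eps) -> z = 0.
Proof.
move=> h; apply: ComplexField.Normc.eq0_normc; apply/eqP; rewrite eq_le normc_ge0 andbT.
by apply/ler_addgt0Pr => e1 h1; rewrite add0r; exact: h.
Qed.

Lemma zcvg_unique f l1 l2 : zcvg f l1 -> zcvg f l2 -> l1 = l2.
Proof.
move=> h1 h2; apply/eqP; rewrite -subr_eq0; apply/eqP/normc_eq0_le => eps e0.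
have e2 : 0 < eps / 2 by rewrite divr_gt0.
have [N1 H1] := h1 _ e2; have [N2 H2] := h2 _ e2.
have := H1 (maxn N1 N2) (maxn N1 N2) (leq_maxl _ _) (leq_maxl _ _).
have := H2 (maxn N1 N2) (maxn N1 N2) (leq_maxr _ _) (leq_maxr _ _).
move: (zsum _ _ _) => s hs2 hs1.
have -> : l1 - l2 = (s - l2) - (s - l1) by ring.
apply: le_trans (normc_le_add _ _) _; rewrite normc_opp; lra.
Qed.

Lemma eq_zcvg f g l : f =1 g -> zcvg f l -> zcvg g l.
Proof. by move=> /funext ->. Qed.

Lemma zcvgZ (c : R[i]) f l : zcvg f l -> zcvg (fun n => c * f n) (c * l).
Proof.
move=> h eps e0; have nc := normc_ge0 c.
have e2 : 0 < eps / (normc c + 1) by rewrite divr_gt0 //; lra.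
have [N H] := h _ e2; exists N => A B hA hB.
rewrite /zsum -mulr_sumr -mulrBr normcM.
have h1 : 0 < normc c + 1 by lra.
have := H A B hA hB; rewrite ler_pdivlMr // -/(zsum A B f) => h2.
have := normc_ge0 (zsum A B f - l); nra.
Qed.

Lemma zcvgD f g l1 l2 : zcvg f l1 -> zcvg g l2 -> zcvg (fun n => f n + g n) (l1 + l2).
Proof.
move=> h1 h2 eps e0.
have e2 : 0 < eps / 2 by rewrite divr_gt0.
have [N1 H1] := h1 _ e2; have [N2 H2] := h2 _ e2; exists (maxn N1 N2) => A B.
rewrite !geq_max => /andP[a1 a2] /andP[b1 b2].
have := H1 A B a1 b1; have := H2 A B a2 b2.
rewrite /zsum big_split /= -/(zsum A B f) -/(zsum A B g) => k1 k2.
rewrite opprD addrACA; apply: le_trans (normc_le_add _ _) _; lra.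
Qed.

Lemma zcvg0 : zcvg (fun=> 0) 0.
Proof.
by move=> eps /ltW e0; exists 0%N => A B _ _; rewrite /zsum big1 // subrr ComplexField.Normc.normc0.
Qed.

Lemma zcvg_sum (I : Type) (r : seq I) (F : I -> int -> R[i]) (L : I -> R[i]) :
  (forall i, zcvg (F i) (L i)) ->
  zcvg (fun n => \sum_(i <- r) F i n) (\sum_(i <- r) L i).
Proof.
move=> h; elim: r => [|i r IH].
  by rewrite big_nil; apply: eq_zcvg zcvg0 => n; rewrite big_nil.
rewrite big_cons; apply: eq_zcvg (zcvgD (h i) IH) => n; by rewrite big_cons.
Qed.

Lemma zcvg_rev f l : zcvg f l -> zcvg (fun n => f (- 1 - n)) l.
Proof.
move=> h eps e0; have [N H] := h _ e0; exists N => A B hA hB.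
by rewrite zsum_rev; apply: H.
Qed.

(** Both sides are limits along the same finite sums: [zsum_mod] identifies the window (M N, M N) of
    [f] with the windows (N, N) of its residue classes. *)
Lemma zcvg_mod M f l (L : nat -> R[i]) : (0 < M)%N -> zcvg f l ->
  (forall r, (r < M)%N -> zcvg (fun m => f (r%:Z + M%:Z * m)) (L r)) ->
  l = \sum_(r < M) L r.
Proof.
move=> M0 hf hr.
apply/eqP; rewrite -subr_eq0; apply/eqP/normc_eq0_le => eps e0.
have e2 : 0 < eps / 2 by rewrite divr_gt0.
have [N1 H1] := hf _ e2.
have hs : zcvg (fun m => \sum_(r < M) f (r%:Z + M%:Z * m)) (\sum_(r < M) L r).
  by apply: zcvg_sum => r; exact: hr.
have [N2 H2] := hs _ e2; set N := maxn N1 N2.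
have := H2 N N (leq_maxr _ _) (leq_maxr _ _).
have hN : (N1 <= M * N)%N by rewrite (leq_trans (leq_maxl N1 N2)) // leq_pmull.
have := H1 _ _ hN hN; rewrite zsum_mod /zsum exchange_big /=.
move: (\sum_(i < _) _) (\sum_(i < M) _) => s t hs1 hs2.
have -> : l - t = (s - t) - (s - l) by ring.
apply: le_trans (normc_le_add _ _) _; rewrite normc_opp; lra.
Qed.

Lemma real_geometric_cvg (a : nat -> R) (C rho : R) : 0 <= rho -> rho < 1 ->
  (forall n, `|a n| <= C * rho ^+ n) -> exists l : R, forall eps, 0 < eps ->
  exists N, forall n, (N <= n)%N -> `|\sum_(i < n) a i - l| <= eps.
Proof.
move=> r0 r1 ha.
have cv : cvgn (series a).
  apply: normed_cvg; apply: (@series_le_cvg _ _ (geometric C rho)) => //=.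
  - by move=> n; apply: le_trans (ha n).
  - by apply: is_cvg_geometric_series; rewrite ger0_norm.
exists (limn (series a)) => eps e0.
have /cvgrPdist_le /(_ _ e0) [N _ H] := cv.
exists N => n hn; have := H n hn; rewrite distrC /series /=.
by rewrite big_mkord.
Qed.

Lemma geometric_ccvg (a : nat -> R[i]) (C rho : R) : 0 <= rho -> rho < 1 ->
  (forall n, normc (a n) <= C * rho ^+ n) ->
  exists l, ccvg (fun n => \sum_(i < n) a i) l.
Proof.
move=> r0 r1 ha.
have [l1 h1] := real_geometric_cvg r0 r1 (fun n => le_trans (normc_Re _) (ha n)).
have [l2 h2] := real_geometric_cvg r0 r1 (fun n => le_trans (normc_Im _) (ha n)).
exists (l1 +i* l2) => eps e0.
have e2 : 0 < eps / 2 by rewrite divr_gt0.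
have [N1 H1] := h1 _ e2; have [N2 H2] := h2 _ e2; exists (maxn N1 N2) => n.
rewrite geq_max => /andP[n1 n2].
have Rs : complex.Re (\sum_(i < n) a i) = \sum_(i < n) complex.Re (a i).
  by elim/big_rec2: _ => // i y z _ <-; rewrite ReD.
have Is : complex.Im (\sum_(i < n) a i) = \sum_(i < n) complex.Im (a i).
  by elim/big_rec2: _ => // i y z _ <-; rewrite ImD.
apply: le_trans (normc_le_ReIm _) _; rewrite ReD ImD ReN ImN Rs Is /=.
have := H1 n n1; have := H2 n n2; lra.
Qed.

Lemma zcvg_exists f (C rho : R) : 0 <= rho -> rho < 1 ->
  (forall n : int, normc (f n) <= C * rho ^+ `|n|%N) -> exists l, zcvg f l.
Proof.
move=> r0 r1 hf.
have [l1 h1] := @geometric_ccvg (fun i => f i%:Z) C rho r0 r1 (fun i => hf i%:Z).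
have [l2 h2] := @geometric_ccvg (fun i => f (- i.+1%:Z)) (C * rho) rho r0 r1
   (fun i => ltac:(by have := hf (- i.+1%:Z); rewrite abszN /= exprS mulrA)).
exists (l1 + l2) => eps e0.
have e2 : 0 < eps / 2 by rewrite divr_gt0.
have [N1 H1] := h1 _ e2; have [N2 H2] := h2 _ e2; exists (maxn N1 N2) => A B.
rewrite !geq_max => /andP[a1 a2] /andP[b1 b2].
rewrite zsumE opprD addrACA; apply: le_trans (normc_le_add _ _) _.
have := H1 B b1; have := H2 A a2; lra.
Qed.

End Limits.

(** * Euler's pentagonal number theorem in finite form *)

Section Pentagonal.
Variables (K : comNzRingType) (q : K).

(** The quotient (q)_n / (q)_s of q-Pochhammer symbols, as a product so that it makes sense in any
    commutative ring. *)
Definition qfact (s n : nat) := \prod_(s <= i < n) (1 - q ^+ i.+1).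

(* Shanks's finite version of Euler's pentagonal number theorem. *)
Definition shanks (n : nat) :=
  \sum_(s < n.+1) (-1) ^+ s * qfact s n * q ^+ (s * n + 'C(s.+1, 2)).

Lemma shanks_rec n : shanks n.+1 = shanks n +
  (-1) ^+ n.+1 * (q ^+ (n.+1 * n.+1 + 'C(n.+1, 2)) + q ^+ (n.+1 * n.+1 + 'C(n.+2, 2))).
Proof.
have binS m : 'C(m.+1, 2) = (m + 'C(m, 2))%N by rewrite binS bin1 addnC.
rewrite {1}/shanks big_ord_recr /=.
(* Replacing [n] by n + 1 in a summand subtracts [V s + U s]: [U] comes from the new factor 1 -
   q^(n+1), [V] from the extra power q^s. As V 0 = 0 and V (s + 1) = - U s, only [U n] survives
   summation. *)
pose U s := (-1) ^+ s * qfact s n * q ^+ (s.+1 * n.+1 + 'C(s.+1, 2)).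
pose V s := (-1) ^+ s * qfact s n * (1 - q ^+ s) * q ^+ (s * n + 'C(s.+1, 2)).
have hterm (s : 'I_n.+1) : (-1) ^+ s * qfact s n.+1 * q ^+ (s * n.+1 + 'C(s.+1, 2)) =
   (-1) ^+ s * qfact s n * q ^+ (s * n + 'C(s.+1, 2)) - (V s + U s).
  rewrite /U /V /qfact (big_nat_recr n) //=; last by rewrite -ltnS.
  have -> : (s * n.+1 + 'C(s.+1, 2) = s + (s * n + 'C(s.+1, 2)))%N by rewrite mulnS addnA.
  have -> : (s.+1 * n.+1 + 'C(s.+1, 2) = s + n.+1 + (s * n + 'C(s.+1, 2)))%N by lia.
  rewrite !exprD; ring.
have hVU : \sum_(s < n.+1) (V s + U s) = U n.
  rewrite big_split /= (big_ord_recl n) (big_ord_recr n) /= {1}/V expr0 subrr mulr0 mul0r add0r.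
  rewrite addrA -big_split /= big1 ?add0r // => i _.
  rewrite /V /U /bump add1n exprS.
  have -> : qfact i n = (1 - q ^+ i.+1) * qfact i.+1 n by rewrite /qfact big_ltn.
  have -> : (i.+1 * n + 'C(i.+2, 2) = i.+1 * n.+1 + 'C(i.+1, 2))%N.
    by rewrite binS mulnS; lia.
  ring.
rewrite (eq_bigr _ (fun s _ => hterm s)) sumrB hVU -/(shanks n) /U /qfact.
rewrite !big_geq // !mulr1 exprS; ring.
Qed.

Lemma shanksE n : shanks n = 1 + \sum_(i < n)
  (-1) ^+ i.+1 * (q ^+ (i.+1 * i.+1 + 'C(i.+1, 2)) + q ^+ (i.+1 * i.+1 + 'C(i.+2, 2))).
Proof.
elim: n => [|n IH].
  by rewrite /shanks big_ord0 big_ord1 /qfact big_geq // !expr0 !mul1r addr0.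
by rewrite shanks_rec IH big_ord_recr /= addrA.
Qed.

Lemma shanks_split n : shanks n = qfact 0 n +
  \sum_(s < n) (-1) ^+ s.+1 * qfact s.+1 n * q ^+ (s.+1 * n + 'C(s.+2, 2)).
Proof. by rewrite /shanks big_ord_recl /= expr0 !mul1r mulr1. Qed.

End Pentagonal.

Section EtaSeries.
Variable R : realType.
Implicit Types (z w tau q : R[i]).

Lemma eD z w : e (z + w) = e z * e w.
Proof. by rewrite /e mulrDr cexpD. Qed.

Lemma e0 : e 0 = 1 :> R[i].
Proof. by rewrite /e mulr0 cexp0. Qed.

Lemma eN z : e (- z) = (e z)^-1.
Proof. by rewrite /e mulrN cexpN. Qed.

Lemma e_neq0 z : e z != 0.
Proof. exact: cexp_neq0. Qed.

Lemma eX z n : e (z *+ n) = e z ^+ n.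
Proof. by rewrite /e mulrnAr cexpX. Qed.

Lemma normc_e z : normc (e z) = expR (- (2 * pi * complex.Im z)).
Proof.
rewrite /e normc_cexp; congr expR; rewrite complex_natr; case: z => a b /=.
rewrite !(mul0r, mulr0, mulr1, mul1r, subr0, addr0, add0r, sub0r, oppr0); ring.
Qed.

Lemma normc_eR (x : R) : normc (e x%:C) = 1.
Proof. by rewrite normc_e /= mulr0 oppr0 expR0. Qed.

Lemma eR (x : R) : e x%:C = cos (2 * pi * x) +i* sin (2 * pi * x).
Proof.
rewrite /e /cexp; have -> : 2%:R * pi%:C * 'i%C * x%:C = 0 +i* (2 * pi * x).
  rewrite complex_natr; apply/eqP; rewrite eq_complex /=.
  by rewrite !(mul0r, mulr0, mulr1, mul1r, subr0, addr0, add0r, sub0r, oppr0) !eqxx.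
by rewrite /= expR0 mul1r.
Qed.

Lemma e_int (n : int) : e n%:~R = 1 :> R[i].
Proof.
have e1 : e 1 = 1 :> R[i].
  by have := eR 1; rewrite rmorph1 mulr1 mulr_natl cos2pi sin2pi.
have enat (m : nat) : e m%:R = 1 :> R[i] by rewrite eX e1 expr1n.
case: n => n; first exact: enat.
by rewrite NegzE mulrNz eN enat invr1.
Qed.

Lemma eDint z (n : int) : e (z + n%:~R) = e z.
Proof. by rewrite eD e_int mulr1. Qed.

Lemma geometric_small (C rho : R) : 0 <= rho -> rho < 1 ->
  forall eps, 0 < eps -> exists N, forall n, (N <= n)%N -> C * rho ^+ n <= eps.
Proof.
move=> r0 r1 eps e0.
have /cvgrPdist_le /(_ _ e0) [N _ H] : (geometric C rho @ \oo --> (0 : R))%classic.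
  by apply: cvg_geometric; rewrite ger0_norm.
exists N => n hn; have := H n hn; rewrite /= sub0r normrN.
by apply: le_trans; exact: ler_norm.
Qed.

Lemma geometric_sum_le (rho : R) n : 0 <= rho -> rho < 1 ->
  \sum_(i < n) rho ^+ i <= (1 - rho)^-1.
Proof.
move=> r0 r1; have h : 0 < 1 - rho by lra.
rewrite -[leRHS]mul1r ler_pdivlMr //; have := subrX1 rho n; move: (\sum_(i < n) _) => s hs.
have : 0 <= rho ^+ n by rewrite exprn_ge0.
nra.
Qed.

Lemma normc_qfact_le q s n : normc q < 1 ->
  normc (qfact q s n) <= expR ((1 - normc q)^-1).
Proof.
move=> q1; have q0 := normc_ge0 q.
apply: (@le_trans _ _ (\prod_(s <= i < n) expR (normc q ^+ i.+1))).
  rewrite /qfact; elim/big_rec2: _ => [|i y z _ h].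
    by rewrite ComplexField.Normc.normc1.
  rewrite normcM; apply: ler_pM; rewrite ?normc_ge0 //.
  apply: le_trans (normc_le_add _ _) _.
  rewrite normc_opp normcX ComplexField.Normc.normc1; exact: expR_ge1Dx.
have -> : \prod_(s <= i < n) expR (normc q ^+ i.+1) =
    expR (\sum_(s <= i < n) normc q ^+ i.+1).
  by elim/big_rec2: _ => [|i y z _ ->]; rewrite ?expR0 // expRD.
rewrite ler_expR; apply: le_trans (geometric_sum_le n q0 q1).
rewrite -(big_mkord xpredT (fun i => normc q ^+ i)).
apply: (@le_trans _ _ (\sum_(s <= i < n) normc q ^+ i)).
  apply: ler_sum => i _; rewrite exprS ler_piMl ?exprn_ge0 //; exact: ltW.
have [sn|sn] := leqP s n; last by rewrite (big_geq (ltnW sn)) sumr_ge0 // => i _; rewrite exprn_ge0.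
by rewrite (big_cat_nat (leq0n s) sn) /= lerDr sumr_ge0 // => i _; rewrite exprn_ge0.
Qed.

(** Every summand of [shanks] with s >= 1 carries a power of q of exponent at least n + (s - 1), so
    the partial Euler products and the partial pentagonal sums have the same limit. *)
Lemma normc_qfact_sub_shanks q n : normc q < 1 ->
  normc (qfact q 0 n - shanks q n) <=
    expR ((1 - normc q)^-1) * (1 - normc q)^-1 * normc q ^+ n.
Proof.
move=> q1; have q0 := normc_ge0 q.
rewrite shanks_split opprD addNKr normc_opp.
apply: le_trans (normc_sum _ _ _) _.
apply: (@le_trans _ _ (\sum_(i < n) normc q ^+ i * (expR (1 - normc q)^-1 * normc q ^+ n))).
  apply: ler_sum => i _; rewrite !normcM !normcX normc_opp ComplexField.Normc.normc1 expr1n mul1r.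
  rewrite mulrCA; apply: ler_pM; rewrite ?normc_ge0 ?exprn_ge0 ?normc_qfact_le //.
  rewrite -exprD; apply: ler_wiXn2l => //; first exact: ltW.
  have := ltn_ord i; nia.
rewrite -mulr_suml mulrAC [leRHS]mulrC; apply: ler_wpM2r; last exact: geometric_sum_le.
by rewrite mulr_ge0 ?expR_ge0 ?exprn_ge0.
Qed.

(** The pentagonal exponent with the factor q^(1/24) of eta absorbed: s (3s + 1) / 2 + 1/24 = (6s +
    1)^2 / 24. *)
Definition etaterm tau (s : int) : R[i] :=
  (-1) ^+ `|s|%N * e (((6 * s + 1) ^+ 2)%:~R * (tau / 24%:R)).

Lemma normc_etaterm tau s : 0 < complex.Im tau ->
  normc (etaterm tau s) <= 1 * expR (- (2 * pi * complex.Im tau)) ^+ `|s|%N.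
Proof.
move=> t0; rewrite mul1r /etaterm normcM normcX normc_opp ComplexField.Normc.normc1 expr1n mul1r.
rewrite normc_e -expRM_natl ler_expR.
have -> : complex.Im (((6 * s + 1) ^+ 2)%:~R * (tau / 24%:R)) =
   ((6 * s + 1) ^+ 2)%:~R * (complex.Im tau / 24).
  have -> : (24%:R : R[i])^-1 = (24^-1 : R)%:C by rewrite complex_natr fmorphV.
  rewrite complex_intr; case: (tau) => a b /=.
  by rewrite !(mul0r, mulr0, addr0, add0r).
have h : (24 * `|s|%N%:~R : R) <= ((6 * s + 1) ^+ 2)%:~R.
  by rewrite -[24]/(24%:~R) -intrM ler_int; nia.
have p0 : 0 < pi :> R by exact: pi_gt0.
rewrite mulrN lerN2.
have := mulr_gt0 p0 t0.
move: h; rewrite -[(`|s|%N%:~R)]/(`|s|%N%:R).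
move: (((6 * s + 1) ^+ 2)%:~R) (`|s|%N%:R) (complex.Im tau) (pi : R) => x y w p h w0; nra.
Qed.

Lemma eta_zcvg tau : 0 < complex.Im tau -> zcvg (etaterm tau) (eta tau).
Proof.
move=> t0; set rho := expR (- (2 * pi * complex.Im tau)).
have rho0 : 0 <= rho by exact: expR_ge0.
have rho1 : rho < 1.
  by rewrite /rho -[ltRHS]expR0 ltr_expR oppr_lt0 !mulr_gt0 // pi_gt0.
have [l hl] := zcvg_exists rho0 rho1 (fun s => normc_etaterm s t0).
suff -> : eta tau = l by [].
have ne := e_neq0 (tau / 24%:R).
(* A bare [lim] says nothing about convergence. The limit [l] of the series is known to exist, so l
   / e(tau / 24) serves as the candidate to which the partial products are shown to converge. *)
transitivity (e (tau / 24%:R) * ((e (tau / 24%:R))^-1 * l)); last by rewrite mulVKf.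
congr (_ * _); apply: ccvg_lim.
set q := e tau.
have q1 : normc q = rho by rewrite /q normc_e.
have hsh n : zsum n n.+1 (etaterm tau) = e (tau / 24%:R) * shanks q n.
  have hpow m : e ((1 + 24 * m)%N%:R * (tau / 24%:R)) = e (tau / 24%:R) * q ^+ m.
    rewrite /q -eX -eD; congr e; rewrite natrD natrM -(mulr_natl tau).
    by field.
  rewrite zsumE big_ord_recl shanksE mulrDr mulr1.
  have -> : etaterm tau 0 = e (tau / 24%:R) by rewrite /etaterm expr0 mulr0 add0r expr1n !mul1r.
  rewrite -addrA; congr (_ + _); rewrite -big_split mulr_sumr; apply: eq_bigr => i _.
  rewrite /etaterm abszN /= /bump leq0n add1n -mulrDr [RHS]mulrCA; congr (_ * _); rewrite addrC.
  have bin2E m : (2 * 'C(m.+1, 2) = m * m.+1)%N.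
    by rewrite -(mul_bin_diag m.+1 1) /= bin1 mulnC.
  have h1 : (6 * - i.+1%:Z + 1) ^+ 2 = (1 + 24 * (i.+1 * i.+1 + 'C(i.+1, 2)))%N.
    by have := bin2E i; nia.
  have h2 : (6 * i.+1%:Z + 1) ^+ 2 = (1 + 24 * (i.+1 * i.+1 + 'C(i.+2, 2)))%N.
    by have := bin2E i.+1; nia.
  by rewrite mulrDr -!hpow h1 h2 -!pmulrn.
move=> eps eps0.
have en0 : 0 < normc (e (tau / 24%:R)) by rewrite normc_e expR_gt0.
have e2 : 0 < eps / 2 by rewrite divr_gt0.
have e3 : 0 < (eps / 2) * normc (e (tau / 24%:R)) by rewrite mulr_gt0.
have [N1 H1] := hl _ e3.
have [N2 H2] := geometric_small (expR ((1 - rho)^-1) * (1 - rho)^-1) rho0 rho1 e2.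
(* The product over 1 <= i < N has N - 1 factors, so the index [n.+1] matches [qfact q 0 n]. *)
exists (maxn N1 N2).+1 => -[//|n]; rewrite ltnS geq_max => /andP[n1 n2].
rewrite big_add1 /= -/(qfact q 0 n).
have -> : qfact q 0 n - (e (tau / 24%:R))^-1 * l =
   (qfact q 0 n - shanks q n) + (e (tau / 24%:R))^-1 * (zsum n n.+1 (etaterm tau) - l).
  by rewrite hsh mulrBr mulKf //; ring.
apply: le_trans (normc_le_add _ _) _.
have hq1 : normc q < 1 by rewrite q1.
have k1 := normc_qfact_sub_shanks n hq1; rewrite q1 in k1.
have k2 := H1 n n.+1 n1 (leqW n1).
have k3 := H2 n n2.
rewrite normcM ComplexField.Normc.normcV.
have k4 : (normc (e (tau / 24%:R)))^-1 * normc (zsum n n.+1 (etaterm tau) - l) <= eps / 2.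
  by rewrite mulrC ler_pdivrMr.
lra.
Qed.
End EtaSeries.

(** * Poisson summation for complex Gaussians *)

Fact gauss_key : unit. Proof. by []. Qed.

Section Gauss.
Variable R : realType.
Implicit Types (z w p d lam v : R[i]) (x y h : R).

(** Locked to keep conversion from unfolding the exponential; [gaussE] opens it. *)
Definition gauss := locked_with gauss_key (fun v : R[i] => cexp (- (pi%:C * v ^+ 2))).

Lemma gaussE v : gauss v = cexp (- (pi%:C * v ^+ 2)).
Proof. by rewrite /gauss unlock. Qed.

Lemma normc_gauss_le (kappa L P : R) p lam y :
  kappa <= complex.Re (lam ^+ 2) -> normc lam <= L -> normc p <= P ->
  normc (gauss (p + lam * y%:C)) <=
    expR (pi * (P ^+ 2 + 2 * P * L * `|y|) - pi * kappa * y ^+ 2).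
Proof.
move=> hk hl hp; rewrite gaussE normc_cexp ler_expR.
have -> : complex.Re (- (pi%:C * (p + lam * y%:C) ^+ 2)) =
  - (pi * (complex.Re (p ^+ 2) + 2 * y * complex.Re (p * lam) + y ^+ 2 * complex.Re (lam ^+ 2))).
  case: p {hp} => a b; case: lam {hk hl} => c d /=; rewrite !mul0r; ring.
have nl := normc_ge0 lam; have np := normc_ge0 p; have p0 : 0 < pi :> R by exact: pi_gt0.
have h1 : `|complex.Re (p ^+ 2)| <= P ^+ 2.
  apply: le_trans (normc_Re _) _; rewrite normcX lerXn2r ?nnegrE //; exact: le_trans hp.
have h2 : `|complex.Re (p * lam)| <= P * L.
  by apply: le_trans (normc_Re _) _; rewrite normcM; apply: ler_pM.
have h3 : - (2 * P * L * `|y|) <= 2 * y * complex.Re (p * lam).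
  have : `|2 * y * complex.Re (p * lam)| <= 2 * P * L * `|y|.
    rewrite !normrM (ger0_norm (ler0n _ 2)) -!mulrA ler_pM2l // mulrC mulrA.
    exact: ler_wpM2r.
  by rewrite ler_norml => /andP[].
have h4 : - P ^+ 2 <= complex.Re (p ^+ 2) by move: h1; rewrite ler_norml => /andP[].
have h5 : y ^+ 2 * kappa <= y ^+ 2 * complex.Re (lam ^+ 2).
  by apply: ler_wpM2l => //; exact: sqr_ge0.
have : 0 <= pi * ((complex.Re (p ^+ 2) + P ^+ 2) +
    (2 * y * complex.Re (p * lam) + 2 * P * L * `|y|) +
    (y ^+ 2 * complex.Re (lam ^+ 2) - y ^+ 2 * kappa)).
  apply: mulr_ge0; first exact: ltW.
  lra.
lra.
Qed.

Lemma gauss_absorb (k a b y : R) : 0 < k ->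
  expR (- (k * y ^+ 2) + a * `|y| + b) <= expR (b + (a + 2) ^+ 2 / (4 * k)) * expR (- 2 * `|y|).
Proof.
move=> k0; rewrite -expRD ler_expR -[y ^+ 2]real_normK ?num_real //.
move: `|y| => u.
have : 0 <= (2 * k * u - (a + 2)) ^+ 2 / (4 * k).
  by rewrite mulr_ge0 ?sqr_ge0 // invr_ge0; lra.
have -> : (2 * k * u - (a + 2)) ^+ 2 / (4 * k) = k * u ^+ 2 - (a + 2) * u + (a + 2) ^+ 2 / (4 * k).
  by field; lra.
lra.
Qed.

(** Uniform over slopes [lam] with Re (lam^2) bounded below and over bounded offsets [p], as a
    homotopy in [lam] requires. The spare factor exp(j |y|) pays for polynomial factors in [y],
    through [onep_le_exp]. *)
Lemma gauss_decay (kappa L P : R) (j : nat) : 0 < kappa -> exists2 C : R, 0 < C &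
  forall p lam y, kappa <= complex.Re (lam ^+ 2) -> normc lam <= L -> normc p <= P ->
  normc (gauss (p + lam * y%:C)) * expR (j%:R * `|y|) <= C * expR (- 2 * `|y|).
Proof.
move=> k0; have p0 : 0 < pi :> R by exact: pi_gt0.
eexists; last first.
  move=> p lam y h1 h2 h3.
  apply: le_trans (ler_wpM2r (expR_ge0 _) (normc_gauss_le y h1 h2 h3)) _.
  have pk : 0 < pi * kappa by exact: mulr_gt0.
  apply: le_trans (gauss_absorb (pi * 2 * P * L + j%:R) (pi * P ^+ 2) y pk).
  rewrite -expRD ler_expR; lra.
exact: expR_gt0.
Qed.

Lemma onep_le_exp (u : R) : 0 <= u -> (1 + u) ^+ 2 <= expR (2 * u).
Proof.
move=> u0; rewrite expRM_natl.
by rewrite lerXn2r ?nnegrE ?expR_ge0 ?expR_ge1Dx //; lra.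
Qed.

Lemma gaussD v d : gauss (v + d) = gauss v * cexp (- (pi%:C * (2%:R * v * d + d ^+ 2))).
Proof. by rewrite !gaussE -cexpD; congr cexp; ring. Qed.

(** The derivative of exp(-pi v^2) is -2 pi v exp(-pi v^2), so this is its second-order Taylor
    bound. The increment may grow linearly in [y] because the homotopy rotates the line along which
    the Gaussian is summed. *)
Lemma gauss_taylor (kappa L P D : R) : 0 < kappa -> 0 <= L -> 0 <= P -> 0 <= D ->
  exists C h0 : R, [/\ 0 < C, 0 < h0 &
  forall p lam y d h, kappa <= complex.Re (lam ^+ 2) -> normc lam <= L -> normc p <= P ->
  normc d <= D * (1 + `|y|) -> 0 <= h -> h <= h0 ->
  let v := p + lam * y%:C in
  normc (gauss (v + h%:C * d) - gauss v + 2%:R * pi%:C * v * (h%:C * d) * gauss v) <=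
    C * h ^+ 2 * expR (- 2 * `|y|)].
Proof.
move=> k0 L0 P0 D0; have p0 : 0 < pi :> R by exact: pi_gt0.
have pk : 0 < pi * kappa by exact: mulr_gt0.
have hA : 0 <= 2 * (P + L) * D + D ^+ 2.
  by rewrite addr_ge0 ?sqr_ge0 // !mulr_ge0 // addr_ge0.
(* [K] is such that the exponent [z] of the increment satisfies |z| <= h K (1 + y^2). The bound on
   [h] keeps h K below pi kappa / 2, so that exp |z| consumes half of the Gaussian decay; [C1] is
   what [gauss_absorb] gives with the other half. *)
pose K := 2 * pi * (2 * (P + L) * D + D ^+ 2).
have K0 : 0 <= K.
  by rewrite /K mulr_ge0 // mulr_ge0 // ltW.
have K1 : 0 < 2 * (K + 1) by lra.
pose C0 := 64 * K ^+ 2 + pi * D ^+ 2 + 1.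
pose C1 := expR ((pi * P ^+ 2 + pi * kappa / 2) + ((2 * pi * P * L + 2) + 2) ^+ 2 / (4 * (pi * kappa / 2))).
have C00 : 0 < C0.
  rewrite /C0; have := mulr_ge0 (ltW p0) (sqr_ge0 D); have := sqr_ge0 K; lra.
exists (C0 * C1), (Num.min 1 (pi * kappa / (2 * (K + 1)))); split.
- by rewrite mulr_gt0 // expR_gt0.
- by rewrite lt_min ltr01 /= divr_gt0.
move=> p lam y d h h1 h2 h3 h4 hh0 hh /=.
set v := p + lam * y%:C; pose u := `|y|; have u0 : 0 <= u by exact: normr_ge0.
have hh1 : h <= 1 by move: hh; rewrite le_min => /andP[].
have hK : h * K <= pi * kappa / 2.
  move: hh; rewrite le_min => /andP[_]; rewrite ler_pdivlMr // => hh.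
  nra.
set z := - (pi%:C * (2%:R * v * (h%:C * d) + (h%:C * d) ^+ 2)).
have -> : gauss (v + h%:C * d) - gauss v + 2%:R * pi%:C * v * (h%:C * d) * gauss v =
   gauss v * ((cexp z - 1 - z) - pi%:C * (h%:C * d) ^+ 2).
  by rewrite gaussD -/z {3}/z; ring.
rewrite normcM.
have nv : normc v <= (P + L) * (1 + u).
  apply: le_trans (normc_le_add _ _) _; rewrite normcM normcR -/u.
  have := ler_wpM2r u0 h2; nra.
have nd := normc_ge0 d; have nv0 := normc_ge0 v.
have hz : normc z <= h * K * (1 + u ^+ 2).
  rewrite /z normc_opp normcM normcR (gtr0_norm p0).
  have t1 : normc (2%:R * v * (h%:C * d) + (h%:C * d) ^+ 2) <=
     h * ((2 * (P + L) * D + D ^+ 2) * (1 + u) ^+ 2).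
    apply: le_trans (normc_le_add _ _) _.
    rewrite normcX !normcM normcR complex_natr normcR (ger0_norm hh0) ger0_norm //.
    have a1 : normc v * normc d <= ((P + L) * (1 + u)) * (D * (1 + u)) by apply: ler_pM.
    have a2 : normc d ^+ 2 <= (D * (1 + u)) ^+ 2.
      by rewrite lerXn2r ?nnegrE // mulr_ge0 // addr_ge0.
    have a3 : (h * normc d) ^+ 2 <= h * (D * (1 + u)) ^+ 2.
      rewrite exprMn; apply: le_trans (ler_wpM2l (sqr_ge0 h) a2) _.
      apply: ler_wpM2r; first exact: sqr_ge0.
      by rewrite expr2 ler_piMl.
    have a4 := ler_wpM2l hh0 a1.
    lra.
  apply: le_trans (ler_wpM2l (ltW p0) t1) _.
  rewrite /K.
  have t2 : (1 + u) ^+ 2 <= 2 * (1 + u ^+ 2) by have := sqr_ge0 (1 - u); lra.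
  have t3 : 0 <= pi * h * (2 * (P + L) * D + D ^+ 2).
    by rewrite !mulr_ge0 // ltW.
  have := ler_wpM2l t3 t2; lra.
have nz := normc_ge0 z.
have e2u := expR_ge0 (2 * u).
have hu : 1 + u ^+ 2 <= 4 * expR u.
  have -> : expR u = expR (2 * (u / 2)) by congr expR; field.
  have := onep_le_exp (_ : 0 <= u / 2); rewrite divr_ge0 // => /(_ isT); lra.
have hu2 : (1 + u ^+ 2) ^+ 2 <= 16 * expR (2 * u).
  have -> : 16 * expR (2 * u) = (4 * expR u) ^+ 2 by rewrite expRM_natl; ring.
  by rewrite lerXn2r ?nnegrE ?mulr_ge0 ?expR_ge0 ?addr_ge0 ?sqr_ge0.
pose F := expR (pi * kappa / 2 * (1 + u ^+ 2)).
have F1 : 1 <= F.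
  rewrite /F -[leLHS]expR0 ler_expR; apply: mulr_ge0; first lra.
  by rewrite addr_ge0 // sqr_ge0.
have b1 : normc (cexp z - 1 - z) <= 64 * K ^+ 2 * h ^+ 2 * expR (2 * u) * F.
  apply: le_trans (normc_cexp_sub_le z) _.
  apply: ler_pM; rewrite ?expR_ge0 ?mulr_ge0 ?sqr_ge0 //.
    have : normc z ^+ 2 <= (h * K * (1 + u ^+ 2)) ^+ 2.
      by rewrite lerXn2r ?nnegrE // (le_trans nz hz).
    have := ler_wpM2l (sqr_ge0 (h * K)) hu2; lra.
  rewrite /F ler_expR; apply: le_trans hz _; apply: ler_wpM2r => //.
  by rewrite addr_ge0 // sqr_ge0.
have b2 : normc (pi%:C * (h%:C * d) ^+ 2) <= pi * D ^+ 2 * h ^+ 2 * expR (2 * u).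
  rewrite normcM normcX normcM !normcR (gtr0_norm p0) (ger0_norm hh0).
  have c1 := onep_le_exp u0.
  have c2 : normc d ^+ 2 <= (D * (1 + u)) ^+ 2.
    by rewrite lerXn2r ?nnegrE // mulr_ge0 // addr_ge0.
  have c3 : 0 <= pi * h ^+ 2 by rewrite mulr_ge0 ?sqr_ge0 // ltW.
  have := ler_wpM2l c3 c2.
  have := ler_wpM2l (mulr_ge0 c3 (sqr_ge0 D)) c1; lra.
have b3 : normc ((cexp z - 1 - z) - pi%:C * (h%:C * d) ^+ 2) <= C0 * h ^+ 2 * expR (2 * u) * F.
  apply: le_trans (normc_le_add _ _) _; rewrite normc_opp.
  have c3 : 0 <= pi * D ^+ 2 * h ^+ 2 * expR (2 * u) by rewrite !mulr_ge0 ?sqr_ge0 // ltW.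
  have c4 := ler_wpM2l c3 F1.
  have c5 : 0 <= h ^+ 2 * expR (2 * u) * F by rewrite !mulr_ge0 ?sqr_ge0 ?expR_ge0.
  rewrite /C0; lra.
have b4 := normc_gauss_le y h1 h2 h3; rewrite -/v -/u in b4.
apply: le_trans (ler_pM (normc_ge0 _) (normc_ge0 _) b4 b3) _.
have b5 : expR (pi * (P ^+ 2 + 2 * P * L * u) - pi * kappa * y ^+ 2) * (expR (2 * u) * F) <=
    C1 * expR (- 2 * `|y|).
  apply: le_trans (gauss_absorb (2 * pi * P * L + 2) (pi * P ^+ 2 + pi * kappa / 2) y _); last lra.
  rewrite /F -!expRD ler_expR /u real_normK ?num_real //; lra.
have := ler_wpM2l (mulr_ge0 (ltW C00) (sqr_ge0 h)) b5; lra.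
Qed.

End Gauss.

(** * Riemann sums of Gaussians along a moving line *)

Section GaussRiemann.
Variable R : realType.
Implicit Types (z w p d lam v : R[i]) (x y h s : R).

(** The geometric series has sum 1 / (1 - exp(-1/N)), at most N + 1 because exp(1/N) >= 1 + 1/N.
    Multiplied by the mesh 1/N it stays bounded. *)
Lemma geometric_exp_le (N n : nat) : (0 < N)%N ->
  \sum_(i < n) expR (- (i%:R / N%:R)) <= N.+1%:R :> R.
Proof.
move=> N0; have n0 : 0 < N%:R :> R by rewrite ltr0n.
have h : (fun i : nat => expR (- (i%:R / N%:R)) : R) =1 (fun i => expR (- N%:R^-1) ^+ i).
  by move=> i; rewrite -expRM_natl mulrN.
rewrite (eq_bigr (fun i : 'I_n => expR (- N%:R^-1 : R) ^+ i)); last by move=> i _; exact: h.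
have r1 : expR (- N%:R^-1 : R) < 1 by rewrite -[ltRHS]expR0 ltr_expR oppr_lt0 invr_gt0.
apply: le_trans (geometric_sum_le _ (expR_ge0 _) r1) _.
rewrite -[leLHS]mul1r ler_pdivrMr ?subr_gt0 //.
have e1 : expR (- N%:R^-1 : R) * (1 + N%:R^-1) <= 1.
  rewrite expRN mulrC ler_pdivrMr ?expR_gt0 // mul1r; exact: expR_ge1Dx.
rewrite mulrBr mulr1 -natr1.
have : expR (- N%:R^-1 : R) * (N%:R + 1) <= N%:R.
  have -> : (N%:R + 1 : R) = (1 + N%:R^-1) * N%:R by rewrite mulrDl mulVf ?gt_eqF // mul1r.
  by rewrite mulrA ler_piMl // ltW.
lra.
Qed.

Lemma zsum_exp_le (N A B : nat) : (0 < N)%N ->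
  zsum A B (fun m => expR (- `|m%:~R / N%:R : R|)) <= 2 * N.+1%:R.
Proof.
move=> N0; rewrite zsumE mulr_natl mulr2n; apply: lerD.
  apply: le_trans (geometric_exp_le B N0); apply: ler_sum => i _.
  by rewrite -pmulrn ger0_norm // divr_ge0.
apply: le_trans (geometric_exp_le A N0); apply: ler_sum => i _.
rewrite mulrNz mulNr normrN -pmulrn ger0_norm ?divr_ge0 //.
by rewrite ler_expR lerN2 ler_pM2r ?invr_gt0 ?ltr0n // ler_nat.
Qed.

Lemma ler_zsum (A B : nat) (f g : int -> R) :
  (forall m, f m <= g m) -> zsum A B f <= zsum A B g.
Proof. by move=> h; apply: ler_sum. Qed.

Lemma zsumMl (K : pzRingType) (A B : nat) (c : K) (f : int -> K) :
  zsum A B (fun n => c * f n) = c * zsum A B f.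
Proof. by rewrite /zsum mulr_sumr. Qed.

Lemma normc_zsum (A B : nat) (f : int -> R[i]) :
  normc (zsum A B f) <= zsum A B (fun m => normc (f m)).
Proof. exact: normc_sum. Qed.

Lemma exp_absorb1 (u : R) : 0 <= u -> (1 + u) * expR (- 2 * u) <= expR (- u).
Proof.
move=> u0; have -> : expR (- 2 * u) = expR (- u) * expR (- u) by rewrite -expRD; congr expR; ring.
rewrite mulrA ler_piMl ?expR_ge0 // expRN ler_pdivrMr ?expR_gt0 // mul1r.
exact: expR_ge1Dx.
Qed.

Lemma exp2_le (u : R) : 0 <= u -> expR (- 2 * u) <= expR (- u).
Proof. by move=> u0; rewrite ler_expR; lra. Qed.

Section Homotopy.
Variables (lam v0 : R[i]).
Hypothesis lamP : `|complex.Im lam| < complex.Re lam.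

(** A homotopy from the line y to the line v0 + lam y: [line] has derivative [dir y] in s and
    [lams s] in y, so gauss(line) (lams dy + dir ds) is the pullback of the closed form gauss(v)
    dv. *)
Let lams s : R[i] := 1 + s%:C * (lam - 1).
Let dir y : R[i] := v0 + (lam - 1) * y%:C.
Let line s y : R[i] := s%:C * v0 + lams s * y%:C.

Let kappa : R := (Num.min 1 (complex.Re lam - `|complex.Im lam|)) ^+ 2.
Let L : R := 1 + normc lam.
Let P : R := normc v0.
Let D : R := 3 + normc v0 + normc lam.

Let nl : 0 <= normc lam. Proof. exact: normc_ge0. Qed.
Let nv : 0 <= normc v0. Proof. exact: normc_ge0. Qed.

Let kappa_gt0 : 0 < kappa.
Proof. by rewrite exprn_gt0 // lt_min ltr01 subr_gt0. Qed.

(** Re (w^2) = (Re w - Im w)(Re w + Im w). On the segment from 1 to lam each factor is a convex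
    combination of 1 and Re lam -+ Im lam, hence at least min(1, Re lam - |Im lam|). *)
Let lams_Re s : 0 <= s -> s <= 1 -> kappa <= complex.Re (lams s ^+ 2).
Proof.
move=> s0 s1; set m := Num.min 1 (complex.Re lam - `|complex.Im lam|).
have m1 : m <= 1 by rewrite ge_min lexx.
have m2 : m <= complex.Re lam - `|complex.Im lam| by rewrite ge_min lexx orbT.
have m0 : 0 < m by rewrite lt_min ltr01 subr_gt0.
have -> : complex.Re (lams s ^+ 2) =
  (1 + s * (complex.Re lam - 1) - s * complex.Im lam) * (1 + s * (complex.Re lam - 1) + s * complex.Im lam).
  rewrite /lams; case: lam => a b /=; ring.
have i1 := ler_norm (complex.Im lam).
have i3 : - complex.Im lam <= `|complex.Im lam| by rewrite -normrN ler_norm.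
have j1 := ler_wpM2l s0 m2; have j2 := ler_wpM2l s0 i1; have j3 := ler_wpM2l s0 i3.
have j4 : (1 - s) * m <= (1 - s) * 1 by apply: ler_wpM2l => //; lra.
rewrite /kappa -/m expr2; apply: ler_pM; rewrite ?(ltW m0) //; lra.
Qed.

Let lams_norm s : 0 <= s -> s <= 1 -> normc (lams s) <= L.
Proof.
move=> s0 s1; have -> : lams s = (1 - s)%:C + s%:C * lam.
  by rewrite /lams rmorphB rmorph1; ring.
apply: le_trans (normc_le_add _ _) _; rewrite normcM !normcR !ger0_norm //; last lra.
rewrite /L; have nl' := nl; have := mulr_ge0 s0 nl'; nra.
Qed.

Let lam1_norm : normc (lam - 1) <= L.
Proof.
apply: le_trans (normc_le_add _ _) _; rewrite normc_opp ComplexField.Normc.normc1 /L; lra.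
Qed.

Let dir_norm y : normc (dir y) <= D * (1 + `|y|).
Proof.
apply: le_trans (normc_le_add _ _) _; rewrite normcM normcR.
have := ler_wpM2r (normr_ge0 y) lam1_norm; rewrite /L /D.
have nl' := nl; have nv' := nv; have u0 := normr_ge0 y; have := mulr_ge0 nl' u0; have := mulr_ge0 nv' u0; lra.
Qed.

(** The circulation of the closed form around a grid square of side [h], with each edge evaluated at
    its lower end. *)
Let cell s y h : R[i] :=
  (gauss (line (s + h) y) * (h%:C * lams (s + h)) - gauss (line s y) * (h%:C * lams s))
  - (gauss (line s (y + h)) * (h%:C * dir (y + h)) - gauss (line s y) * (h%:C * dir y)).

(** The terms of order h^2 cancel because the form is closed. Two Taylor remainders, each times a
    factor [h], and one explicit term of order h^3 are left. *)
Let cellE s y h : let v := line s y in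
  let T d := gauss (v + h%:C * d) - gauss v + 2%:R * pi%:C * v * (h%:C * d) * gauss v in
  cell s y h = T (dir y) * (h%:C * lams (s + h)) - T (lams s) * (h%:C * dir (y + h))
    + 2%:R * pi%:C * v * (h ^+ 3)%:C * (lam - 1) * (lams s - dir y) * gauss v.
Proof.
move=> v T; rewrite /cell /T.
have -> : line (s + h) y = v + h%:C * dir y by rewrite /v /line /lams /dir !rmorphD; ring.
have -> : line s (y + h) = v + h%:C * lams s by rewrite /v /line /lams /dir !rmorphD; ring.
rewrite -/v.
have -> : lams (s + h) = lams s + h%:C * (lam - 1) by rewrite /lams rmorphD; ring.
have -> : dir (y + h) = dir y + h%:C * (lam - 1) by rewrite /dir rmorphD; ring.
rewrite rmorphXn; ring.
Qed.

Let line_norm s y : 0 <= s -> s <= 1 -> normc (line s y) <= (P + L) * (1 + `|y|).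
Proof.
move=> s0 s1; apply: le_trans (normc_le_add _ _) _; rewrite !normcM !normcR (ger0_norm s0).
have h1 : s * normc v0 <= P by rewrite /P ler_piMl.
have h2 := ler_wpM2r (normr_ge0 y) (lams_norm s0 s1).
have nl' := nl; have nv' := nv; have L0 : 0 <= L by rewrite /L; lra.
have := mulr_ge0 nv' (normr_ge0 y); rewrite /P in h1 *; lra.
Qed.

Let cell_bound : exists C h0 : R, [/\ 0 < C, 0 < h0 & forall s y h,
  0 <= s -> s <= 1 -> 0 <= h -> h <= h0 ->
  normc (cell s y h) <= C * h ^+ 3 * expR (- `|y|)].
Proof.
have nl' := nl; have nv' := nv; have L0 : 0 <= L by rewrite /L; lra.
have D0 : 0 <= D by rewrite /D; lra.
have p0 : 0 < pi :> R by exact: pi_gt0.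
have [C1 [h1 [C10 h10 T1]]] := gauss_taylor kappa_gt0 L0 nv D0.
have [C2 C20 T2] := @gauss_decay R kappa L P 2 kappa_gt0.
pose C3 := 2 * pi * (P + L) * L * (L + D) * C2.
have C30 : 0 <= C3.
  have a1 : 0 <= P + L by exact: addr_ge0.
  have a2 : 0 <= L + D by exact: addr_ge0.
  by rewrite /C3 !mulr_ge0 ?(ltW p0) ?(ltW C20).
exists (C1 * (L + L) + C1 * (D + D) + C3 + 1), (Num.min 1 h1); split.
- have := mulr_ge0 (ltW C10) L0; have := mulr_ge0 (ltW C10) D0; lra.
- by rewrite lt_min ltr01.
move=> s y h s0 s1 hh0; rewrite le_min => /andP[hh1 hh2].
have u0 := normr_ge0 y; set u := `|y| in u0 *.
have ps : normc (s%:C * v0) <= P by rewrite normcM normcR (ger0_norm s0) ler_piMl.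
have k1 := lams_Re s0 s1; have k2 := lams_norm s0 s1.
have k3 : normc (lams s) <= D * (1 + u).
  apply: le_trans k2 _; have := mulr_ge0 D0 u0; rewrite /D /L; lra.
have t1 := T1 _ _ y _ h k1 k2 ps (dir_norm y) hh0 hh2.
have t2 := T1 _ _ y _ h k1 k2 ps k3 hh0 hh2.
rewrite cellE /=; rewrite /= -/(line s y) -/u in t1 t2.
have hy : `|y + h| <= u + 1.
  by apply: le_trans (ler_normD _ _) _; rewrite (ger0_norm hh0) lerD2l.
have e20 := expR_ge0 (- 2 * u); have e10 := expR_ge0 (- u).
have e21 := exp2_le u0; have e22 := exp_absorb1 u0.
have Ch : 0 <= C1 * h ^+ 2 by rewrite mulr_ge0 ?sqr_ge0 // ltW.
have h3 : 0 <= h ^+ 3 by rewrite exprn_ge0.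
have A' : normc (h%:C * lams (s + h)) <= h * (L + L).
  rewrite normcM normcR (ger0_norm hh0); apply: ler_wpM2l => //.
  have -> : lams (s + h) = lams s + h%:C * (lam - 1) by rewrite /lams rmorphD; ring.
  apply: le_trans (normc_le_add _ _) _; apply: lerD => //.
  rewrite normcM normcR (ger0_norm hh0); apply: le_trans lam1_norm.
  by rewrite ler_piMl // normc_ge0.
have B' : normc (h%:C * dir (y + h)) <= h * ((D + D) * (1 + u)).
  rewrite normcM normcR (ger0_norm hh0); apply: ler_wpM2l => //.
  apply: le_trans (dir_norm _) _; have := ler_wpM2l D0 hy; have := mulr_ge0 D0 u0; lra.
have m1 := ler_pM (normc_ge0 _) (normc_ge0 _) t1 A'.
have m2 := ler_pM (normc_ge0 _) (normc_ge0 _) t2 B'.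
have m3 : normc (2%:R * pi%:C * line s y * (h ^+ 3)%:C * (lam - 1) * (lams s - dir y) * gauss (line s y)) <=
   C3 * h ^+ 3 * expR (- u).
  have g := T2 _ _ y k1 k2 ps; rewrite -/(line s y) -/u in g.
  have g2 : normc (gauss (line s y)) * (1 + u) ^+ 2 <= C2 * expR (- u).
    apply: le_trans (_ : C2 * expR (- 2 * u) <= _); last by rewrite ler_pM2l.
    by apply: le_trans g; apply: ler_wpM2l (onep_le_exp u0); exact: normc_ge0.
  move: (gauss _) g g2 => G g g2.
  rewrite !normcM complex_natr !normcR (ger0_norm h3) (gtr0_norm p0) ger0_norm //.
  have n1 := line_norm y s0 s1; rewrite -/u in n1.
  have n2 : normc (lams s - dir y) <= (L + D) * (1 + u).
    apply: le_trans (normc_le_add _ _) _; rewrite normc_opp.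
    have := dir_norm y; rewrite -/u; have := mulr_ge0 L0 u0; lra.
  have n3 := ler_pM (normc_ge0 _) (normc_ge0 _) n1 n2.
  have n4 := ler_pM (mulr_ge0 (normc_ge0 _) (normc_ge0 _)) (normc_ge0 _) n3 lam1_norm.
  have n5 := ler_wpM2r (normc_ge0 G) n4.
  have c0 : 0 <= 2 * pi * h ^+ 3 by rewrite !mulr_ge0 // ltW.
  have n6 := ler_wpM2l c0 n5.
  have c1 : 0 <= 2 * pi * h ^+ 3 * ((P + L) * (L + D) * L).
    by rewrite mulr_ge0 // !mulr_ge0 // addr_ge0 // /P.
  have n7 := ler_wpM2l c1 g2.
  rewrite /C3; lra.
apply: le_trans (normc_le_add _ _) _.
apply: le_trans (lerD (normc_le_add _ _) (lexx _)) _.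
rewrite normc_opp !(normcM _ (h%:C * _)).
have q1 := ler_wpM2l (mulr_ge0 Ch (mulr_ge0 hh0 (addr_ge0 L0 L0))) e21.
have q2 := ler_wpM2l (mulr_ge0 Ch (mulr_ge0 hh0 (addr_ge0 D0 D0))) e22.
have q3 := mulr_ge0 h3 e10.
lra.
Qed.

(** Mesh 1/N on the interval from -N to N + 1. Both ends of the window are multiples of N, so that
    the same window in [gcoef] can be split by [zsum_mod] with modulus N. *)
Definition riemann (N : nat) (mu w : R[i]) : R[i] :=
  N%:R^-1 * zsum (N * N) (N * N.+1) (fun m => gauss (w + mu * (m%:~R / N%:R)%:C)).

(* A discrete Cauchy theorem: [Q N 0] is [riemann N 1 0], [Q N 1] is
   [lam * riemann N lam v0], and each cell of side [1 / N] of the grid in [(s, y)]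
   contributes [O(N^-3 exp(- |y|))] to their difference. *)
Let Q (N : nat) s := lams s * riemann N (lams s) (s%:C * v0).

Let step_bound : exists (C : R) (N0 : nat), 0 < C /\ forall (N : nat) s, (N0 <= N)%N -> (0 < N)%N ->
  0 <= s -> s <= 1 -> normc (Q N (s + N%:R^-1) - Q N s) <= C / N%:R ^+ 2.
Proof.
have [C1 [h0 [C10 h00 H1]]] := cell_bound.
have nl' := nl; have nv' := nv; have L0 : 0 <= L by rewrite /L; lra.
have D0 : 0 <= D by rewrite /D; lra.
have [C2 C20 T2] := @gauss_decay R kappa L P 1 kappa_gt0.
have [N0 hN0] : exists N0 : nat, h0^-1 <= N0%:R.
  by exists (Num.bound h0^-1); rewrite ltW // archi_boundP // invr_ge0 ltW.
exists (C1 * 4 + (D * C2) * 2 + 1), N0; split.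
  by have := mulr_ge0 D0 (ltW C20); lra.
move=> N s hN Npos s0 s1.
have n0 : 0 < N%:R :> R by rewrite ltr0n.
set h := N%:R^-1 : R; have hpos : 0 < h by rewrite invr_gt0.
have hle : h <= h0.
  by rewrite /h -[leRHS]invrK lef_pV2 ?posrE ?invr_gt0 // (le_trans hN0) // ler_nat.
pose y (m : int) : R := m%:~R / N%:R.
have yS m : y (m + 1) = y m + h by rewrite /y intrD mulrDl mul1r.
pose bd (m : int) : R[i] := gauss (line s (y m)) * (h%:C * dir (y m)).
have QE r : Q N r = zsum (N * N) (N * N.+1) (fun m => gauss (line r (y m)) * (h%:C * lams r)).
  rewrite /Q /riemann mulrA mulrC /zsum mulr_suml; apply: eq_bigr => i _; congr (_ * _).
  by rewrite mulrC /h complex_natr fmorphV.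
(* Discrete Stokes formula: the change of [Q] is the sum of the cells plus the edges in direction s
   at the two ends, where |y| >= N. *)
have -> : Q N (s + h) - Q N s = zsum (N * N) (N * N.+1) (fun m => cell s (y m) h)
   + (bd (N * N.+1)%N%:Z - bd (- (N * N)%N%:Z)).
  rewrite -zsum_telescope -zsumD !QE -zsumB; apply: eq_zsum => m.
  by rewrite /bd yS /cell subrK.
have hb m : normc (bd m) <= h * (D * C2 * expR (- `|y m|)).
  rewrite /bd mulrCA normcM normcR (gtr0_norm hpos) (ler_pM2l hpos) normcM.
  have ps : normc (s%:C * v0) <= P by rewrite normcM normcR (ger0_norm s0) ler_piMl.
  have g := T2 _ _ (y m) (lams_Re s0 s1) (lams_norm s0 s1) ps; rewrite -/(line s (y m)) mul1r in g.
  apply: le_trans (ler_wpM2l (normc_ge0 _) (dir_norm _)) _.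
  have u0 := normr_ge0 (y m).
  have g1 := ler_wpM2l (normc_ge0 (gauss (line s (y m)))) (expR_ge1Dx `|y m|).
  have g2 := ler_wpM2l (ltW C20) (exp2_le u0).
  have g3 := ler_wpM2l D0 (le_trans g1 (le_trans g g2)); lra.
(* The end terms already carry one factor [h]; the crude bound exp(-N) <= 1/N supplies the second,
   which makes a single step O(1/N^2). *)
have hN1 (x : R) : N%:R <= x -> expR (- x) <= h.
  move=> hx; rewrite expRN lef_pV2 ?posrE ?expR_gt0 //.
  by apply: le_trans hx _; have := expR_ge1Dx x; lra.
have b1 : normc (bd (N * N.+1)%N%:Z) <= h * (D * C2 * h).
  apply: le_trans (hb _) _; apply: ler_wpM2l; first exact: ltW.
  apply: ler_wpM2l; first by rewrite mulr_ge0 // ltW.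
  apply: hN1; rewrite /y -pmulrn natrM mulrAC mulfV ?gt_eqF // mul1r ger0_norm // ler_nat //.
have b2 : normc (bd (- (N * N)%N%:Z)) <= h * (D * C2 * h).
  apply: le_trans (hb _) _; apply: ler_wpM2l; first exact: ltW.
  apply: ler_wpM2l; first by rewrite mulr_ge0 // ltW.
  apply: hN1; rewrite /y mulrNz mulNr normrN -pmulrn natrM mulfK ?gt_eqF // ger0_norm //.
have b3 : normc (zsum (N * N) (N * N.+1) (fun m => cell s (y m) h)) <= C1 * h ^+ 3 * (2 * N.+1%:R).
  apply: le_trans (normc_zsum _ _ _) _.
  apply: le_trans (_ : C1 * h ^+ 3 * zsum (N * N) (N * N.+1) (fun m => expR (- `|y m|)) <= _).
    rewrite -zsumMl; apply: ler_zsum => m; apply: H1 => //; exact: ltW.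
  by apply: ler_wpM2l; [rewrite mulr_ge0 ?exprn_ge0 // ltW | exact: zsum_exp_le].
apply: le_trans (normc_le_add _ _) _.
have b4 := normc_le_add (bd (N * N.+1)%N%:Z) (- bd (- (N * N)%N%:Z)); rewrite normc_opp in b4.
have b5 : h ^+ 3 * N.+1%:R <= 2 * h ^+ 2.
  rewrite exprS -natr1 mulrAC mulrDr mulr1 {1}/h mulVf ?gt_eqF //.
  have : h <= 1 by rewrite /h invf_le1 // ler1n.
  have := sqr_ge0 h; nra.
rewrite -exprVn -/h.
have b6 := ler_wpM2l (ltW C10) b5; have := sqr_ge0 h; lra.
Qed.

Lemma riemann_homotopy : exists (C : R) (N0 : nat), 0 < C /\ forall N : nat, (N0 <= N)%N -> (0 < N)%N ->
  normc (lam * riemann N lam v0 - riemann N 1 0) <= C / N%:R.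
Proof.
have [C [N0 [C0 H]]] := step_bound; exists C, N0; split=> // N hN Npos.
have n0 : 0 < N%:R :> R by rewrite ltr0n.
have Q1 : Q N 1 = lam * riemann N lam v0.
  by rewrite /Q /lams !rmorph1 !mul1r addrC subrK.
have Q0 : Q N 0 = riemann N 1 0.
  by rewrite /Q /lams !rmorph0 !mul0r addr0 mul1r.
have : forall j, (j <= N)%N -> normc (Q N (j%:R / N%:R) - Q N 0) <= j%:R * (C / N%:R ^+ 2).
  elim=> [|j IH] hj; first by rewrite !mul0r subrr ComplexField.Normc.normc0.
  have -> : Q N (j.+1%:R / N%:R) - Q N 0 =
    (Q N (j%:R / N%:R + N%:R^-1) - Q N (j%:R / N%:R)) + (Q N (j%:R / N%:R) - Q N 0).
    by rewrite -natr1 mulrDl mul1r; ring.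
  apply: le_trans (normc_le_add _ _) _.
  rewrite -[in leRHS]natr1 mulrDl mul1r addrC; apply: lerD; first exact: IH (ltnW hj).
  apply: H => //; by rewrite ler_pdivrMr // mul1r ler_nat ltnW.
move=> /(_ N (leqnn N)); rewrite divff ?gt_eqF // Q1 Q0.
suff -> : N%:R * (C / N%:R ^+ 2) = C / N%:R by [].
by field; rewrite gt_eqF.
Qed.

End Homotopy.
End GaussRiemann.

Fact er_key : unit. Proof. by []. Qed.

(** * Discrete Fourier inversion and the Poisson formula *)

Section Poisson.
Variable R : realType.
Implicit Types (z w p d lam v : R[i]) (x y h s : R).

Lemma sin_ge_mul_cos y : 0 <= y -> y <= pi / 2 -> y * cos y <= sin y.
Proof.
rewrite le_eqVlt => /orP[/eqP <-|y0 yp]; first by rewrite sin0 mul0r.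
have p0 : 0 < pi :> R by exact: pi_gt0.
have [|c] := @MVT R sin cos 0 y y0.
  by apply: continuous_subspaceT => z; exact: continuous_sin.
rewrite in_itv /= => /andP[c0 cy]; rewrite sin0 !subr0 => ->.
rewrite mulrC ler_pM2r // ltW // ltr_cos // in_itv /=; apply/andP; split; lra.
Qed.

(** sin y = 2 sin(y/2) cos(y/2) >= y cos(y/2)^2 = y (1 + cos y) / 2 >= y / 2. *)
Lemma sin_ge_half y : 0 <= y -> y <= pi / 2 -> y / 2 <= sin y.
Proof.
move=> y0 yp; have p0 : 0 < pi :> R by exact: pi_gt0.
have c0 : 0 <= cos y by apply: cos_ge0_pihalf; apply/andP; split; lra.
have h1 : sin y = 2 * sin (y / 2) * cos (y / 2).
  by rewrite [in LHS](_ : y = y / 2 + y / 2) ?sinD; [ring | field].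
have h2 : cos y = 2 * cos (y / 2) ^+ 2 - 1.
  by rewrite [in LHS](_ : y = (y / 2) *+ 2) ?cos_mulr2n; [ring | field].
have c2 : 0 <= cos (y / 2) by apply: cos_ge0_pihalf; apply/andP; split; lra.
have h3 : y / 2 * cos (y / 2) <= sin (y / 2) by apply: sin_ge_mul_cos; lra.
have := ler_wpM2r c2 h3; rewrite h1; nra.
Qed.

(** The complex number on the right is -4 sin(pi t)^2, the eigenvalue of the second difference on
    the character m -> e(t m); [gcoef_bound] divides by it. *)
Lemma normc_e_second_diff (t : R) : `|t| <= 1 / 2 ->
  4 * t ^+ 2 <= normc (e t%:C - 2%:R + e (- t%:C)).
Proof.
move=> t2; have -> : e t%:C - 2%:R + e (- t%:C) = (- (4 * sin (pi * `|t|) ^+ 2))%:C.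
  have -> : e (- t%:C) = e (- t)%:C by rewrite rmorphN.
  rewrite !eR mulrN cosN sinN; apply/eqP; rewrite eq_complex /=; apply/andP; split; apply/eqP; last ring.
  have -> : sin (pi * `|t|) ^+ 2 = sin (pi * t) ^+ 2.
    by have [h|h] := ger0P t; rewrite ?mulrN ?sinN ?sqrrN.
  have -> : 2 * pi * t = (pi * t) *+ 2 by ring.
  rewrite cos_mulr2n cos2sin2; ring.
rewrite normcR normrN.
have p2 : 2 <= pi :> R by exact: pi_ge2.
have u0 := normr_ge0 t; have h1 : 0 <= pi * `|t| by rewrite mulr_ge0 //; lra.
have p0 : 0 < pi :> R by lra.
have h2 : pi * `|t| <= pi / 2 by have := ler_wpM2l (ltW p0) t2; lra.
have h3 := sin_ge_half h1 h2.
have h4 : `|t| <= sin (pi * `|t|) by apply: le_trans h3; nra.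
rewrite ger0_norm; last by rewrite mulr_ge0 ?sqr_ge0.
rewrite ler_pM2l // -[t ^+ 2]real_normK ?num_real //.
by rewrite lerXn2r ?nnegrE //; apply: le_trans u0 h4.
Qed.

Definition er := locked_with er_key (fun x : R => e x%:C : R[i]).

Lemma erE (x : R) : er x = e x%:C.
Proof. by rewrite /er unlock. Qed.

Lemma erD (x y : R) : er (x + y) = er x * er y.
Proof. by rewrite !erE rmorphD eD. Qed.

Lemma erN (x : R) : er (- x) = (er x)^-1.
Proof. by rewrite !erE rmorphN eN. Qed.

Lemma er0 : er 0 = 1.
Proof. by rewrite erE e0. Qed.

Lemma er_int (n : int) : er n%:~R = 1.
Proof. by rewrite erE -complex_intr e_int. Qed.

Lemma erDint (x : R) (n : int) : er (x + n%:~R) = er x.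
Proof. by rewrite erD er_int mulr1. Qed.

Lemma er_neq0 (x : R) : er x != 0.
Proof. by rewrite erE e_neq0. Qed.

Lemma normc_er (x : R) : normc (er x) = 1.
Proof. by rewrite erE normc_eR. Qed.

Lemma erX (x : R) n : er (x *+ n) = er x ^+ n.
Proof. by rewrite !erE rmorphMn eX. Qed.

Lemma er_neq1 (t : R) : 0 < t -> t < 1 -> er t != 1.
Proof.
move=> t0 t1; apply/eqP => h.
have hw (u : R) : 0 < u -> u <= 1 / 2 -> er u = 1 -> False.
  move=> u0 u1 hu; have := @normc_e_second_diff u; rewrite (gtr0_norm u0) eN -erE hu invr1.
  have -> : 1 - 2%:R + 1 = 0 :> R[i] by ring.
  rewrite ComplexField.Normc.normc0 => /(_ u1).
  have := mulr_gt0 u0 u0; rewrite -expr2; lra.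
have [l|l] := leP t (1 / 2); first exact: (hw t).
have h0 : er (1 - t) = 1 by rewrite erD erN h (er_int 1) invr1 mulr1.
apply: hw h0; lra.
Qed.

Lemma er_frac_modz (m : int) (N : nat) : (0 < N)%N ->
  er (m%:~R / N%:R) = er ((m %% N%:Z)%Z%:~R / N%:R).
Proof.
move=> N0; rewrite {1}(divz_eq m N%:Z) intrD intrM mulrDl mulfK ?pnatr_eq0 ?gtn_eqF //.
by rewrite addrC erDint.
Qed.

Lemma dft_orthogonal (N : nat) (m : int) : (0 < N)%N ->
  \sum_(i < N) er (i%:R * (m%:~R / N%:R)) = if (N%:Z %| m)%Z then N%:R else 0.
Proof.
move=> N0; have n0 : 0 < N%:R :> R by rewrite ltr0n.
have nZ : N%:Z != 0 by rewrite eqz_nat -lt0n.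
set z := er (m%:~R / N%:R).
have -> : \sum_(i < N) er (i%:R * (m%:~R / N%:R)) = \sum_(i < N) z ^+ i.
  by apply: eq_bigr => i _; rewrite /z -erX mulr_natl.
have [/dvdz_mod0P hm|hm] := boolP (N%:Z %| m)%Z.
  have -> : z = 1 by rewrite /z er_frac_modz // hm mul0r er0.
  under eq_bigr do rewrite expr1n; by rewrite sumr_const card_ord.
have zN : z ^+ N = 1.
  by rewrite /z -erX -[_ *+ N]mulr_natr divfK ?gt_eqF // er_int.
have hz : z != 1.
  rewrite /z er_frac_modz //; apply: er_neq1.
    rewrite divr_gt0 // ltr0z lt_neqAle modz_ge0 // andbT eq_sym.
    by apply: contra hm => /eqP h; apply/dvdz_mod0P.
  rewrite ltr_pdivrMr // mul1r pmulrn ltr_int; exact: ltz_pmod.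
have := subrX1 z N; rewrite zN subrr => /esym/eqP; rewrite mulf_eq0 subr_eq0 (negPf hz) /=.
by move/eqP.
Qed.

(* Discrete Fourier coefficients, on [N] points, of the periodization of
   [y |-> gauss (lam y)]. *)
Definition gcoef (lam : R[i]) (x : R) (N : nat) (k : int) : R[i] :=
  N%:R^-1 * zsum (N * N) (N * N.+1) (fun m =>
    gauss (lam * x%:C + lam * (m%:~R / N%:R)%:C) * er (- (k%:~R * (x + m%:~R / N%:R)))).

Definition gdual (lam : R[i]) (x : R) (k : int) : R[i] :=
  gauss (k%:~R / lam) * er (k%:~R * x).

(** Completing the square absorbs the character into the complex shift i k / lam of the Gaussian,
    which is why the homotopy carries an arbitrary complex offset [v0]. *)
Lemma gcoefE lam x N k : lam != 0 ->
  gcoef lam x N k = gauss (k%:~R / lam) * riemann N lam (lam * x%:C + 'i%C * k%:~R / lam).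
Proof.
move=> l0; rewrite /gcoef /riemann mulrCA; congr (_ * _).
rewrite -zsumMl; apply: eq_zsum => m.
move: (m%:~R / N%:R) => y; rewrite !gaussE !erE /e -!cexpD; congr cexp.
rewrite rmorphN rmorphM rmorphD complex_intr.
have i2 : 'i%C ^+ 2 = -1 :> R[i] by rewrite sqr_i.
have -> : (lam * x%:C + 'i%C * k%:~R%:C / lam + lam * y%:C) ^+ 2 =
  (lam * x%:C + lam * y%:C) ^+ 2 + 2%:R * 'i%C * k%:~R%:C * (x%:C + y%:C) + 'i%C ^+ 2 * (k%:~R%:C / lam) ^+ 2.
  by field.
by rewrite i2; ring.
Qed.

Lemma exchange_zsum A B A' B' (F : int -> int -> R[i]) :
  zsum A B (fun k => zsum A' B' (F k)) = zsum A' B' (fun m => zsum A B (F ^~ m)).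
Proof. exact: exchange_big. Qed.

(** N = 2M + 1 is odd, so that the frequencies -M, ..., M form a complete residue system modulo N.
    Summing over them keeps just the sample points m / N that are integers, each with weight N. *)
Lemma gcoef_inversion lam x (M : nat) : let N := M.*2.+1 in
  zsum M M.+1 (fun k => gcoef lam x N k * er (k%:~R * x)) =
  zsum N N.+1 (fun n => gauss (lam * (x + n%:~R)%:C)).
Proof.
move=> N; have N0 : (0 < N)%N by [].
have nN : (N%:R : R) != 0 by rewrite pnatr_eq0.
have nC : (N%:R : R[i]) != 0 by rewrite pnatr_eq0.
pose g m := gauss (lam * x%:C + lam * (m%:~R / N%:R : R)%:C).
pose S (m : int) := zsum M M.+1 (fun k => er (- (k%:~R * (m%:~R / N%:R)))).
have -> : zsum M M.+1 (fun k => gcoef lam x N k * er (k%:~R * x)) =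
   N%:R^-1 * zsum (N * N) (N * N.+1) (fun m => g m * S m).
  transitivity (zsum M M.+1 (fun k => zsum (N * N) (N * N.+1) (fun m =>
     N%:R^-1 * (g m * er (- (k%:~R * (m%:~R / N%:R))))))).
    apply: eq_zsum => k; rewrite zsumMl /gcoef -mulrA; congr (_ * _).
    rewrite mulrC -zsumMl; apply: eq_zsum => m.
    rewrite mulrCA -erD /g; move: (m%:~R / N%:R) => y.
    congr (_ * _); congr er; ring.
  rewrite exchange_zsum -zsumMl; apply: eq_zsum => m.
  by rewrite zsumMl zsumMl.
have SE (m : int) : S m = if (N%:Z %| m)%Z then N%:R else 0.
  have hM : (M + M.+1 = N)%N by rewrite addnS addnn.
  have -> : (N%:Z %| m)%Z = (N%:Z %| - m)%Z by rewrite !dvdzE abszN.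
  rewrite -dft_orthogonal // /S /zsum hM.
  have [/dvdz_mod0P hm|hm] := boolP (N%:Z %| m)%Z.
    apply: eq_bigr => i _.
    have [q ->] : exists q, m = q * N%:Z by exists (m %/ N%:Z)%Z; rewrite {1}(divz_eq m N%:Z) hm addr0.
    have hq (u : int) : (u * N%:Z)%:~R / N%:R = u%:~R :> R by rewrite intrM mulfK.
    have -> : i%:R = i%:Z%:~R :> R by [].
    by rewrite -(mulNr q) !hq -!intrM -mulrNz !er_int.
  transitivity (er (M%:R * (m%:~R / N%:R)) * \sum_(i < N) er (i%:R * ((- m)%:~R / N%:R))).
    rewrite mulr_sumr; apply: eq_bigr => i _; rewrite -erD; congr er.
    by rewrite rmorphB /= mulrNz; ring.
  by rewrite dft_orthogonal // !dvdzE abszN -!dvdzE (negPf hm) mulr0.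
rewrite zsum_mod (bigD1 ord0) //= [X in _ + X]big1 ?addr0; last first.
  move=> i i0; rewrite /zsum big1 // => j _; rewrite SE.
  have -> : (N%:Z %| i%:Z + N%:Z * (j%:Z - N%:Z))%Z = false; last by rewrite mulr0.
  apply/negP => /dvdz_mod0P; rewrite addrC mulrC modzMDl modz_small.
    by move=> [h]; move: i0; rewrite -val_eqE /= h.
  by rewrite /= ltz_nat ltn_ord.
rewrite -zsumMl; apply: eq_zsum => m.
rewrite add0r SE dvdz_mulr // mulrCA mulVf // mulr1 /g; congr gauss.
by rewrite -mulrDr -rmorphD intrM mulrAC mulfV // mul1r.
Qed.

(** Two summations by parts move the second difference from the character to the Gaussian, where it
    costs O(1/N^2), and divide by an eigenvalue of size at least 4 (k/N)^2. The condition 2 |k| <= N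
    keeps the frequency away from the other zeros of that eigenvalue. Uniformity in N controls the
    tail in [poisson_approx]. *)
Lemma gcoef_bound lam x : 0 < complex.Re (lam ^+ 2) ->
  exists (C : R) (N0 : nat), 0 < C /\ forall (N : nat) (k : int), (N0 <= N)%N -> (0 < N)%N ->
    k != 0 -> (2 * `|k| <= N)%N -> normc (gcoef lam x N k) <= C / k%:~R ^+ 2.
Proof.
move=> hre; set kappa := complex.Re (lam ^+ 2) in hre.
have [C1 [h0 [C10 h00 H1]]] := @gauss_taylor R kappa (normc lam) (normc (lam * x%:C)) (normc lam)
   hre (normc_ge0 _) (normc_ge0 _) (normc_ge0 _).
have [C2 C20 H2] := @gauss_decay R kappa (normc lam) (normc (lam * x%:C)) 0 hre.
have [N0 hN0] : exists N0 : nat, h0^-1 <= N0%:R.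
  by exists (Num.bound h0^-1); rewrite ltW // archi_boundP // invr_ge0 ltW.
exists (2 * C1 + C2 * 4), N0; split; first lra.
move=> N k hN Npos k0 kN.
have n0 : 0 < N%:R :> R by rewrite ltr0n.
set h := N%:R^-1 : R; have hpos : 0 < h by rewrite invr_gt0.
have hle : h <= h0.
  by rewrite /h -[leRHS]invrK lef_pV2 ?posrE ?invr_gt0 // (le_trans hN0) // ler_nat.
pose y (m : int) : R := m%:~R / N%:R.
have yD m : y (m + 1) = y m + h by rewrite /y intrD mulrDl mul1r.
have yB m : y (m - 1) = y m - h by rewrite /y intrB mulrBl mul1r.
pose g (m : int) := gauss (lam * x%:C + lam * (y m)%:C).
pose T (m : int) := er (- (k%:~R * (x + y m))).
pose t : R := - (k%:~R / N%:R).
have TS m : T (m + 1) = er t * T m by rewrite /T yD -erD; congr er; rewrite /t /h; ring.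
have TP m : T (m - 1) = (er t)^-1 * T m by rewrite /T yB -erN -erD; congr er; rewrite /t /h; ring.
(* [W] is the discrete Wronskian: its increment is [g] times the second difference of [T] minus [T]
   times that of [g]. *)
pose W (m : int) := g (m - 1) * T m - g m * T (m - 1).
have key : zsum (N * N) (N * N.+1) (fun m => g m * T m) * (er t - 2%:R + (er t)^-1) =
   zsum (N * N) (N * N.+1) (fun m => T m * (g (m + 1) - 2%:R * g m + g (m - 1)))
   + (W (N * N.+1)%N%:Z - W (- (N * N)%N%:Z)).
  rewrite -zsum_telescope -zsumD mulrC -zsumMl; apply: eq_zsum => m.
  by rewrite /W addrK TS TP; ring.
have gb m : normc (g m) <= C2 * expR (- 2 * `|y m|).
  by have := H2 (lam * x%:C) lam (y m) (lexx _) (lexx _) (lexx _); rewrite mul0r expR0 mulr1.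
have nT m : normc (T m) = 1 by exact: normc_er.
have d2 m : normc (g (m + 1) - 2%:R * g m + g (m - 1)) <= 2 * C1 * h ^+ 2 * expR (- `|y m|).
  have ld : normc lam <= normc lam * (1 + `|y m|).
    by rewrite ler_peMr ?normc_ge0 // lerDl.
  have ldN : normc (- lam) <= normc lam * (1 + `|y m|) by rewrite normc_opp.
  have := H1 (lam * x%:C) lam (y m) lam h (lexx _) (lexx _) (lexx _) ld (ltW hpos) hle.
  have := H1 (lam * x%:C) lam (y m) (- lam) h (lexx _) (lexx _) (lexx _) ldN (ltW hpos) hle.
  cbv zeta; rewrite -/(g m).
  have -> : lam * x%:C + lam * (y m)%:C + h%:C * lam = lam * x%:C + lam * (y (m + 1))%:C.
    by rewrite yD rmorphD; ring.
  have -> : lam * x%:C + lam * (y m)%:C + h%:C * - lam = lam * x%:C + lam * (y (m - 1))%:C.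
    by rewrite yB rmorphB; ring.
  rewrite -/(g (m + 1)) -/(g (m - 1)) => a b.
  have -> : g (m + 1) - 2%:R * g m + g (m - 1) =
    (g (m + 1) - g m + 2%:R * pi%:C * (lam * x%:C + lam * (y m)%:C) * (h%:C * lam) * g m) +
    (g (m - 1) - g m + 2%:R * pi%:C * (lam * x%:C + lam * (y m)%:C) * (h%:C * - lam) * g m).
    by ring.
  apply: le_trans (normc_le_add _ _) _.
  have c0 : 0 <= C1 * h ^+ 2 by rewrite mulr_ge0 ?sqr_ge0 // ltW.
  have := ler_wpM2l c0 (exp2_le (normr_ge0 (y m))); lra.
have hN1 (z : R) : N%:R - 1 <= z -> expR (- 2 * z) <= 1 * h.
  move=> hz; rewrite mul1r mulNr expRN lef_pV2 ?posrE ?expR_gt0 //.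
  have := expR_ge1Dx (2 * z); have : 1 <= N%:R :> R by rewrite ler1n.
  lra.
have tE : t ^+ 2 = k%:~R ^+ 2 * h ^+ 2 by rewrite /t sqrrN expr_div_n exprVn.
have t2 : `|t| <= 1 / 2.
  rewrite /t normrN normrM (gtr0_norm hpos) ler_pdivrMr // -intr_norm.
  rewrite -abszE -pmulrn; have : (2 * `|k|)%N%:R <= N%:R :> R by rewrite ler_nat.
  rewrite natrM; lra.
have e2 := normc_e_second_diff t2; rewrite eN -erE in e2.
have hb m : N%:R - 1 <= `|y m| -> normc (g m) <= C2 * h.
  by move=> hm; apply: le_trans (gb m) _; rewrite ler_pM2l // -[leRHS]mul1r hN1.
have h1 : h <= 1 by rewrite /h invf_le1 // ler1n.
have yp : y (N * N.+1)%N%:Z = N%:R + 1.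
  by rewrite /y -pmulrn natrM mulrAC mulfV ?gt_eqF // mul1r natr1.
have ym : y (- (N * N)%N%:Z) = - N%:R.
  by rewrite /y mulrNz mulNr -pmulrn natrM mulfK ?gt_eqF.
have w (m : int) : N%:R - 1 <= `|y m| -> N%:R - 1 <= `|y (m - 1)| -> normc (W m) <= 2 * C2 * h.
  move=> a b; rewrite /W; apply: le_trans (normc_le_add _ _) _.
  rewrite normc_opp !normcM !nT !mulr1; have := hb _ a; have := hb _ b; lra.
have w1 : normc (W (N * N.+1)%N%:Z) <= 2 * C2 * h.
  by apply: w; rewrite ?yB yp ger0_norm; lra.
have w2 : normc (W (- (N * N)%N%:Z)) <= 2 * C2 * h.
  by apply: w; rewrite ?yB ym ler0_norm; lra.
have key2 : normc (zsum (N * N) (N * N.+1) (fun m => T m * (g (m + 1) - 2%:R * g m + g (m - 1)))) <=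
    2 * C1 * h ^+ 2 * (2 * N.+1%:R).
  apply: le_trans (normc_zsum _ _ _) _.
  apply: le_trans (_ : 2 * C1 * h ^+ 2 * zsum (N * N) (N * N.+1) (fun m => expR (- `|y m|)) <= _).
    by rewrite -zsumMl; apply: ler_zsum => m; rewrite normcM nT mul1r.
  by apply: ler_wpM2l; [rewrite !mulr_ge0 ?sqr_ge0 // ltW | exact: zsum_exp_le].
have b5 : h ^+ 2 * N.+1%:R <= 2 * h.
  rewrite expr2 -natr1 -mulrA mulrDr mulr1 {2}/h mulVf ?gt_eqF // mulrC.
  by rewrite ler_pM2r //; lra.
have key3 := congr1 (@normc R) key; rewrite normcM in key3.
have key4 : normc (zsum (N * N) (N * N.+1) (fun m => g m * T m)) * (4 * t ^+ 2) <= (8 * C1 + 4 * C2) * h.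
  apply: le_trans (ler_wpM2l (normc_ge0 _) e2) _; rewrite key3.
  apply: le_trans (normc_le_add _ _) _.
  have := normc_le_add (W (N * N.+1)%N%:Z) (- W (- (N * N)%N%:Z)); rewrite normc_opp.
  have := ler_wpM2l (ltW C10) b5; lra.
have k2 : 0 < k%:~R ^+ 2 :> R by rewrite exprn_even_gt0 // intr_eq0.
rewrite ler_pdivlMr //.
have -> : gcoef lam x N k = h%:C * zsum (N * N) (N * N.+1) (fun m => g m * T m).
  by rewrite /gcoef /h complex_natr fmorphV.
rewrite normcM normcR (gtr0_norm hpos).
move: key4; rewrite tE; move: (normc (zsum _ _ _)) (normc_ge0 (zsum (N * N) (N * N.+1) (fun m => g m * T m))) => Z Z0 key4.
rewrite -(ler_pM2l hpos); have := mulr_gt0 hpos C20; lra.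
Qed.

Lemma ccvg_sum0 (n : nat) (u : nat -> nat -> R[i]) :
  (forall i, ccvg (u i) 0) -> ccvg (fun N => \sum_(i < n) u i N) 0.
Proof.
move=> hu; elim: n => [|n IH] eps eps0.
  by exists 0%N => N _; rewrite big_ord0 subr0 ComplexField.Normc.normc0 ltW.
have e2 : 0 < eps / 2 by rewrite divr_gt0.
have [N1 H1] := IH _ e2; have [N2 H2] := hu n _ e2.
exists (maxn N1 N2) => N; rewrite geq_max => /andP[a b].
rewrite big_ord_recr /= subr0; apply: le_trans (normc_le_add _ _) _.
have := H1 N a; have := H2 N b; rewrite !subr0; lra.
Qed.

(** 1 / (a + 1)^2 <= 1 / a - 1 / (a + 1), and the right-hand side telescopes. *)
Lemma tail_inv_sqr (K n : nat) : (0 < K)%N ->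
  \sum_(i < n) (K + i).+1%:R ^- 2 <= K%:R^-1 - (K + n)%:R^-1 :> R.
Proof.
move=> K0; elim: n => [|n IH]; first by rewrite big_ord0 addn0 subrr.
rewrite big_ord_recr /= addnS; apply: le_trans (lerD IH (lexx _)) _.
have k0 : 0 < (K + n)%:R :> R by rewrite ltr0n addn_gt0 K0.
rewrite -natr1; move: (K + n)%:R k0 K%:R^-1 => a a0 b.
have a1 : 0 < a + 1 by lra.
have -> : b - a^-1 + (a + 1) ^- 2 = b - (a + 1)^-1 - (a * (a + 1) ^+ 2)^-1.
  by field; rewrite !gt_eqF.
by rewrite gerBl invr_ge0 mulr_ge0 ?sqr_ge0 // ltW.
Qed.

Lemma leq_doubleS M : (M <= M.*2.+1)%N.
Proof. by rewrite -addnn; lia. Qed.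

Lemma double_tail_le K M i : (i < M - K)%N -> (2 * (K + i).+1 <= M.*2.+1)%N.
Proof. by rewrite -addnn; lia. Qed.

(** The cut-off K is chosen first and makes the tail of the discrete Fourier series small uniformly
    in M; then M grows until the finitely many remaining coefficients are close to their limits. The
    Gaussian integral enters as the still unknown [riemann M.*2.+1 1 0]. *)
Lemma poisson_approx (lam : R[i]) (x : R) : `|complex.Im lam| < complex.Re lam ->
  forall eps : R, 0 < eps -> exists K0, forall K, (K0 <= K)%N -> exists M0, forall M, (M0 <= M)%N ->
  normc (lam * zsum M.*2.+1 M.*2.+2 (fun n => gauss (lam * (x + n%:~R)%:C)) -
     riemann M.*2.+1 1 0 * zsum K K.+1 (gdual lam x)) <= eps.
Proof.
move=> hlam eps eps0.
have hlam0 : lam != 0.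
  by apply/eqP => h; move: hlam; rewrite h /= normr0 ltxx.
have hre : 0 < complex.Re (lam ^+ 2).
  have -> : complex.Re (lam ^+ 2) = complex.Re lam ^+ 2 - `|complex.Im lam| ^+ 2.
    by rewrite real_normK ?num_real //; case: (lam) => a b /=; ring.
  rewrite subr_gt0 ltrXn2r // ?nnegrE //.
have [C [N0 [C0 HC]]] := gcoef_bound x hre.
have l0 : 0 < normc lam.
  rewrite lt_neqAle normc_ge0 andbT eq_sym; apply: contra hlam0 => /eqP h.
  by apply/eqP; exact: ComplexField.Normc.eq0_normc.
pose B := normc lam * (2 * C).
have B0 : 0 < B by rewrite /B !mulr_gt0.
have [K1 hK1] : exists K1 : nat, 2 * B / eps <= K1%:R.
  exists (Num.bound (2 * B / eps)); rewrite ltW // archi_boundP // divr_ge0 ?ltW //; lra.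
exists K1.+1 => K hK.
have K0 : (0 < K)%N by apply: leq_trans hK.
have hKe : B / K%:R <= eps / 2.
  rewrite ler_pdivrMr ?ltr0n //.
  have : K1%:R <= K%:R :> R by rewrite ler_nat ltnW.
  move: hK1; rewrite ler_pdivrMr // => a b; have := ler_wpM2l (ltW eps0) b; lra.
pose F (M : nat) (k : int) := lam * gcoef lam x M.*2.+1 k * er (k%:~R * x).
pose G (M : nat) (k : int) := riemann M.*2.+1 1 0 * gdual lam x k.
have hFG k : ccvg (fun M => F M k - G M k) 0.
  have [C1 [N1 [C10 H1]]] := riemann_homotopy (lam * x%:C + 'i%C * k%:~R / lam) hlam.
  move=> e3 e30; set E := normc (gauss (k%:~R / lam)) * C1.
  have E0 : 0 <= E by rewrite mulr_ge0 ?normc_ge0 // ltW.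
  have [N2 hN2] : exists N2 : nat, E / e3 <= N2%:R.
    by exists (Num.bound (E / e3)); rewrite ltW // archi_boundP // divr_ge0 // ltW.
  exists (maxn N1 N2) => M; rewrite geq_max => /andP[a b]; rewrite subr0.
  have -> : F M k - G M k = gauss (k%:~R / lam) * (lam * riemann M.*2.+1 lam (lam * x%:C + 'i%C * k%:~R / lam)
      - riemann M.*2.+1 1 0) * er (k%:~R * x).
    by rewrite /F /G /gdual gcoefE //; ring.
  rewrite !normcM normc_er mulr1.
  have hle := leq_doubleS M.
  have := H1 M.*2.+1 (leq_trans a hle) isT => h.
  apply: le_trans (ler_wpM2l (normc_ge0 _) h) _; rewrite mulrA -/E ler_pdivrMr ?ltr0n //.
  move: hN2; rewrite ler_pdivrMr // => hN2; apply: le_trans hN2 _.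
  by rewrite mulrC ler_pM2l // ler_nat (leq_trans b).
have e2 : 0 < eps / 2 by rewrite divr_gt0.
have [M1 HM1] := @ccvg_sum0 (K + K.+1) (fun i M => F M (i%:Z - K%:Z) - G M (i%:Z - K%:Z)) (fun i => hFG _) _ e2.
exists (maxn (maxn M1 N0) K) => M; rewrite !geq_max => /andP[/andP[a b] c].
have hinv : lam * zsum M.*2.+1 M.*2.+2 (fun n => gauss (lam * (x + n%:~R)%:C)) = zsum M M.+1 (F M).
  rewrite -gcoef_inversion -zsumMl; apply: eq_zsum => k; by rewrite mulrA.
have hsplit : zsum M M.+1 (F M) = zsum K K.+1 (F M) +
    \sum_(i < M - K) (F M (K + i).+1%:Z + F M (- (K + i).+1%:Z)).
  by have := zsum_symD K (M - K) (F M); rewrite subnKC.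
have := HM1 M a; rewrite subr0 -/(zsum K K.+1 (fun k => F M k - G M k)) zsumB => h1.
have h2 : normc (\sum_(i < M - K) (F M (K + i).+1%:Z + F M (- (K + i).+1%:Z))) <= eps / 2.
  apply: le_trans (normc_sum _ _ _) _; apply: le_trans hKe.
  apply: (@le_trans _ _ (\sum_(i < M - K) B * (K + i).+1%:R ^- 2)).
    apply: ler_sum => i _; apply: le_trans (normc_le_add _ _) _.
    have hk (k : int) : (`|k| = (K + i).+1)%N -> normc (F M k) <= normc lam * C * (K + i).+1%:R ^- 2.
      move=> hk; rewrite /F normcM normc_er mulr1 normcM -mulrA ler_pM2l //.
      have -> : (K + i).+1%:R ^+ 2 = k%:~R ^+ 2 :> R.
        by rewrite -[RHS]real_normK ?num_real // -intr_norm -abszE hk.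
      apply: HC => //; first by rewrite (leq_trans b) // leq_doubleS.
        by rewrite -absz_eq0 hk.
      by rewrite hk; apply: double_tail_le.
    have := hk (K + i).+1%:Z erefl; have := hk (- (K + i).+1%:Z); rewrite abszN => /(_ erefl).
    have -> : B * (K + i).+1%:R ^- 2 = normc lam * C * (K + i).+1%:R ^- 2 + normc lam * C * (K + i).+1%:R ^- 2.
      by rewrite /B; ring.
    by move=> p q; apply: lerD.
  rewrite -mulr_sumr ler_pM2l //; apply: le_trans (tail_inv_sqr _ K0) _.
  by rewrite gerBl invr_ge0.
rewrite hinv hsplit.
have -> : riemann M.*2.+1 1 0 * zsum K K.+1 (gdual lam x) = zsum K K.+1 (G M) by rewrite -zsumMl.
rewrite addrAC; apply: le_trans (normc_le_add _ _) _; lra.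
Qed.

Lemma square_cone (lam : R[i]) : `|complex.Im lam| < complex.Re lam ->
  0 < complex.Re (lam ^+ 2).
Proof.
move=> h; have -> : complex.Re (lam ^+ 2) = complex.Re lam ^+ 2 - `|complex.Im lam| ^+ 2.
  by rewrite real_normK ?num_real //; case: (lam) => a b /=; ring.
by rewrite subr_gt0 ltrXn2r // ?nnegrE // (le_trans (normr_ge0 _) (ltW h)).
Qed.

Lemma inv_cone (lam : R[i]) : `|complex.Im lam| < complex.Re lam ->
  `|complex.Im lam^-1| < complex.Re lam^-1.
Proof.
case: lam => a b /= h; have a0 : 0 < a by apply: le_lt_trans h.
have s0 : 0 < a ^+ 2 + b ^+ 2 by rewrite ltr_pwDl ?sqr_ge0 // exprn_gt0.
by rewrite normrN normrM normfV (gtr0_norm s0) ltr_pM2r ?invr_gt0.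
Qed.

Lemma exp_neg2_pow (y : R) (n : nat) : y = n%:R -> expR (- 2 * y) = expR (- 2) ^+ n.
Proof. by move=> ->; rewrite mulrC expRM_natl. Qed.

Lemma exp_neg2_lt1 : expR (- 2) < 1 :> R.
Proof. by rewrite -[ltRHS]expR0 ltr_expR; lra. Qed.

Lemma gauss_zcvg (lam : R[i]) (x : R) : `|complex.Im lam| < complex.Re lam ->
  exists l, zcvg (fun n => gauss (lam * (x + n%:~R)%:C)) l.
Proof.
move=> /square_cone h.
have [C C0 H] := @gauss_decay R _ (normc lam) (normc (lam * x%:C)) 0 h.
apply: (zcvg_exists (C := C) (expR_ge0 _) exp_neg2_lt1) => n.
have := H (lam * x%:C) lam n%:~R (lexx _) (lexx _) (lexx _).
by rewrite mul0r expR0 mulr1 -mulrDr -rmorphD (@exp_neg2_pow _ `|n|%N) // -intr_norm -abszE.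
Qed.

Lemma gdual_zcvg (lam : R[i]) (x : R) : `|complex.Im lam| < complex.Re lam ->
  exists l, zcvg (gdual lam x) l.
Proof.
move=> /inv_cone /square_cone h.
have [C C0 H] := @gauss_decay R _ (normc lam^-1) 0 0 h.
apply: (zcvg_exists (C := C) (expR_ge0 _) exp_neg2_lt1) => n.
have := H 0 lam^-1 n%:~R (lexx _) (lexx _); rewrite ComplexField.Normc.normc0 => /(_ (lexx _)).
rewrite mul0r expR0 mulr1 add0r /gdual normcM normc_er mulr1 complex_intr mulrC.
by rewrite (@exp_neg2_pow _ `|n|%N) // -intr_norm -abszE.
Qed.

(* The Gaussian integral comes for free: for [lam = 1] and [x = 0] the two sides of
   [poisson_approx] are the same theta series, up to the factor [riemann M.*2.+1 1 0]. *)
Lemma riemann_gauss_cvg : ccvg (fun M => riemann M.*2.+1 (1 : R[i]) 0) 1.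
Proof.
have c1 : `|complex.Im (1 : R[i])| < complex.Re (1 : R[i]) by rewrite /= normr0 ltr01.
have gR (n : int) : gauss ((1 : R[i]) * (0 + n%:~R : R)%:C) = (expR (- (pi * n%:~R ^+ 2)))%:C.
  by rewrite gaussE mul1r add0r -rmorphXn -rmorphM -rmorphN cexpR.
have [th hth] := gauss_zcvg 0 c1.
have dualE : gdual (1 : R[i]) 0 =1 (fun n => gauss ((1 : R[i]) * (0 + n%:~R : R)%:C)).
  by move=> n; rewrite /gdual mulr0 er0 mulr1 divr1 mul1r add0r complex_intr.
(* The term n = 0 is 1 and the others are positive, so theta is bounded away from 0 and can be
   cancelled. *)
have th1 : 1 <= normc th.
  apply/ler_addgt0Pr => eps eps0; have [N H] := hth _ eps0.
  have := H N N.+1 (leqnn N) (leqnSn N).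
  set s := zsum _ _ _ => hs.
  have s1 : 1 <= complex.Re s.
    have -> : s = (1 + \sum_(i < N) (expR (- (pi * i.+1%:Z%:~R ^+ 2)) + expR (- (pi * (- i.+1%:Z)%:~R ^+ 2))))%:C.
      rewrite /s zsum_sym gR expr0n mulr0 oppr0 expR0 [RHS]rmorphD rmorph_sum; congr (_ + _).
      by apply: eq_bigr => i _; rewrite !gR rmorphD.
    by rewrite lerDl sumr_ge0 // => i _; rewrite addr_ge0 // expR_ge0.
  have h1 : normc s <= normc (s - th) + normc th.
    by rewrite -[X in normc X <= _](subrK th); exact: normc_le_add.
  have := normc_Re s; have := ler_norm (complex.Re s); lra.
move=> eps eps0.
pose d := Num.min (1 / 4) (eps / 4).
have d0 : 0 < d by rewrite lt_min !divr_gt0.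
have d1 : d <= 1 / 4 by rewrite ge_min lexx.
have d2 : d <= eps / 4 by rewrite ge_min lexx orbT.
have [K0 HK] := poisson_approx 0 c1 d0.
have [N1 HN1] := hth _ d0.
have [M0 HM] := HK (maxn K0 N1) (leq_maxl _ _).
exists (maxn M0 N1) => M; rewrite geq_max => /andP[a b].
have := HM M a; rewrite mul1r (eq_zsum _ _ dualE).
have := HN1 (maxn K0 N1) (maxn K0 N1).+1 (leq_maxr _ _) (leqW (leq_maxr _ _)).
have := HN1 M.*2.+1 M.*2.+2 (leq_trans b (leq_doubleS M)) (leqW (leq_trans b (leq_doubleS M))).
move: (zsum M.*2.+1 _ _) (zsum (maxn K0 N1) _ _) (riemann _ _ _) => s1 s2 J h1 h2 h3.
have n1 : normc J * normc s2 <= normc (s1 - J * s2) + normc s1.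
  rewrite -normcM; have {1}-> : J * s2 = - (s1 - J * s2) + s1 by ring.
  by apply: le_trans (normc_le_add _ _) _; rewrite normc_opp.
have n2 : normc s1 <= normc (s1 - th) + normc th.
  by rewrite -[X in normc X <= _](subrK th); exact: normc_le_add.
have n3 : normc th <= normc (s2 - th) + normc s2.
  rewrite -[normc (s2 - th)]normc_opp opprB -[X in normc X <= _](subrK s2).
  exact: normc_le_add.
have nJ0 := normc_ge0 J.
have nJ : normc J <= 2.
  have : normc J * (normc th - d) <= normc th + 2 * d.
    have : normc J * (normc th - d) <= normc J * normc s2 by apply: ler_wpM2l => //; lra.
    lra.
  nra.
have key : normc (J - 1) * normc th <= 4 * d.
  rewrite -normcM; have -> : (J - 1) * th = - (J * (s2 - th)) - (s1 - J * s2) + (s1 - th) by ring.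
  apply: le_trans (normc_le_add _ _) _; apply: le_trans (lerD (normc_le_add _ _) (lexx _)) _.
  rewrite !normc_opp normcM.
  have := ler_wpM2r (normc_ge0 (s2 - th)) nJ; lra.
have := ler_wpM2l (normc_ge0 (J - 1)) th1; lra.
Qed.

(* The Gaussian is [gauss (lam v) = exp(- pi lam^2 v^2)], so that [lam] plays
   the role of the principal square root of the complex parameter. *)
Theorem poisson (lam : R[i]) (x : R) (l1 l2 : R[i]) : `|complex.Im lam| < complex.Re lam ->
  zcvg (fun n => gauss (lam * (x + n%:~R)%:C)) l1 -> zcvg (gdual lam x) l2 ->
  lam * l1 = l2.
Proof.
move=> hlam h1 h2; apply/eqP; rewrite -subr_eq0; apply/eqP/normc_eq0_le => eps eps0.
pose B := normc lam + normc l2 + 4.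
have B0 : 0 < B by have := normc_ge0 lam; have := normc_ge0 l2; rewrite /B; lra.
pose d := Num.min 1 (eps / B).
have d0 : 0 < d by rewrite lt_min ltr01 divr_gt0.
have d1 : d <= 1 by rewrite ge_min lexx.
have d2 : d * B <= eps by rewrite -ler_pdivlMr // ge_min lexx orbT.
have [K0 HK] := poisson_approx x hlam d0.
have [N1 HN1] := h1 _ d0; have [N2 HN2] := h2 _ d0; have [N3 HN3] := riemann_gauss_cvg d0.
have [M0 HM] := HK (maxn K0 N2) (leq_maxl _ _).
pose M := maxn M0 (maxn N1 N3).
have := HM M (leq_maxl _ _).
have := HN3 M (leq_trans (leq_maxr _ _) (leq_maxr _ _)).
have := HN2 (maxn K0 N2) (maxn K0 N2).+1 (leq_maxr _ _) (leqW (leq_maxr _ _)).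
have hN1 : (N1 <= M.*2.+1)%N.
  by apply: leq_trans (leq_doubleS M); apply: leq_trans (leq_maxl _ _) (leq_maxr _ _).
have := HN1 M.*2.+1 M.*2.+2 hN1 (leqW hN1).
move: (zsum M.*2.+1 _ _) (zsum (maxn K0 N2) _ _) (riemann _ _ _) => s1 s2 J k1 k2 k3 k4.
have -> : lam * l1 - l2 = - (lam * (s1 - l1)) + ((lam * s1 - J * s2) + (J * (s2 - l2) + (J - 1) * l2)).
  by ring.
apply: le_trans (normc_le_add _ _) _; rewrite normc_opp normcM.
apply: le_trans (lerD (lexx _) (normc_le_add _ _)) _.
apply: le_trans (lerD (lexx _) (lerD (lexx _) (normc_le_add _ _))) _; rewrite !normcM.
have nJ : normc J <= 2.
  have -> : J = (J - 1) + 1 by ring.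
  by apply: le_trans (normc_le_add _ _) _; rewrite ComplexField.Normc.normc1; lra.
have a1 := ler_wpM2l (normc_ge0 lam) k1.
have a2 := ler_pM (normc_ge0 _) (normc_ge0 _) nJ k2.
have a3 := ler_wpM2r (normc_ge0 l2) k3.
rewrite /B in d2; lra.
Qed.

End Poisson.

(** * Gauss sums with the character modulo 12 *)

Section Chi12.

Definition chi12_nat (r : nat) : int :=
  if (r == 1%N) || (r == 11%N) then 1 else if (r == 5%N) || (r == 7%N) then -1 else 0.

Definition chi12 (n : int) : int := chi12_nat `|(n %% 12)%Z|.

Lemma chi12_mod (n m : int) : (n = m %[mod 12])%Z -> chi12 n = chi12 m.
Proof. by rewrite /chi12 => ->. Qed.

Lemma chi12D (n m : int) : chi12 (n + m * 12) = chi12 n.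
Proof. by apply: chi12_mod; rewrite addrC modzMDl. Qed.

Lemma modz12_nat (n : int) : exists2 r : nat, (r < 12)%N & (n %% 12)%Z = r.
Proof.
exists `|(n %% 12)%Z|%N; last by rewrite gez0_abs // modz_ge0.
by rewrite -ltz_nat gez0_abs ?modz_ge0 // ltz_pmod.
Qed.

Lemma iota12P (P : pred nat) : all P (iota 0 12) -> forall r, (r < 12)%N -> P r.
Proof. by move/allP => h r hr; apply: h; rewrite mem_iota. Qed.

Lemma chi12M (n m : int) : chi12 (n * m) = chi12 n * chi12 m.
Proof.
have [r hr nr] := modz12_nat n; have [s hs ms] := modz12_nat m.
rewrite (@chi12_mod (n * m) (r * s)%N); last by rewrite PoszM -nr -ms modzMm.
rewrite /chi12 nr ms.
have : all (fun r => all (fun s : nat => chi12_nat `|((r * s)%N %% 12)%Z| == chi12_nat r * chi12_nat s)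
   (iota 0 12)) (iota 0 12) by vm_compute.
by move=> /iota12P /(_ r hr) /iota12P /(_ s hs) /eqP.
Qed.

Lemma chi12_sqr (n : int) : coprimez n 12 -> chi12 n * chi12 n = 1.
Proof.
have [r hr nr] := modz12_nat n; rewrite /coprimez -gcdz_modl nr /chi12 nr.
have : all (fun r : nat => (gcdn r 12 == 1%N) ==> (chi12_nat r * chi12_nat r == 1)) (iota 0 12).
  by vm_compute.
by move=> /iota12P /(_ r hr) /implyP h; rewrite /gcdz eqz_nat => /h /eqP.
Qed.

Lemma chi12_neq0_sqr (n : int) : chi12 n != 0 -> (24 %| n ^+ 2 - 1)%Z.
Proof.
move=> h; have [r hr nr] := modz12_nat n.
have [q ->] : exists q : int, n = q * 12 + r by exists (n %/ 12)%Z; rewrite -nr -divz_eq.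
have -> : (q * 12 + r) ^+ 2 - 1 = (6 * q ^+ 2 + q * r) * 24 + (r%:Z ^+ 2 - 1) by ring.
rewrite rpredD ?dvdz_mull //.
move: h; rewrite /chi12 nr.
have : all (fun r : nat => (chi12_nat r != 0) ==> (24 %| r%:Z ^+ 2 - 1)%Z) (iota 0 12).
  by vm_compute.
by move=> /iota12P /(_ r hr) /implyP; apply.
Qed.

Lemma chi12_eq0 (n : int) : (2 %| n)%Z || (3 %| n)%Z -> chi12 n = 0.
Proof.
move=> h; have [r hr nr] := modz12_nat n.
have {h} : (2 %| r)%N || (3 %| r)%N by lia.
rewrite /chi12 nr.
have : all (fun r : nat => ((2 %| r)%N || (3 %| r)%N) ==> (chi12_nat r == 0)) (iota 0 12).
  by vm_compute.
by move=> /iota12P /(_ r hr) /implyP h /h /eqP.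
Qed.

(** This makes the signs of the pentagonal series periodic in 6s + 1, so that Poisson summation
    applies class by class. *)
Lemma chi12_etasign (s : int) : chi12 (6 * s + 1) = (-1) ^+ `|s|%N.
Proof.
have [q [b ->]] : exists (q : int) (b : bool), s = q * 2 + b%:Z.
  exists (s %/ 2)%Z; exists ((s %% 2)%Z == 1).
  have h1 := modz_ge0 s (isT : 2 != 0 :> int); have h2 := ltz_pmod s (isT : 0 < 2 :> int).
  rewrite {1}(divz_eq s 2); congr (_ + _); lia.
have -> : 6 * (q * 2 + b%:Z) + 1 = (6 * b%:Z + 1) + q * 12 by ring.
rewrite chi12D -signr_odd; have -> : odd `|(q * 2 + b%:Z)%R|%N = b by case: b; lia.
by case: b; vm_compute.
Qed.

End Chi12.

Section PeriodicSums.
Variable V : zmodType.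
Implicit Types f : int -> V.

Definition psum (M : nat) f := \sum_(r < M) f r%:Z.

Lemma periodic_modz (M : nat) f : (forall n, f (n + M%:Z) = f n) ->
  forall n m, (n = m %[mod M%:Z])%Z -> f n = f m.
Proof.
move=> hf n m hnm.
have hmul (q : nat) n' : f (n' + q%:Z * M%:Z) = f n'.
  elim: q => [|q IH]; first by rewrite mul0r addr0.
  by rewrite -addn1 PoszD mulrDl mul1r addrA hf.
have hmulz q n' : f (n' + q * M%:Z) = f n'.
  case: q => q; first exact: hmul.
  by rewrite NegzE mulNr -[in LHS](hmul q.+1) subrK.
by rewrite (divz_eq n M) (divz_eq m M) hnm ![_ * _ + _]addrC !hmulz.
Qed.

Lemma psum_affine (M : nat) f (u s : int) : (0 < M)%N -> coprimez u M%:Z ->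
  (forall n, f (n + M%:Z) = f n) -> psum M (fun n => f (u * n + s)) = psum M f.
Proof.
move=> M0 cu hf.
have MZ : M%:Z != 0 by rewrite eqz_nat -lt0n.
have hlt (n : int) : (`|(n %% M%:Z)%Z| < M)%N.
  by rewrite -ltz_nat gez0_abs ?modz_ge0 // ltz_pmod.
pose h (r : 'I_M) : 'I_M := Ordinal (hlt (u * r%:Z + s)).
have hinj : injective h.
  move=> r1 r2 /(congr1 val) /= /eqP; rewrite -eqz_nat !gez0_abs ?modz_ge0 // => /eqP hm.
  apply: val_inj; apply/eqP; rewrite -eqz_nat /=.
  have : (M%:Z %| u * (r1%:Z - r2%:Z))%Z.
    by rewrite -[_ * _](_ : (u * r1%:Z + s) - (u * r2%:Z + s) = _) -?eqz_mod_dvd ?hm //; ring.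
  rewrite Gauss_dvdzr 1?coprimez_sym // -eqz_mod_dvd => /eqP.
  by rewrite !modz_small ?ltz_nat ?ltn_ord // => ->.
rewrite /psum [RHS](reindex_inj hinj) /=; apply: eq_bigr => r _.
apply: (periodic_modz hf); by rewrite gez0_abs ?modz_ge0 // modz_mod.
Qed.

Lemma psum_shift (M : nat) f (s : int) : (0 < M)%N ->
  (forall n, f (n + M%:Z) = f n) -> psum M (fun n => f (n + s)) = psum M f.
Proof.
move=> M0 hf; rewrite -(psum_affine s M0 _ hf (u := 1)) //; last by rewrite /coprimez gcd1z.
by apply: eq_bigr => r _; rewrite mul1r.
Qed.

End PeriodicSums.

Section GaussSums.
Variable R : realType.
Variable k : nat.
Hypothesis k0 : (0 < k)%N.

Let n24 : (24 * k)%N%:R != 0 :> R.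
Proof. by rewrite pnatr_eq0 muln_eq0 /= -lt0n. Qed.

Definition er24 (n : int) : R[i] := er (n%:~R / (24 * k)%N%:R : R).

Lemma er24D n m : er24 (n + m) = er24 n * er24 m.
Proof. by rewrite /er24 intrD mulrDl erD. Qed.

Lemma er24_0 : er24 0 = 1.
Proof. by rewrite /er24 mul0r er0. Qed.

Lemma er24N n : er24 (- n) = (er24 n)^-1.
Proof. by rewrite /er24 mulrNz mulNr erN. Qed.

Lemma er24_dvd n m : ((24 * k)%N%:Z %| n - m)%Z -> er24 n = er24 m.
Proof.
move=> /dvdzP [q hq]; rewrite -(subrK m n) addrC er24D hq /er24 intrM mulfK //.
by rewrite er_int mulr1.
Qed.

Definition gsum (a j : int) : R[i] :=
  psum (12 * k) (fun r => (chi12 r)%:~R * er24 (a * r ^+ 2 + 2 * j * r)).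

(** [gsum] after completing the square with r -> r - d j, where d inverts a: the parameter j is left
    inside [chi12] alone, hence matters modulo 12 only. *)
Definition hsum (a d j : int) : R[i] :=
  psum (12 * k) (fun r => (chi12 (r - d * j))%:~R * er24 (a * r ^+ 2)).

Lemma chi12_add12k (n : int) : chi12 (n + (12 * k)%N%:Z) = chi12 n.
Proof. by rewrite PoszM mulrC chi12D. Qed.

Lemma er24_sqr_period (a r : int) : er24 (a * (r + (12 * k)%N%:Z) ^+ 2) = er24 (a * r ^+ 2).
Proof.
apply: er24_dvd; rewrite (_ : _ - _ = (a * r + 6 * a * k%:Z) * (24 * k)%N%:Z) ?dvdz_mull //.
by rewrite !PoszM; ring.
Qed.

Lemma mul12_gt0 : (0 < 12 * k)%N.
Proof. by rewrite muln_gt0. Qed.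

Lemma hsum_period a d j n :
  (chi12 (n + (12 * k)%N%:Z - d * j))%:~R * er24 (a * (n + (12 * k)%N%:Z) ^+ 2) =
  (chi12 (n - d * j))%:~R * er24 (a * n ^+ 2).
Proof. by rewrite er24_sqr_period addrAC chi12_add12k. Qed.

Lemma gsum_hsum a d j : ((24 * k)%N%:Z %| a * d - 1)%Z ->
  gsum a j = er24 (- (d * j ^+ 2)) * hsum a d j.
Proof.
move=> /dvdzP [q hq].
rewrite /hsum -(psum_shift (d * j) mul12_gt0 (hsum_period a d j)) /psum mulr_sumr.
apply: eq_bigr => r _; rewrite addrK [RHS]mulrCA -er24D; congr (_ * _); apply: er24_dvd.
rewrite (_ : _ - _ = - ((2 * j * r%:Z + d * j ^+ 2) * (a * d - 1))); last by ring.
by rewrite hq rpredN mulrA dvdz_mull.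
Qed.

Lemma hsum_mod a d j j' : (j = j' %[mod 12])%Z -> hsum a d j = hsum a d j'.
Proof.
move=> h; apply: eq_bigr => r _; congr ((_ : int)%:~R * _); apply: chi12_mod.
by rewrite -modzDmr -modzNm -modzMmr h modzMmr modzNm modzDmr.
Qed.

(** Substituting U r for r preserves a r^2 modulo 24k, as U^2 = 1, and pulls [chi12 U] out of the
    character. *)
Lemma hsum_unit a d j U : ((24 * k)%N%:Z %| U ^+ 2 - 1)%Z ->
  hsum a d (U * j) = (chi12 U)%:~R * hsum a d j.
Proof.
move=> /dvdzP [q hq].
have cU : coprimez U (12 * k)%N%:Z.
  apply/coprimezP; exists (U, - (2 * q)) => /=.
  by rewrite -expr2 -[U ^+ 2](subrK 1) hq !PoszM; ring.
rewrite {1}/hsum -(psum_affine 0 mul12_gt0 cU (hsum_period a d (U * j))) /hsum /psum mulr_sumr.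
apply: eq_bigr => r _; rewrite addr0 [RHS]mulrA -[in RHS]intrM -chi12M.
congr ((chi12 _)%:~R * _); first by ring.
apply: er24_dvd; rewrite (_ : _ - _ = a * r%:Z ^+ 2 * (U ^+ 2 - 1)); last by ring.
by rewrite hq mulrA dvdz_mull.
Qed.

Lemma sqrt1_exists (p q : nat) : coprime p q -> exists U : int,
  [/\ ((p * q)%N%:Z %| U ^+ 2 - 1)%Z, (p%:Z %| U + 1)%Z & (q%:Z %| U - 1)%Z].
Proof.
move=> cpq; have cz : coprimez p%:Z q%:Z by rewrite /coprimez /gcdz /= (eqP cpq).
exists (zchinese p%:Z q%:Z (-1) 1).
have h1 : (p%:Z %| zchinese p%:Z q%:Z (-1) 1 + 1)%Z.
  by rewrite -[_ + 1]/(_ - -1) -eqz_mod_dvd; apply/eqP; apply: zchinese_modl.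
have h2 : (q%:Z %| zchinese p%:Z q%:Z (-1) 1 - 1)%Z.
  by rewrite -eqz_mod_dvd; apply/eqP; apply: zchinese_modr.
split=> //; rewrite PoszM Gauss_dvdz //; apply/andP; split.
  rewrite (_ : _ - 1 = (zchinese p%:Z q%:Z (-1) 1 + 1) * (zchinese p%:Z q%:Z (-1) 1 - 1)); last by ring.
  exact: dvdz_mulr.
rewrite (_ : _ - 1 = (zchinese p%:Z q%:Z (-1) 1 + 1) * (zchinese p%:Z q%:Z (-1) 1 - 1)); last by ring.
exact: dvdz_mull.
Qed.

Let n24gt0 : (0 < 24 * k)%N. Proof. by rewrite muln_gt0. Qed.

Lemma dvd_part24 (pi : nat_pred) (m : nat) : (m %| 24)%N -> pi.-nat m ->
  (m%:Z %| ((24 * k)`_pi)%N%:Z)%Z.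
Proof.
move=> h hm; rewrite dvdzE /= -(part_pnat_id hm).
by apply: partn_dvd => //; apply: dvdn_mulr.
Qed.

(** U is -1 modulo the 2-part of 24k and 1 modulo the odd part. As 4 divides the former and 3 the
    latter, U = 7 modulo 12. *)
Lemma sqrt1_7 : exists U : int, ((24 * k)%N%:Z %| U ^+ 2 - 1)%Z /\ (U = 7 %[mod 12])%Z.
Proof.
have [U [h1 h2 h3]] := sqrt1_exists (coprime_partC 2%N (24 * k) (24 * k)).
exists U; split; first by rewrite partnC in h1.
have d4 : (4%:Z %| U + 1)%Z by apply: dvdz_trans h2; apply: dvd_part24.
have d3 : (3%:Z %| U - 1)%Z by apply: dvdz_trans h3; apply: dvd_part24.
clear -d4 d3; lia.
Qed.

(** Now U is -1 modulo the 3-part and 1 modulo the rest, hence -1 modulo 3 and 1 modulo 4. *)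
Lemma sqrt1_5 : exists U : int, ((24 * k)%N%:Z %| U ^+ 2 - 1)%Z /\ (U = 5 %[mod 12])%Z.
Proof.
have [U [h1 h2 h3]] := sqrt1_exists (coprime_partC 3%N (24 * k) (24 * k)).
exists U; split; first by rewrite partnC in h1.
have d3 : (3%:Z %| U + 1)%Z by apply: dvdz_trans h2; apply: dvd_part24.
have d4 : (4%:Z %| U - 1)%Z by apply: dvdz_trans h3; apply: dvd_part24.
clear -d4 d3; lia.
Qed.

Lemma hsum_5 a d j : hsum a d (5 * j) = - hsum a d j.
Proof.
have [U [h1 h2]] := sqrt1_5.
have -> : hsum a d (5 * j) = hsum a d (U * j).
  by apply: hsum_mod; rewrite -modzMml -h2 modzMml.
by rewrite hsum_unit // (chi12_mod h2) mulN1r.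
Qed.

Lemma hsum_7 a d j : hsum a d (7 * j) = - hsum a d j.
Proof.
have [U [h1 h2]] := sqrt1_7.
have -> : hsum a d (7 * j) = hsum a d (U * j).
  by apply: hsum_mod; rewrite -modzMml -h2 modzMml.
by rewrite hsum_unit // (chi12_mod h2) mulN1r.
Qed.

Lemma eq_opp0 (z : R[i]) : z = - z -> z = 0.
Proof.
move=> h; have : z *+ 2 = 0 by rewrite mulr2n {1}h addNr.
by move/eqP; rewrite mulrn_eq0 /= => /eqP.
Qed.

(* [hsum a d j] depends on [j] modulo 12 only, and multiplying [j] by a square root
   [U] of 1 modulo [24 k] multiplies it by [chi12 U]; the classes 5 and 7 modulo 12
   contain such a [U]. *)
Lemma hsumE a d j : hsum a d j = (chi12 j)%:~R * hsum a d 1.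
Proof.
have [r hr jr] := modz12_nat j.
rewrite (@hsum_mod a d j r); last by rewrite -jr modz_mod.
have -> : chi12 j = chi12_nat r by rewrite /chi12 jr.
have e5 (n m : int) : (5 * n = m %[mod 12])%Z -> hsum a d m = - hsum a d n.
  by move=> h; rewrite -hsum_5; apply: hsum_mod.
have e7 (n m : int) : (7 * n = m %[mod 12])%Z -> hsum a d m = - hsum a d n.
  by move=> h; rewrite -hsum_7; apply: hsum_mod.
move: r hr {jr}; case=> [|[|[|[|[|[|[|[|[|[|[|[|r]]]]]]]]]]]] // _.
all: rewrite /chi12_nat /= ?mul1r ?mul0r ?mulN1r //.
- by apply: eq_opp0; apply: e7.
- by apply: eq_opp0; apply: e7.
- by apply: eq_opp0; apply: e5.
- by apply: eq_opp0; apply: e7.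
- by apply: e5.
- by apply: eq_opp0; apply: e7.
- by apply: e7.
- by apply: eq_opp0; apply: e7.
- by apply: eq_opp0; apply: e5.
- by apply: eq_opp0; apply: e7.
- by rewrite (e5 7) // (e7 1) // opprK.
Qed.

Lemma gsumE a d j : ((24 * k)%N%:Z %| a * d - 1)%Z ->
  gsum a j * er24 (d * j ^+ 2) = (chi12 j)%:~R * (gsum a 1 * er24 d).
Proof.
move=> h; rewrite !(@gsum_hsum a d) // hsumE.
have n1 := er_neq0 ((d * j ^+ 2)%:~R / (24 * k)%N%:R : R).
have n2 := er_neq0 (d%:~R / (24 * k)%N%:R : R).
rewrite !er24N expr1n mulr1 -!/(er24 _).
rewrite mulrAC mulVf // mul1r mulrAC mulVf // mul1r mulrC //.
Qed.

(** Substituting d r for r turns a r^2 into d r^2. Thanks to this symmetry nu_eta depends on [a]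
    through e(a / 24k) alone, apart from a function of [d]. *)
Lemma gsum_inv a d : ((24 * k)%N%:Z %| a * d - 1)%Z ->
  gsum a 1 * er24 d = gsum d 1 * er24 a.
Proof.
move=> h; have h' : ((24 * k)%N%:Z %| d * a - 1)%Z by rewrite mulrC.
have [q hq] := dvdzP h.
have cd : coprimez d (12 * k)%N%:Z.
  apply/coprimezP; exists (a, - (2 * q)) => /=.
  by rewrite -[a * d](subrK 1) hq !PoszM; ring.
have cd12 : coprimez d 12.
  apply/coprimezP; exists (a, - (2 * q * k%:Z)) => /=.
  by rewrite -[a * d](subrK 1) hq !PoszM; ring.
have -> : gsum a 1 * er24 d = hsum a d 1.
  rewrite (@gsum_hsum a d) // expr1n mulr1 mulrAC -er24D addNr er24_0 mul1r //.
rewrite /hsum -(psum_affine 0 mul12_gt0 cd (hsum_period a d 1)).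
have -> : psum (12 * k) (fun n => (chi12 (d * n + 0 - d * 1))%:~R * er24 (a * (d * n + 0) ^+ 2)) =
   (chi12 d)%:~R * psum (12 * k) (fun n => (chi12 (n - 1))%:~R * er24 (d * n ^+ 2)).
  rewrite /psum mulr_sumr; apply: eq_bigr => r _.
  rewrite addr0 -mulrBr chi12M intrM -mulrA; congr (_ * (_ * _)); apply: er24_dvd.
  rewrite (_ : _ - _ = d * r%:Z ^+ 2 * (a * d - 1)); last by ring.
  by rewrite hq mulrA dvdz_mull.
rewrite -(psum_shift 1 mul12_gt0); last first.
  by move=> n; rewrite er24_sqr_period addrAC chi12_add12k.
have -> : psum (12 * k) (fun n => (chi12 (n + 1 - 1))%:~R * er24 (d * (n + 1) ^+ 2)) =
   gsum d d * er24 (a * d ^+ 2).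
  rewrite /gsum /psum mulr_suml; apply: eq_bigr => r _.
  rewrite addrK -[RHS]mulrA -[in RHS]er24D; congr (_ * _); apply: er24_dvd.
  rewrite (_ : _ - _ = - (d * (a * d - 1))); last by ring.
  by rewrite hq rpredN mulrA dvdz_mull.
by rewrite (gsumE d h') mulrA -intrM chi12_sqr // mul1r.
Qed.

(* The normalized Gauss sum; [chi12 r != 0] forces [24 %| r ^+ 2 - 1], so it
   only depends on [d] modulo [k]. *)
Definition fsum (d : int) : R[i] :=
  psum (12 * k) (fun r => (chi12 r)%:~R * er24 (d * (r ^+ 2 - 1) + 2 * r)).

Lemma fsumE d : gsum d 1 = er24 d * fsum d.
Proof.
rewrite /gsum /fsum /psum mulr_sumr; apply: eq_bigr => r _.
by rewrite [RHS]mulrCA -er24D; congr (_ * _); congr er24; ring.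
Qed.

Lemma chi12_er24 (r n m : int) : (chi12 r != 0 -> ((24 * k)%N%:Z %| n - m)%Z) ->
  (chi12 r)%:~R * er24 n = (chi12 r)%:~R * er24 m.
Proof.
case: (eqVneq (chi12 r) 0) => [->|_ h]; first by rewrite !mul0r.
by rewrite (er24_dvd (h isT)).
Qed.

Lemma fsum_mod d d' : (k%:Z %| d - d')%Z -> fsum d = fsum d'.
Proof.
move=> /dvdzP [q hq]; apply: eq_bigr => r _; apply: chi12_er24 => hr.
have /dvdzP [s hs] := chi12_neq0_sqr hr.
rewrite (_ : _ - _ = (d - d') * (r%:Z ^+ 2 - 1)); last by ring.
by rewrite hq hs PoszM; apply/dvdzP; exists (q * s); ring.
Qed.

End GaussSums.

(** * The eta multiplier *)

Section EtaTransform.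
Variable R : realType.
Implicit Types (z w tau mu : R[i]).

Definition eta_chi tau (N : int) : R[i] :=
  (chi12 N)%:~R * e ((N ^+ 2)%:~R * (tau / 24%:R)).

Lemma sign_intr n : ((-1) ^+ n : int)%:~R = (-1) ^+ n :> R[i].
Proof. by rewrite -signr_odd -[RHS]signr_odd; case: odd. Qed.

Lemma normc_chi12 (n : int) : normc ((chi12 n)%:~R : R[i]) <= 1.
Proof.
rewrite complex_intr normcR /chi12 /chi12_nat.
by do 2?case: ifP => _; rewrite ?normr1 ?normrN ?normr1 ?normr0.
Qed.

Lemma Im_mul_natinv tau (n : nat) (m : int) :
  complex.Im (m%:~R * (tau / n%:R)) = m%:~R * (complex.Im tau / n%:R).
Proof.
have -> : (n%:R : R[i])^-1 = (n%:R^-1 : R)%:C by rewrite complex_natr fmorphV.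
rewrite complex_intr; case: tau => a b /=.
by rewrite !(mul0r, mulr0, addr0, add0r).
Qed.

(** N and -N give the same term, whence the factor 2: the classes 1 and 5 modulo 6 each reproduce
    the pentagonal series, the second one reflected, and [chi12] vanishes on the other four. *)
Lemma eta_chi_zcvg tau : 0 < complex.Im tau -> zcvg (eta_chi tau) (2%:R * eta tau).
Proof.
move=> t0; set rho := expR (- (2 * pi * (complex.Im tau / 24%:R))).
have p0 : 0 < pi :> R by exact: pi_gt0.
have t1 : 0 < 2 * pi * (complex.Im tau / 24%:R) by rewrite !mulr_gt0 ?invr_gt0.
have rho1 : rho < 1 by rewrite /rho -[ltRHS]expR0 ltr_expR oppr_lt0.
have bnd (n : int) : normc (eta_chi tau n) <= 1 * rho ^+ `|n|%N.
  rewrite /eta_chi normcM; apply: ler_pM; rewrite ?normc_ge0 ?normc_chi12 //.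
  rewrite normc_e Im_mul_natinv -expRM_natl ler_expR mulrN lerN2.
  have h : (`|n|%N%:R : R) <= (n ^+ 2)%:~R.
    by rewrite -[`|n|%N%:R]/(`|n|%N%:Z%:~R) ler_int; nia.
  have := ler_wpM2r (ltW t1) h; lra.
have [l hl] := zcvg_exists (expR_ge0 _) rho1 bnd.
suff <- : l = 2%:R * eta tau by [].
have hE := eta_zcvg t0.
have h1 : zcvg (fun m => eta_chi tau (1%N%:Z + 6%N%:Z * m)) (eta tau).
  apply: eq_zcvg hE => m; rewrite /etaterm /eta_chi.
  have -> : 1%N%:Z + 6%N%:Z * m = 6 * m + 1 by ring.
  by rewrite chi12_etasign sign_intr.
have h5 : zcvg (fun m => eta_chi tau (5%N%:Z + 6%N%:Z * m)) (eta tau).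
  apply: eq_zcvg (zcvg_rev hE) => m; rewrite /etaterm /eta_chi.
  rewrite -sign_intr -chi12_etasign.
  have -> : chi12 (5 + 6 * m) = chi12 (6 * (- 1 - m) + 1).
    rewrite (_ : 6 * (- 1 - m) + 1 = (5 + 6 * m) * -1); last by ring.
    by rewrite chi12M [chi12 (-1)](_ : _ = 1) ?mulr1.
  by have -> : (6 * (- 1 - m) + 1) ^+ 2 = (5%N%:Z + 6%N%:Z * m) ^+ 2 by ring.
pose L (r : nat) := if (r == 1%N) || (r == 5%N) then eta tau else 0.
rewrite (zcvg_mod (L := L) (isT : (0 < 6)%N) hl); last first.
  have hz (r : nat) : (forall m, chi12 (r%:Z + 6%N%:Z * m) = 0) ->
     zcvg (fun m => eta_chi tau (r%:Z + 6%N%:Z * m)) 0.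
    by move=> h; apply: eq_zcvg (@zcvg0 R) => m; rewrite /eta_chi h mul0r.
  case=> [|[|[|[|[|[|r]]]]]] // _; rewrite /L /=; try exact: h1; try exact: h5;
    apply: hz => m.
  1-4: by rewrite chi12_eq0 //; lia.
rewrite !big_ord_recr big_ord0 /L /=; ring.
Qed.

Lemma eta_add1 tau : 0 < complex.Im tau -> eta (tau + 1) = er (24^-1) * eta tau.
Proof.
move=> t0; have t1 : 0 < complex.Im (tau + 1) by rewrite ImD /= addr0.
have h1 := eta_chi_zcvg t1; have h2 := zcvgZ (er (24^-1)) (eta_chi_zcvg t0).
have n2 : 2%:R != 0 :> R[i] by rewrite pnatr_eq0.
apply: (mulfI n2); rewrite [RHS]mulrCA; apply: (zcvg_unique h1).
apply: eq_zcvg h2 => N; rewrite /eta_chi mulrCA.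
case: (eqVneq (chi12 N) 0) => [->|hN]; first by rewrite !mul0r.
congr (_ * _); have /dvdzP [q hq] := chi12_neq0_sqr hN.
rewrite erE -eD -[RHS](eDint _ (- q)); congr e.
have -> : (24^-1 : R)%:C = 24%:R^-1 :> R[i] by rewrite fmorphV rmorph_nat.
have -> : N ^+ 2 = q * 24 + 1 by rewrite -hq subrK.
by rewrite rmorphN rmorphD rmorphM /=; field.
Qed.

Lemma eta_addz tau (m : int) : 0 < complex.Im tau ->
  eta (tau + m%:~R) = er (m%:~R / 24) * eta tau.
Proof.
move=> t0.
have hn (n : nat) (t : R[i]) : 0 < complex.Im t -> eta (t + n%:R) = er (n%:R / 24) * eta t.
  move=> ht; elim: n => [|n IH]; first by rewrite addr0 mul0r er0 mul1r.
  rewrite -natr1 addrA eta_add1; last by rewrite ImD complex_natr /= addr0.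
  by rewrite IH mulrA -erD -(natr1 n) mulrDl mul1r addrC.
case: m => n; first exact: hn.
rewrite NegzE mulrNz; set s := tau - _.
have hs : tau = s + n.+1%:R by rewrite /s -pmulrn subrK.
have s0 : 0 < complex.Im s by move: t0; rewrite hs ImD complex_natr /= addr0.
by rewrite hs hn // mulrA -erD mulrNz mulNr -pmulrn addNr er0 mul1r.
Qed.

(** The choice lam = sqrt 12 / mu makes the Gaussian at N / 12k the exponential of the N-th eta term
    at i / (k^2 mu^2). In [gauss_dual] the same lam produces the exponential of the j-th term at i
    mu^2. *)
Lemma gauss_lam (k : nat) mu (x : R) : (0 < k)%N -> mu != 0 ->
  gauss ((Num.sqrt 12)%:C / mu * (x / (12 * k)%N%:R)%:C) =
  e ((x ^+ 2)%:C * (('i%C / (k%:R ^+ 2 * mu ^+ 2)) / 24%:R)).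
Proof.
move=> k0 m0; rewrite gaussE /e; congr cexp.
have k1 : k%:R != 0 :> R[i] by rewrite pnatr_eq0 -lt0n.
have s12 : (Num.sqrt 12 : R)%:C ^+ 2 = 12%:R.
  by rewrite -rmorphXn sqr_sqrtr // rmorph_nat.
have -> : (x / (12 * k)%N%:R)%:C = x%:C / (12%:R * k%:R) :> R[i].
  by rewrite rmorphM fmorphV rmorph_nat natrM.
rewrite exprMn expr_div_n s12 rmorphXn.
have i2 : 'i%C * 'i%C = -1 :> R[i] by rewrite -expr2 sqr_i.
have -> : 2%:R * pi%:C * 'i%C * (x%:C ^+ 2 * ('i%C / (k%:R ^+ 2 * mu ^+ 2) / 24%:R)) =
  ('i%C * 'i%C) * (2%:R * pi%:C * (x%:C ^+ 2 / (k%:R ^+ 2 * mu ^+ 2) / 24%:R)) by ring.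
rewrite i2; field; by rewrite k1 m0.
Qed.

Lemma gauss_dual mu (j : int) : mu != 0 ->
  gauss (j%:~R / ((Num.sqrt 12)%:C / mu)) = e ((j ^+ 2)%:~R * (('i%C * mu ^+ 2) / 24%:R)) :> R[i].
Proof.
move=> m0; rewrite gaussE /e; congr cexp.
have s12 : (Num.sqrt 12 : R)%:C ^+ 2 = 12%:R.
  by rewrite -rmorphXn sqr_sqrtr // rmorph_nat.
have s0 : (Num.sqrt 12 : R)%:C != 0 by rewrite -sqrf_eq0 s12 pnatr_eq0.
have -> : j%:~R / ((Num.sqrt 12)%:C / mu) = j%:~R * mu / (Num.sqrt 12)%:C by rewrite invf_div mulrA.
rewrite expr_div_n s12 rmorphXn.
have i2 : 'i%C * 'i%C = -1 :> R[i] by rewrite -expr2 sqr_i.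
have -> : 2%:R * pi%:C * 'i%C * (j%:~R ^+ 2 * ('i%C * mu ^+ 2 / 24%:R)) =
  ('i%C * 'i%C) * (2%:R * pi%:C * (j%:~R ^+ 2 * (mu ^+ 2 / 24%:R))) by ring.
by rewrite i2; field.
Qed.

(* Poisson summation over each residue class [N = r mod 12 k], applied to the
   series of [eta] at [a / k + i / (k^2 z)], [z = mu ^ 2]. *)
Lemma eta_gauss_transform (k : nat) (a d : int) mu : (0 < k)%N ->
  ((24 * k)%N%:Z %| a * d - 1)%Z -> `|complex.Im mu| < complex.Re mu ->
  eta (a%:~R / k%:R + 'i%C / (k%:R ^+ 2 * mu ^+ 2)) =
  mu / (Num.sqrt 12)%:C * (gsum R k a 1 * er24 R k d) *
  eta (- d%:~R / k%:R + 'i%C * mu ^+ 2).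
Proof.
move=> k0 had hmu.
have m0 : mu != 0 by apply/eqP => h; move: hmu; rewrite h /= normr0 ltxx.
have kR : 0 < k%:R :> R by rewrite ltr0n.
have k1 : k%:R != 0 :> R[i] by rewrite pnatr_eq0 -lt0n.
have mu2 : 0 < complex.Re (mu ^+ 2) := square_cone hmu.
set lam := (Num.sqrt 12)%:C / mu.
have s0 : 0 < Num.sqrt 12 :> R by rewrite sqrtr_gt0.
have s1 : (Num.sqrt 12 : R)%:C != 0 by rewrite -(rmorph0 (real_complex R)) (inj_eq (@complexI R)) gt_eqF.
have hlam : `|complex.Im lam| < complex.Re lam.
  have := inv_cone hmu; rewrite /lam ReM ImM /= !mul0r subr0 addr0.
  by rewrite normrM (gtr0_norm s0) ltr_pM2l.
set sg := a%:~R / k%:R + _; set ta := - d%:~R / k%:R + _.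
have hta : 0 < complex.Im ta.
  rewrite /ta ImD -mulrNz -[_ / k%:R]mul1r -(rmorph1 (intmul (1 : R[i]))).
  rewrite Im_mul_natinv complex_intr /= mul0r mulr0 add0r ImM /= mul0r mul1r add0r //.
have hsg : 0 < complex.Im sg.
  have hi := square_cone (inv_cone hmu).
  rewrite /sg ImD -[a%:~R / _]mul1r -(rmorph1 (intmul (1 : R[i]))).
  rewrite Im_mul_natinv complex_intr /= mul0r mulr0 add0r.
  have -> : 'i%C / (k%:R ^+ 2 * mu ^+ 2) = 'i%C * ((k%:R ^- 2 : R)%:C * mu^-1 ^+ 2).
    by rewrite fmorphV rmorphXn rmorph_nat exprVn invfM.
  rewrite ImM /= mul0r mul1r add0r ReM /= !mul0r subr0 mulr_gt0 // invr_gt0 exprn_gt0 //.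
have hM : (0 < 12 * k)%N by rewrite muln_gt0.
have [l1 hl1] : exists l1 : nat -> R[i], forall r, zcvg (fun n => gauss (lam * (r%:R / (12 * k)%N%:R + n%:~R)%:C)) (l1 r).
  by have [f hf] := choice (fun r : nat => gauss_zcvg (r%:R / (12 * k)%N%:R) hlam); exists f.
have [l2 hl2] : exists l2 : nat -> R[i], forall r, zcvg (gdual lam (r%:R / (12 * k)%N%:R)) (l2 r).
  by have [f hf] := choice (fun r : nat => gdual_zcvg (r%:R / (12 * k)%N%:R) hlam); exists f.
have hP r : lam * l1 r = l2 r by exact: poisson hlam (hl1 r) (hl2 r).
pose c (r : nat) : R[i] := (chi12 r)%:~R * er24 R k (a * r%:Z ^+ 2).
have hsgsum : 2%:R * eta sg = \sum_(r < 12 * k) c r * l1 r.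
  apply: (zcvg_mod (L := fun r => c r * l1 r) hM (eta_chi_zcvg hsg)) => r _.
  apply: eq_zcvg (zcvgZ (c r) (hl1 r)) => n.
  rewrite /eta_chi /c (chi12_mod (m := r)); last by rewrite PoszM -mulrA mulrC addrC modzMDl.
  rewrite -mulrA; congr (_ * _).
  have hk : (12 * k)%N%:R != 0 :> R by rewrite pnatr_eq0 -lt0n.
  have -> : r%:R / (12 * k)%N%:R + n%:~R = (r%:Z + (12 * k)%N%:Z * n)%:~R / (12 * k)%N%:R :> R.
    by rewrite intrD intrM mulrDl mulrAC mulfV ?mul1r.
  rewrite gauss_lam //; set N := r%:Z + _.
  (* The part a / k of the argument contributes e(a N^2 / 24k), which depends on N modulo 12k: this
     dictates the modulus of the residue classes. *)
  have -> : er24 R k (a * r%:Z ^+ 2) = er24 R k (a * N ^+ 2).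
    apply: er24_dvd => //.
    rewrite (_ : _ - _ = - (a * r%:Z * n + 6 * a * k%:Z * n ^+ 2) * (24 * k)%N%:Z) ?dvdz_mull //.
    by rewrite /N !PoszM; ring.
  rewrite /er24 erE -eD; congr e; rewrite /sg.
  have -> : ((a * N ^+ 2)%:~R / (24 * k)%N%:R : R)%:C = (a * N ^+ 2)%:~R / (24%:R * k%:R) :> R[i].
    by rewrite rmorphM fmorphV rmorph_nat natrM rmorph_int.
  rewrite !rmorphXn rmorph_int rmorphM /= !rmorphXn; field; by rewrite k1 m0.
have htsum : \sum_(r < 12 * k) c r * l2 r = gsum R k a 1 * er24 R k d * (2%:R * eta ta).
  have h1 : zcvg (fun j => \sum_(r < 12 * k) c r * gdual lam (r%:R / (12 * k)%N%:R) j)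
       (\sum_(r < 12 * k) c r * l2 r).
    by apply: zcvg_sum => r; apply: zcvgZ; apply: hl2.
  apply: (zcvg_unique h1); apply: eq_zcvg (zcvgZ _ (eta_chi_zcvg hta)) => j.
  have -> : \sum_(r < 12 * k) c r * gdual lam (r%:R / (12 * k)%N%:R) j =
     gauss (j%:~R / lam) * gsum R k a j.
    rewrite /gsum /psum mulr_sumr; apply: eq_bigr => r _.
    rewrite /c /gdual mulrCA -!mulrA; congr (_ * (_ * _)).
    rewrite er24D; congr (_ * _); rewrite /er24; congr er.
    have kn : k%:R != 0 :> R by rewrite gt_eqF.
    by rewrite !natrM rmorphM rmorphM /=; field.
  rewrite gauss_dual // /eta_chi /ta.
  (* The Gauss sum returns [chi12 j] times e(-d j^2 / 24k); the latter is the shift by -d / k in the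
     argument of the dual eta. *)
  have hgs := @gsumE R k k0 a d j had.
  have hn0 := er_neq0 ((d * j ^+ 2)%:~R / (24 * k)%N%:R : R); rewrite -/(er24 R k _) in hn0.
  apply: (mulIf hn0); rewrite -[RHS]mulrA hgs [RHS]mulrCA.
  have key : e ((j ^+ 2)%:~R * ((- d%:~R / k%:R + 'i%C * mu ^+ 2) / 24%:R)) * er24 R k (d * j ^+ 2) =
      e ((j ^+ 2)%:~R * ('i%C * mu ^+ 2 / 24%:R)).
    rewrite /er24 erE -eD; congr e.
    have -> : ((d * j ^+ 2)%:~R / (24 * k)%N%:R : R)%:C = (d * j ^+ 2)%:~R / (24%:R * k%:R) :> R[i].
      by rewrite rmorphM fmorphV rmorph_nat natrM rmorph_int.
    by rewrite rmorphM /=; field.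
  by rewrite -key; ring.
have n2 : 2%:R != 0 :> R[i] by rewrite pnatr_eq0.
apply: (mulfI n2).
have l0 : lam != 0 by rewrite mulf_neq0 // invr_eq0.
apply: (mulfI l0); rewrite hsgsum mulr_sumr.
under eq_bigr do rewrite mulrCA hP.
rewrite htsum /lam; field; by rewrite m0 s1.
Qed.

End EtaTransform.

Section NuEta.
Variable R : realType.
Implicit Types (z w tau mu : R[i]).

Lemma Re_sqrtc_ge0 z : 0 <= complex.Re (sqrtc z).
Proof. by case: z => a b; rewrite /= sqrtr_ge0. Qed.

Lemma sqrtc_unique z w : w ^+ 2 = z -> 0 < complex.Re w -> sqrtc z = w.
Proof.
move=> hw w0; have := sqr_sqrtc z; rewrite -{2}hw => /eqP.
rewrite eqf_sqr => /orP[/eqP //|/eqP h].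
by have := Re_sqrtc_ge0 z; rewrite h ReN => h1; exfalso; clear -h1 w0; lra.
Qed.

(** Re (w^2) is the difference of the squares of Re w and Im w, so the principal root lies in the
    open cone on which [poisson] holds. *)
Lemma sqrtc_cone z : 0 < complex.Re z -> `|complex.Im (sqrtc z)| < complex.Re (sqrtc z).
Proof.
move=> hz; have := Re_sqrtc_ge0 z; have h := sqr_sqrtc z.
move: hz; rewrite -{1}h expr2 ReM => hz h0.
by rewrite ltr_norml; apply/andP; split; nra.
Qed.

(** It gives uniqueness of the multiplier picked by [xget]. At tau = i the term s is at most rho^|s|
    times the term 0, with rho = exp(-2 pi) <= 1/5, so all others together are at most 2 rho / (1 -
    rho) <= 1/2 of it. *)
Lemma eta_neq0 : exists2 tau : R[i], 0 < complex.Im tau & eta tau != 0.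
Proof.
pose tau : R[i] := 'i%C; have t0 : 0 < complex.Im tau by rewrite /= ltr01.
exists tau => //; apply/eqP => heta.
have p2 : 2 <= pi :> R by exact: pi_ge2.
pose rho : R := expR (- (2 * pi)).
have r0 : 0 <= rho by exact: expR_ge0.
have r5 : rho <= 1 / 5.
  rewrite /rho expRN div1r lef_pV2 ?posrE ?expR_gt0 //.
  have := expR_ge1Dx (2 * pi : R); lra.
pose f := etaterm tau.
have nf (s : int) : normc (f s) = expR (- (2 * pi * (((6 * s + 1) ^+ 2)%:~R * (1 / 24%:R)))).
  rewrite /f /etaterm normcM normcX normc_opp ComplexField.Normc.normc1 expr1n mul1r.
  by rewrite normc_e Im_mul_natinv.
have f0 : 0 < normc (f 0) by rewrite nf expR_gt0.
have fs (s : int) : normc (f s) <= normc (f 0) * rho ^+ `|s|%N.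
  rewrite !nf /rho -expRM_natl -expRD ler_expR.
  have h : (24 * `|s|%N%:~R : R) + ((6 * 0 + 1 : int) ^+ 2)%:~R <= ((6 * s + 1) ^+ 2)%:~R.
    by rewrite -[24]/(24%:~R) -intrM -intrD ler_int; nia.
  move: h; rewrite -[(`|s|%N%:~R)]/(`|s|%N%:R).
  move: (((6 * s + 1) ^+ 2)%:~R : R) (`|s|%N%:R : R) (((6 * 0 + 1 : int) ^+ 2)%:~R : R) => x y w h.
  have p0 : 0 <= pi :> R by lra.
  have := ler_wpM2l p0 h; lra.
have [N H] := eta_zcvg t0 (divr_gt0 f0 (ltr0n R 4)).
have := H N N.+1 (leqnn N) (leqnSn N); rewrite heta subr0 zsum_sym -/f => h1.
have h2 : normc (\sum_(i < N) (f i.+1%:Z + f (- i.+1%:Z))) <= normc (f 0) / 2.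
  apply: le_trans (normc_sum _ _ _) _.
  apply: (@le_trans _ _ (\sum_(i < N) (2 * normc (f 0) * rho) * rho ^+ i)).
    apply: ler_sum => i _; apply: le_trans (normc_le_add _ _) _.
    have := fs i.+1%:Z; have := fs (- i.+1%:Z); rewrite abszN.
    rewrite (_ : `|i.+1%:Z|%N = i.+1) // exprS; lra.
  rewrite -mulr_sumr.
  have r1 : rho < 1 by lra.
  have := geometric_sum_le N r0 r1.
  have h3 : (1 - rho)^-1 <= 5 / 4 by rewrite -div1r ler_pdivrMr; lra.
  move=> h4; have h5 := le_trans h4 h3.
  have c0 : 0 <= 2 * normc (f 0) * rho by rewrite !mulr_ge0 // ltW.
  have := ler_wpM2l c0 h5; have := ler_wpM2l (ltW f0) r5; lra.
have h3 : normc (f 0) <= normc (f 0 + \sum_(i < N) (f i.+1%:Z + f (- i.+1%:Z))) +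
    normc (\sum_(i < N) (f i.+1%:Z + f (- i.+1%:Z))).
  rewrite -{1}[f 0](addrK (\sum_(i < N) (f i.+1%:Z + f (- i.+1%:Z)))).
  by apply: le_trans (normc_le_add _ _) _; rewrite normc_opp.
lra.
Qed.

(** Determinant 1 gives inverses modulo k, whereas the Gauss sums require them modulo 24k. As k is
    even, a is odd. If 3 divides a, then 3 does not divide k, and a + k is prime to 3. *)
Lemma inverse_lift24 (k : nat) (a d : int) : (0 < k)%N -> (2 %| k)%N -> (k%:Z %| a * d - 1)%Z ->
  exists m m' : int, ((24 * k)%N%:Z %| (a + m * k%:Z) * (d + m' * k%:Z) - 1)%Z.
Proof.
move=> k0 k2 /dvdzP [q hq].
have cak : coprimez a k%:Z.
  by apply/coprimezP; exists (d, - q); rewrite /= [d * a]mulrC -[a * d](subrK 1) hq; ring.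
have [m hm] : exists m : int, ~~ (3 %| a + m * k%:Z)%Z.
  have [h|h] := boolP (3 %| a)%Z; last by exists 0; rewrite mul0r addr0.
  exists 1; rewrite mul1r; apply/negP => h'.
  have h3 : (3 %| k%:Z)%Z by rewrite -[k%:Z](addKr a) rpredD // rpredN.
  have := cak; rewrite /coprimez => /eqP hg.
  have : (3 %| gcdz a k%:Z)%Z by rewrite dvdz_gcd h h3.
  by rewrite hg.
pose a' := a + m * k%:Z.
have ca'k : coprimez a' k%:Z.
  apply/coprimezP; exists (d, - q - d * m) => /=.
  by rewrite /a' mulrDr [d * a]mulrC -[a * d](subrK 1) hq; ring.
have c3 : coprimez a' 3.
  by rewrite coprimez_sym coprimezE /= prime_coprime // -dvdzE.
have c2 : coprimez a' 2.
  have k2z : (2 %| k%:Z)%Z by rewrite dvdzE.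
  exact: coprimez_dvdr k2z ca'k.
have c24 : coprimez a' (24 * k)%N%:Z.
  rewrite PoszM coprimezMr ca'k andbT.
  by rewrite (_ : 24%N%:Z = 2 * (2 * (2 * 3))) // !coprimezMr c2 c3.
have /coprimezP [[u v] /= huv] := c24.
have hd : (k%:Z %| u - d)%Z.
  rewrite -(Gauss_dvdzr _ (m := k%:Z) (n := a')) 1?coprimez_sym //.
  rewrite (_ : a' * (u - d) = (- v * 24 - m * d - q) * k%:Z) ?dvdz_mull //.
  have e1 : a' * u = 1 - v * (24 * k)%N%:Z by rewrite -huv; ring.
  have e2 : a' * d = 1 + q * k%:Z + m * d * k%:Z.
    by rewrite /a' mulrDl -[a * d](subrK 1) hq; ring.
  by rewrite mulrBr e1 e2 PoszM; ring.
have /dvdzP [m' hm'] := hd.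
exists m, m'; have -> : d + m' * k%:Z = u by rewrite -hm' addrC subrK.
by rewrite -/a' (_ : _ - 1 = - v * (24 * k)%N%:Z) ?dvdz_mull // -huv; ring.
Qed.

Lemma kl_mxE (a d k : nat) :
  [/\ kl_mx a d k 0 0 = a, kl_mx a d k 0 1 = ((a%:Z * d%:Z - 1) %/ k%:Z)%Z,
      kl_mx a d k 1 0 = k & kl_mx a d k 1 1 = d].
Proof. by rewrite /kl_mx /mx2 !mxE. Qed.

Lemma er8_sqr : er (8^-1 : R) ^+ 2 = 'i%C.
Proof.
rewrite -erX erE eR (_ : 2 * pi * (8^-1 *+ 2) = pi / 2); last by field.
by rewrite cos_pihalf sin_pihalf.
Qed.

(** The cone puts arg mu between -pi/4 and pi/4; multiplication by e(1/8) moves it between 0 and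
    pi/2, so the product has positive real part and is the principal root. *)
Lemma sqrtc_rotated (k : nat) mu : (0 < k)%N -> `|complex.Im mu| < complex.Re mu ->
  sqrtc ('i%C * k%:R * mu ^+ 2) = er 8^-1 * (Num.sqrt k%:R)%:C * mu.
Proof.
move=> k0 hmu; have kR : 0 < k%:R :> R by rewrite ltr0n.
apply: sqrtc_unique.
  by rewrite !exprMn er8_sqr -rmorphXn sqr_sqrtr ?ltW // rmorph_nat.
have p0 : 0 < pi :> R by exact: pi_gt0.
have cs : er (8^-1 : R) = cos (pi / 4) +i* sin (pi / 4).
  by rewrite erE eR (_ : 2 * pi * 8^-1 = pi / 4) //; field.
have c0 : 0 < cos (pi / 4 : R) by apply: cos_gt0_pihalf; apply/andP; split; lra.
have sc : sin (pi / 4 : R) = cos (pi / 4).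
  have h := cosBpihalf (pi / 4 : R).
  by rewrite -h (_ : pi / 4 - pi / 2 = - (pi / 4)) ?cosN //; field.
rewrite cs sc !ReM ImM /= !(mulr0, mul0r, subr0, add0r).
have s0 : 0 < Num.sqrt k%:R :> R by rewrite sqrtr_gt0.
have hi := ler_norm (complex.Im mu).
have -> : cos (pi / 4) * Num.sqrt k%:R * complex.Re mu - cos (pi / 4) * Num.sqrt k%:R * complex.Im mu =
   cos (pi / 4) * Num.sqrt k%:R * (complex.Re mu - complex.Im mu) by ring.
rewrite !mulr_gt0 //; lra.
Qed.

Lemma nu_eta_transform (a d k : nat) tau : (0 < k)%N -> (2 %| k)%N -> (k%:Z %| a%:Z * d%:Z - 1)%Z ->
  0 < complex.Im tau ->
  eta (moebius (kl_mx a d k) tau) =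
   er24 R k (a%:Z + d%:Z) * fsum R k d / ((Num.sqrt (12 * k)%:R)%:C * er 8^-1) *
   sqrtc (cocyc (kl_mx a d k) tau) * eta tau.
Proof.
move=> k0 k2 had t0.
have kR : k%:R != 0 :> R by rewrite pnatr_eq0 -lt0n.
have kC : k%:R != 0 :> R[i] by rewrite pnatr_eq0 -lt0n.
have [m [m' hmm]] := inverse_lift24 k0 k2 had.
(* With this [z], gamma tau = a / k + i / (k^2 z) and tau = -d / k + i z, the two arguments in
   [eta_gauss_transform] up to integer translations. *)
pose z := - 'i%C * (tau + d%:R / k%:R).
have i2 : 'i%C * 'i%C = -1 :> R[i] by rewrite -expr2 sqr_i.
have iz : 'i%C * z = tau + d%:R / k%:R by rewrite /z mulNr mulrN mulrA i2 mulN1r opprK.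
have zR : 0 < complex.Re z.
  rewrite /z ReM ReN ImN /= !(oppr0, mul0r, mulN1r, opprK, sub0r).
  have -> : d%:R / k%:R = (d%:R / k%:R : R)%:C by rewrite rmorphM fmorphV !rmorph_nat.
  by rewrite ImD /= addr0.
pose mu := sqrtc z; have hmu : `|complex.Im mu| < complex.Re mu by exact: sqrtc_cone.
have mu2 : mu ^+ 2 = z by exact: sqr_sqrtc.
have m0 : mu != 0 by apply/eqP => h; move: hmu; rewrite h /= normr0 ltxx.
have z0 : z != 0 by rewrite -mu2 sqrf_eq0.
have [g00 g01 g10 g11] := kl_mxE a d k.
have hcoc : cocyc (kl_mx a d k) tau = 'i%C * k%:R * mu ^+ 2.
  rewrite /cocyc g10 g11 mu2 mulrAC iz -!pmulrn mulrDl divfK // [tau * _]mulrC //.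
have /dvdzP [b hb] := had.
have hmoe : moebius (kl_mx a d k) tau = a%:R / k%:R + 'i%C / (k%:R ^+ 2 * mu ^+ 2).
  rewrite /moebius hcoc g00 g01 hb mulzK; last by rewrite eqz_nat -lt0n.
  have ht : tau = 'i%C * z - d%:R / k%:R by rewrite iz addrK.
  rewrite mu2 -!pmulrn {1}ht.
  have hbR : b%:~R = (a%:R * d%:R - 1) / k%:R :> R[i].
    apply: (mulIf kC); rewrite divfK //.
    have := congr1 (fun n : int => n%:~R : R[i]) hb; rewrite rmorphB !rmorphM /= -!pmulrn => ->.
    by [].
  have i0 : 'i%C != 0 :> R[i] by rewrite -sqrf_eq0 expr2 i2 oppr_eq0 oner_eq0.
  have iV : 'i%C = - 'i%C^-1 :> R[i].
    by apply: (mulfI i0); rewrite mulrN divff // i2.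
  rewrite hbR [in RHS]iV; field; by rewrite kC z0 i0.
rewrite hcoc sqrtc_rotated // hmoe.
set sg := a%:R / k%:R + _.
have htt : (a%:Z + m * k%:Z)%:~R / k%:R + 'i%C / (k%:R ^+ 2 * mu ^+ 2) = sg + m%:~R.
  by rewrite /sg intrD intrM -!pmulrn mulrDl mulfK // addrAC.
have hta : - (d%:Z + m' * k%:Z)%:~R / k%:R + 'i%C * mu ^+ 2 = tau + (- m')%:~R.
  by rewrite mu2 iz intrD intrM -!pmulrn rmorphN /=; field.
have hsg : 0 < complex.Im sg.
  have hi := square_cone (inv_cone hmu).
  rewrite /sg; have -> : a%:R / k%:R = (a%:R / k%:R : R)%:C by rewrite rmorphM fmorphV !rmorph_nat.
  rewrite ImD /= add0r.
  have -> : 'i%C / (k%:R ^+ 2 * mu ^+ 2) = 'i%C * ((k%:R ^- 2 : R)%:C * mu^-1 ^+ 2).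
    by rewrite fmorphV rmorphXn rmorph_nat exprVn invfM.
  rewrite ImM /= mul0r mul1r add0r ReM /= !mul0r subr0 mulr_gt0 // invr_gt0 exprn_gt0 // ltr0n //.
have := eta_gauss_transform k0 hmm hmu.
rewrite htt hta !eta_addz // => hE.
(* The lifts by m k and m' k cost e(m / 24) and e(m' / 24), exactly the factors by which [eta_addz]
   moves the two arguments back. *)
have hgg : gsum R k (a%:Z + m * k%:Z) 1 * er24 R k (d%:Z + m' * k%:Z) =
   er24 R k (a%:Z + d%:Z) * er (m%:~R / 24) * er (m'%:~R / 24) * fsum R k d.
  have hfm : fsum R k (d%:Z + m' * k%:Z) = fsum R k d.
    by apply: fsum_mod => //; rewrite addrC addKr dvdz_mull.
  rewrite (gsum_inv _ k0 hmm) fsumE hfm.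
  rewrite mulrAC -er24D; congr (_ * _).
  have hq (x : int) : er24 R k (x * k%:Z) = er (x%:~R / 24).
    rewrite /er24; congr er; rewrite intrM natrM -pmulrn; field; by rewrite kR.
  by rewrite -!hq -!er24D; congr er24; ring.
rewrite hgg in hE.
have n1 := er_neq0 (m%:~R / 24 : R).
apply: (mulfI n1); rewrite hE.
have -> : er ((- m')%:~R / 24 : R) = (er (m'%:~R / 24))^-1 by rewrite rmorphN mulNr erN.
have n2 := er_neq0 (m'%:~R / 24 : R).
have n8 := er_neq0 (8^-1 : R).
have s12 : (Num.sqrt (12 * k)%:R : R)%:C = (Num.sqrt 12)%:C * (Num.sqrt k%:R)%:C.
  by rewrite natrM sqrtrM // rmorphM.
have s1 : (Num.sqrt 12 : R)%:C != 0.
  by rewrite -(rmorph0 (real_complex R)) (inj_eq (@complexI R)) gt_eqF // sqrtr_gt0.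
have s2 : (Num.sqrt k%:R : R)%:C != 0.
  by rewrite -(rmorph0 (real_complex R)) (inj_eq (@complexI R)) gt_eqF // sqrtr_gt0 ltr0n.
rewrite s12; field; by rewrite n2 n8 s1 s2.
Qed.

Lemma nu_etaE (a d k : nat) : (0 < k)%N -> (2 %| k)%N -> (k%:Z %| a%:Z * d%:Z - 1)%Z ->
  nu_eta (kl_mx a d k) =
   er24 R k (a%:Z + d%:Z) * fsum R k d / ((Num.sqrt (12 * k)%:R)%:C * er 8^-1).
Proof.
move=> k0 k2 had; set w := (X in _ = X).
have hw tau : 0 < complex.Im tau -> eta (moebius (kl_mx a d k) tau) = w * sqrtc (cocyc (kl_mx a d k) tau) * eta tau.
  exact: nu_eta_transform.
rewrite /nu_eta; case: xgetP => [v _ hv|/(_ w) //].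
have [tau t0 et0] := eta_neq0.
have := hv _ t0; rewrite hw // => /(mulIf et0) h.
have c0 : sqrtc (cocyc (kl_mx a d k) tau) != 0.
  have [g00 g01 g10 g11] := kl_mxE a d k.
  rewrite sqrtc_eq0; apply/eqP => /(congr1 (@complex.Im R)).
  rewrite /cocyc g10 g11 ImD !complex_intr ImM /= mul0r !addr0 => /eqP.
  by rewrite mulf_eq0 intr_eq0 eqz_nat gt_eqF //= gt_eqF.
by apply/esym; apply: (mulIf c0).
Qed.

End NuEta.

(** * Square roots of 1 - 24 n modulo 24 k *)

(** [P1] and [P2] have to contain the reductions of [P], nothing more; this lets [P] be a congruence
    modulo twice m1 m2, as in [card_sqrt_double]. *)
Lemma card_crt (m1 m2 : nat) (P : pred 'I_(m1 * m2)) (P1 : pred 'I_m1) (P2 : pred 'I_m2) :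
  (0 < m1)%N -> (0 < m2)%N -> coprime m1 m2 ->
  (forall (x : 'I_(m1 * m2)) (y : 'I_m1), P x -> y = x %% m1 :> nat -> P1 y)%N ->
  (forall (x : 'I_(m1 * m2)) (y : 'I_m2), P x -> y = x %% m2 :> nat -> P2 y)%N ->
  (#|P| <= #|P1| * #|P2|)%N.
Proof.
move=> h1 h2 co hP1 hP2.
pose f (x : 'I_(m1 * m2)) := (Ordinal (ltn_pmod x h1), Ordinal (ltn_pmod x h2)).
have finj : injective f.
  move=> x y [] e1 e2; apply: val_inj => /=.
  have := chinese_mod co x; have := chinese_mod co y; rewrite e1 e2 => <-.
  by rewrite !modn_small ?ltn_ord.
rewrite -cardX -(card_imset _ finj); apply: subset_leq_card.
apply/fintype.subsetP => -[a b] /imsetP [x Px [-> ->]]; rewrite inE /=; apply/andP; split.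
  exact: hP1 Px _.
exact: hP2 Px _.
Qed.

Lemma card_pm_le2 (q : nat) (P : pred 'I_q) :
  (forall x y : 'I_q, P x -> P y -> (q%:Z %| x%:Z - y%:Z)%Z || (q%:Z %| x%:Z + y%:Z)%Z) ->
  (#|P| <= 2)%N.
Proof.
move=> h; case: (pickP P) => [y Py|h0]; last by rewrite eq_card0.
have q0 : (0 < q)%N by apply: leq_ltn_trans (ltn_ord y).
pose z : 'I_q := Ordinal (ltn_pmod (q - y) q0).
have : P \subset [set y; z].
  apply/fintype.subsetP => x Px; rewrite !inE -!val_eqE /=.
  have yq := ltn_ord y; have xq := ltn_ord x.
  case/orP: (h x y Px Py) => hd; apply/orP.
    left; have : (x%:Z == y%:Z %[mod q])%Z by rewrite eqz_mod_dvd.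
    by rewrite !modz_small ?ltz_nat // eqz_nat.
  right; have : (x%:Z == (q - y)%N%:Z %[mod q])%Z.
    by rewrite eqz_mod_dvd -subzn ?(ltnW yq) // opprB addrA rpredB.
  by rewrite modz_small ?ltz_nat // modz_nat eqz_nat.
by move=> /subset_leq_card /leq_trans; apply; rewrite cards2; case: (_ != _).
Qed.

Lemma dvdz_sqr_sub (p m z D : int) :
  (p %| m)%Z -> (m %| z ^+ 2 - D)%Z -> (p %| z)%Z -> (p %| D)%Z.
Proof.
move=> pm h hz; rewrite -[D](subKr (z ^+ 2)) rpredB ?(dvdz_trans pm h) //.
by rewrite expr2 dvdz_mull.
Qed.

Lemma coprimez_primeX (p i : nat) (z : int) : prime p -> ~~ (p%:Z %| z)%Z ->
  coprimez (p ^ i)%N%:Z z.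
Proof.
by move=> pp hz; rewrite coprimezE coprimeXl // prime_coprime.
Qed.

Definition nsqrt (m : nat) (D : int) : nat := #|[pred x : 'I_m | (m%:Z %| x%:Z ^+ 2 - D)%Z]|.

Lemma dvdz_sqr_modn (m x : nat) (D : int) :
  (m%:Z %| x%:Z ^+ 2 - D)%Z -> (m%:Z %| (x %% m)%N%:Z ^+ 2 - D)%Z.
Proof.
move=> h; rewrite (_ : _ - D = (x%:Z ^+ 2 - D) - (x %/ m)%N%:Z * (x%:Z + (x %% m)%N%:Z) * m%:Z).
  by rewrite rpredB // dvdz_mull.
have := congr1 Posz (divn_eq x m); rewrite PoszD PoszM => {1 2}->; ring.
Qed.

(** If p does not divide D, roots x and y are prime to p, and the odd p cannot divide both x - y and
    x + y, so the prime power divides one of them. If p divides D, the exponent is at most 1 and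
    every root is 0. *)
Lemma nsqrt_prime_power (p e' : nat) (D : int) : prime p -> odd p ->
  ((p%:Z %| D)%Z -> (e' <= 1)%N) -> (nsqrt (p ^ e') D <= 2)%N.
Proof.
move=> pp po hD; apply: card_pm_le2 => x y /= hx hy.
have hxy : ((p ^ e')%N%:Z %| (x%:Z - y%:Z) * (x%:Z + y%:Z))%Z.
  by have := rpredB hx hy; rewrite opprB addrA subrK subr_sqr.
case: e' => [|e'] in x y hx hy hD hxy *.
  by apply/orP; left; exact: dvd1z.
have [pD|pD] := boolP (p%:Z %| D)%Z.
  have e0 : e' = 0%N by have := hD pD; case: e' {x y hx hy hD hxy}.
  have pdiv (z : int) : ((p ^ e'.+1)%N%:Z %| z ^+ 2 - D)%Z -> ((p ^ e'.+1)%N%:Z %| z)%Z.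
    rewrite e0 expn1 => h; have : (p%:Z %| z ^+ 2)%Z by rewrite -(subrK D (z ^+ 2)) rpredD.
    by rewrite expr2 !dvdzE abszM /= Euclid_dvdM // orbb.
  by apply/orP; left; apply: rpredB; apply: pdiv.
have ppow : (p%:Z %| (p ^ e'.+1)%N%:Z)%Z by rewrite dvdzE /= dvdn_exp.
have pnx (z : int) : ((p ^ e'.+1)%N%:Z %| z ^+ 2 - D)%Z -> ~~ (p%:Z %| z)%Z.
  move=> h; apply: contra pD => hz.
  exact: dvdz_sqr_sub ppow h hz.
have [h|h] := boolP (p%:Z %| x%:Z - y%:Z)%Z.
  have hn : ~~ (p%:Z %| x%:Z + y%:Z)%Z.
    apply/negP => h'; have : (p%:Z %| (2 : int) * x%:Z)%Z.
      move: (x%:Z) (y%:Z) h h' => a b h h'.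
      have -> : 2 * a = (a - b) + (a + b) by ring.
      exact: rpredD.
    rewrite dvdzE abszM Euclid_dvdM // => /orP[|hx'].
      by move=> /(dvdn_leq (isT : (0 < 2)%N)) p2; have := prime_gt1 pp; move: po; case: (p) p2 => [|[|[|]]].
    by have := pnx _ hx; rewrite dvdzE hx'.
  by move: hxy; rewrite Gauss_dvdzl ?coprimez_primeX // => ->.
by move: hxy; rewrite Gauss_dvdzr ?coprimez_primeX // => ->; rewrite orbT.
Qed.

Lemma nsqrt_odd (m : nat) (D : int) : (0 < m)%N -> odd m ->
  (forall p, prime p -> (p %| m)%N -> (p%:Z %| D)%Z -> ~~ (p ^ 2 %| m)%N) ->
  (nsqrt m D <= 2 ^ size (primes m))%N.
Proof.
elim/ltn_ind: m => m IH m0 om hm.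
have [m1|m1] := leqP m 1.
  have -> : m = 1%N by apply/eqP; rewrite eqn_leq m1 m0.
  by rewrite (leq_trans (max_card _)) // card_ord.
set p := pdiv m; have pp : prime p by exact: pdiv_prime.
have pm : (p %| m)%N by exact: pdiv_dvd.
have mE := partnC p m0.
have q0 : (0 < m`_p^')%N by exact: part_gt0.
have pe : (m`_p = p ^ logn p m)%N by rewrite p_part.
have l0 : (0 < logn p m)%N by rewrite logn_gt0 mem_primes pp m0 pm.
have lt : (m`_p^' < m)%N.
  rewrite -[X in (_ < X)%N]mE ltn_Pmull // pe -{1}(exp1n (logn p m)) ltn_exp2r //.
  exact: prime_gt1.
have dq : (m`_p^' %| m)%N by exact: dvdn_part.
have opn : odd p by apply: dvdn_odd pm om.
have sz : size (primes m) = (size (primes m`_p^')).+1.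
  rewrite primes_part size_filter -(count_predC (mem (p : nat_pred)) (primes m)).
  rewrite (_ : count (mem (p : nat_pred)) _ = 1%N) ?add1n //.
  rewrite (eq_count (a2 := pred1 p)); last by move=> x; rewrite !inE.
  by rewrite (count_uniq_mem _ (primes_uniq m)) mem_primes pp m0 pm.
have ih : (nsqrt m`_p^' D <= 2 ^ size (primes m`_p^'))%N.
  apply: IH => //; first exact: dvdn_odd om.
  move=> r pr rq rD; apply: contra (hm r pr (dvdn_trans rq dq) rD) => h.
  exact: dvdn_trans dq.
have ip : (nsqrt m`_p D <= 2)%N.
  rewrite pe; apply: nsqrt_prime_power => // pD.
  have := hm p pp pm pD; rewrite pfactor_dvdn // -ltnNge //.
rewrite sz expnS; apply: leq_trans (leq_mul ip ih).
rewrite -[X in (nsqrt X D <= _)%N]mE.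
apply: card_crt => //.
- exact: coprime_partC.
- move=> x y /= hx ->; apply: dvdz_sqr_modn; apply: dvdz_trans hx.
  by rewrite PoszM dvdz_mulr.
- move=> x y /= hx ->; apply: dvdz_sqr_modn; apply: dvdz_trans hx.
  by rewrite PoszM dvdz_mull.
Qed.

(* The modulus is doubled for the condition only, which halves the number of
   square roots of a unit modulo a power of 2. *)
Definition dsqrt (M : nat) (D : int) : pred 'I_M :=
  [pred x : 'I_M | ((2 * M)%N%:Z %| x%:Z ^+ 2 - D)%Z].

Arguments dsqrt M D : clear implicits.

Lemma dvdz_sqr_modn2 (m x : nat) (D : int) : (2 %| m)%N ->
  ((2 * m)%N%:Z %| x%:Z ^+ 2 - D)%Z -> ((2 * m)%N%:Z %| (x %% m)%N%:Z ^+ 2 - D)%Z.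
Proof.
move=> /dvdnP [u hu] h.
have hx : x%:Z = (x %/ m)%N%:Z * m%:Z + (x %% m)%N%:Z by rewrite -PoszM -PoszD -divn_eq.
have hm : m%:Z = u%:Z * 2 by rewrite hu PoszM.
move: h; rewrite hx PoszM; move: (x %/ m)%N%:Z (x %% m)%N%:Z => v w h.
rewrite (_ : _ - D = ((v * m%:Z + w) ^+ 2 - D) - (v * w + u%:Z * v ^+ 2) * (2 * m%:Z)).
  by rewrite rpredB // dvdz_mull.
by rewrite hm; ring.
Qed.

(** Roots x and y are odd, so exactly one of u = (x - y) / 2 and v = (x + y) / 2 is odd. From
    2^(al+1) | 4uv one gets 2^al | 2uv, and the odd factor can be removed. *)
Lemma nsqrt_two (al : nat) (D : int) : (0 < al)%N -> ~~ (2 %| D)%Z ->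
  (#|dsqrt (2 ^ al) D| <= 2)%N.
Proof.
move=> al0 hD; apply: card_pm_le2 => x y; rewrite /dsqrt /= -expnS => hx hy.
have hxy : ((2 ^ al.+1)%N%:Z %| (x%:Z - y%:Z) * (x%:Z + y%:Z))%Z.
  by have := rpredB hx hy; rewrite opprB addrA subrK subr_sqr.
have odx (z : int) : ((2 ^ al.+1)%N%:Z %| z ^+ 2 - D)%Z -> ~~ (2 %| z)%Z.
  move=> h; apply: contra hD => hz.
  have h2 : (2 %| (2 ^ al.+1)%N%:Z)%Z by rewrite dvdzE /= dvdn_exp.
  exact: dvdz_sqr_sub h2 h hz.
have ox := odx _ hx; have oy := odx _ hy.
have [u hu] : exists u : int, x%:Z - y%:Z = 2 * u by exists ((x%:Z - y%:Z) %/ 2)%Z; clear -ox oy; lia.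
have [v hv] : exists v : int, x%:Z + y%:Z = 2 * v by exists ((x%:Z + y%:Z) %/ 2)%Z; clear -ox oy; lia.
have huv : (2 %| u)%Z = ~~ (2 %| v)%Z by clear -ox oy hu hv; lia.
have cop (z : int) : ~~ (2 %| z)%Z -> coprimez (2 ^ al)%N%:Z z.
  exact: coprimez_primeX.
have h2uv : ((2 ^ al)%N%:Z %| u * (2 * v))%Z.
  move: hxy; rewrite hu hv (_ : 2 * u * (2 * v) = 2 * (u * (2 * v))); last by ring.
  by rewrite expnS PoszM dvdz_mul2l.
have h2uv' : ((2 ^ al)%N%:Z %| 2 * u * v)%Z.
  by rewrite (_ : 2 * u * v = u * (2 * v)) //; ring.
rewrite hu hv; have [h|h] := boolP (2 %| u)%Z.
  by apply/orP; left; move: h2uv'; rewrite Gauss_dvdzl // cop // -huv.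
by apply/orP; right; move: h2uv; rewrite Gauss_dvdzr // cop.
Qed.

Lemma card_sqrt_double (M : nat) (D : int) : (0 < M)%N -> (2 %| M)%N -> ~~ (2 %| D)%Z ->
  (forall p, prime p -> odd p -> (p %| M)%N -> (p%:Z %| D)%Z -> ~~ (p ^ 2 %| M)%N) ->
  (#|dsqrt M D| <= 2 * 2 ^ size [seq p <- primes M | odd p])%N.
Proof.
move=> M0 M2 hD hp.
have mE := partnC 2%N M0.
have q0 : (0 < M`_2^')%N by exact: part_gt0.
have pe : (M`_2 = 2 ^ logn 2 M)%N by rewrite p_part.
have l0 : (0 < logn 2 M)%N by rewrite logn_gt0 mem_primes M0 M2.
have dq : (M`_2^' %| M)%N by exact: dvdn_part.
have oq : odd (M`_2^')%N.
  by have := part_pnat 2%N^' M; rewrite -(odd_2'nat).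
have sz : size [seq p <- primes M | odd p] = size (primes (M`_2^')%N).
  rewrite primes_part; congr size; apply: eq_in_filter => x.
  rewrite mem_primes => /andP[px _]; rewrite !inE.
  by case: (even_prime px) => [->|o] //; rewrite o; apply/esym/eqP => h; rewrite h in o.
have ih : (nsqrt (M`_2^')%N D <= 2 ^ size (primes (M`_2^')%N))%N.
  apply: nsqrt_odd => // p pp pq pD.
  apply: contra (hp p pp (dvdn_odd pq oq) (dvdn_trans pq dq) pD) => h.
  exact: dvdn_trans dq.
have i2 : (#|dsqrt (M`_2)%N D| <= 2)%N by rewrite pe; exact: nsqrt_two.
rewrite sz; apply: leq_trans (leq_mul i2 ih).
rewrite -[X in (#|dsqrt X D| <= _)%N]mE.
apply: card_crt => //.
- exact: coprime_partC.
- move=> x y; rewrite /dsqrt /= => hx ->; apply: dvdz_sqr_modn2; first by rewrite pe dvdn_exp.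
  by apply: dvdz_trans hx; rewrite mulnA [X in (_ %| X)%Z]PoszM dvdz_mulr.
- move=> x y; rewrite /dsqrt /= => hx ->; apply: dvdz_sqr_modn; apply: dvdz_trans hx.
  by rewrite mulnA [X in (_ %| X)%Z]PoszM dvdz_mull.
Qed.

(** * The remaining sum over square roots *)

Section GaussPeriods.
Variable R : realType.

(* What is left of the Kloosterman sum after the sum over [d]; [D] stands for [1 - 24 n]. *)
Definition tterm (k : nat) (D r : int) : R[i] :=
  if ((24 * k)%N%:Z %| r ^+ 2 - D)%Z then (chi12 r)%:~R * er24 R k (2 * r) else 0.

Definition tsum (k : nat) (D : int) : R[i] := psum (12 * k) (tterm k D).

Lemma tterm_period k D r : (0 < k)%N -> tterm k D (r + (12 * k)%N%:Z) = tterm k D r.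
Proof.
move=> k0; rewrite /tterm chi12_add12k.
have h : ((24 * k)%N%:Z %| (r + (12 * k)%N%:Z) ^+ 2 - r ^+ 2)%Z.
  by rewrite (_ : _ - _ = (r + 6 * k%:Z) * (24 * k)%N%:Z) ?dvdz_mull // !PoszM; ring.
rewrite (_ : _ ^+ 2 - D = ((r + (12 * k)%N%:Z) ^+ 2 - r ^+ 2) + (r ^+ 2 - D)); last by ring.
rewrite (rpredDl _ h); case: ifP => // _; congr (_ * _); apply: er24_dvd => //.
by rewrite (_ : _ - _ = 1 * (24 * k)%N%:Z) ?dvdz_mull // !PoszM; ring.
Qed.

Lemma psumZ (M : nat) (c : R[i]) (f : int -> R[i]) : psum M (fun r => c * f r) = c * psum M f.
Proof. by rewrite /psum mulr_sumr. Qed.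

Lemma er_prime_fixed (p : nat) (z : R[i]) : prime p -> z = er p%:R^-1 * z -> z = 0.
Proof.
move=> pp /eqP; rewrite -subr_eq0 -{1}[z]mul1r -mulrBl mulf_eq0 subr_eq0 => /orP[|/eqP //].
rewrite eq_sym (negPf (er_neq1 _ _)) //.
  by rewrite invr_gt0 ltr0n prime_gt0.
by rewrite invf_lt1 ?ltr1n ?prime_gt1 // ltr0n prime_gt0.
Qed.

(** As p divides D, every r that counts is divisible by p. For these the shift by 12k / p keeps r^2
    modulo 24k and multiplies e(2r / 24k) by e(1/p), so the sum equals e(1/p) times itself. *)
Lemma tsum_square_prime k D p : (0 < k)%N -> prime p -> (p ^ 2 %| k)%N -> (p%:Z %| D)%Z ->
  tsum k D = 0.
Proof.
move=> k0 pp /dvdnP [q hq] pD.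
have kZ : k%:Z = q%:Z * p%:Z ^+ 2 by rewrite hq PoszM.
have pk : (p%:Z %| (24 * k)%N%:Z)%Z by rewrite PoszM kZ expr2 mulrA mulrA dvdz_mull.
pose s : int := 12 * q%:Z * p%:Z.
have hs r : tterm k D (r + s) = er (p%:R^-1) * tterm k D r.
  rewrite /tterm.
  have pE : (p%:Z %| (r + s) ^+ 2 - D)%Z = (p%:Z %| r)%Z.
    rewrite (rpredBr _ pD).
    rewrite (_ : (r + s) ^+ 2 = r ^+ 2 + (r * 24 * q%:Z + 12 * q%:Z * s) * p%:Z); last by rewrite /s; ring.
    rewrite (rpredDr _ (dvdz_mull _ (dvdzz _))) expr2 !dvdzE abszM /= Euclid_dvdM //.
    by rewrite orbb.
  have [hr|hr] := boolP (p%:Z %| r)%Z; last first.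
    have hn x : (p%:Z %| x - D)%Z = false -> ((24 * k)%N%:Z %| x - D)%Z = false.
      by move=> h; apply/negP => /(dvdz_trans pk); rewrite h.
    have e1 : ((24 * k)%N%:Z %| (r + s) ^+ 2 - D)%Z = false.
      by apply: hn; rewrite pE; exact: negPf.
    have e2 : ((24 * k)%N%:Z %| r ^+ 2 - D)%Z = false.
      apply: hn; rewrite (rpredBr _ pD) expr2 dvdzE abszM /= Euclid_dvdM // orbb.
      by move: hr; rewrite dvdzE => /negPf.
    by rewrite e1 e2 mulr0.
  have /dvdzP [t ht] := hr.
  have h : ((24 * k)%N%:Z %| (r + s) ^+ 2 - r ^+ 2)%Z.
    rewrite (_ : _ - _ = (t + 6 * q%:Z) * (24 * k)%N%:Z) ?dvdz_mull //.
    by rewrite PoszM kZ ht /s; ring.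
  rewrite (_ : _ ^+ 2 - D = ((r + s) ^+ 2 - r ^+ 2) + (r ^+ 2 - D)); last by ring.
  rewrite (rpredDl _ h); case: ifP => _; last by rewrite mulr0.
  rewrite /s (_ : r + 12 * q%:Z * p%:Z = r + q%:Z * p%:Z * 12); last by ring.
  rewrite chi12D mulrDr er24D [RHS]mulrCA; congr (_ * _); rewrite mulrC; congr (_ * _).
  rewrite /er24; congr er; rewrite !intrM natrM hq natrM natrX -!pmulrn.
  have p0 : p%:R != 0 :> R by rewrite pnatr_eq0 -lt0n prime_gt0.
  have q0 : q%:R != 0 :> R.
    by rewrite pnatr_eq0 -lt0n; move: k0; rewrite hq muln_gt0 => /andP[].
  by field; rewrite p0 q0.
apply: (er_prime_fixed pp).
rewrite /tsum -psumZ -[LHS](psum_shift s (mul12_gt0 k0)); last by move=> n; exact: tterm_period.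
by apply: eq_bigr => r _; rewrite hs.
Qed.

Lemma tterm_norm k D r :
  normc (tterm k D r) <= if ((24 * k)%N%:Z %| r ^+ 2 - D)%Z then 1 else 0.
Proof.
rewrite /tterm; case: ifP => _; last by rewrite ComplexField.Normc.normc0.
by rewrite normcM normc_er mulr1 normc_chi12.
Qed.

Lemma tsum_card k D : normc (tsum k D) <= #|dsqrt (12 * k) D|%:R.
Proof.
apply: le_trans (normc_sum _ _ _) _; rewrite -sum1_card natr_sum [leRHS]big_mkcond /=.
apply: ler_sum => r _; apply: le_trans (tterm_norm _ _ _) _.
by rewrite /in_mem /= /dsqrt /= mulnA.
Qed.

Lemma normc_1_sub_er3 (u : int) : ~~ (3 %| u)%Z -> normc (1 - er (u%:~R / 3 : R)) = Num.sqrt 3.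
Proof.
move=> hu; set w := er _; have w3 : w ^+ 3 = 1.
  by rewrite /w -erX -[_ *+ 3]mulr_natr divfK ?er_int // pnatr_eq0.
have w1 : w != 1.
  rewrite /w er_frac_modz //; apply: er_neq1.
    rewrite divr_gt0 // ltr0z lt_neqAle modz_ge0 // andbT eq_sym.
    by apply: contra hu => /eqP h; apply/dvdz_mod0P.
  by rewrite ltr_pdivrMr // mul1r -[3]/(3%:~R) ltr_int; exact: ltz_pmod.
have : (w - 1) * (w ^+ 2 + w + 1) = w ^+ 3 - 1 by ring.
rewrite w3 subrr => /eqP; rewrite mulf_eq0 subr_eq0 (negPf w1) /= => /eqP hw.
have nw : normc w = 1 by exact: normc_er.
clearbody w; case: w w3 w1 hw nw => x y _ /= w1 hw nw.
have hy : x ^+ 2 + y ^+ 2 = 1.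
  by rewrite -[LHS]sqr_sqrtr ?addr_ge0 ?sqr_ge0 // nw expr1n.
move/eqP: hw; rewrite expr2 eq_complex /= => /andP[/eqP h1 /eqP h2].
have hx : x = - (1 / 2).
  have h : y * (2 * x + 1) = 0 by clear -h2; lra.
  move/eqP: h; rewrite mulf_eq0 => /orP[/eqP y0|/eqP h]; last by clear -h; lra.
  by rewrite y0 in hy h1; clear -hy h1; nra.
by congr Num.sqrt; clear -hx hy; rewrite hx in hy *; nra.
Qed.

Lemma tsum_not3 k D : (0 < k)%N -> ~~ (3 %| k)%N ->
  normc (tsum k D) <= Num.sqrt 3 / 2 * #|dsqrt (12 * k) D|%:R.
Proof.
move=> k0 k3.
have c43 : coprimez (8 * k)%N%:Z 3.
  by rewrite coprimezE /= coprime_sym prime_coprime // Euclid_dvdM.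
(* [V] serves to pair r with V r: its square is 1 modulo 24k, and it is 5 modulo 12, so that chi12 V
   = -1. *)
have [V [V1 V2]] : exists V : int, ((8 * k)%N%:Z %| V - 1)%Z /\ (3 %| V + 1)%Z.
  exists (zchinese (8 * k)%N%:Z 3 1 (-1)); split.
    by rewrite -eqz_mod_dvd; apply/eqP; apply: zchinese_modl.
  by rewrite -[_ + 1]/(_ - -1) -eqz_mod_dvd; apply/eqP; apply: zchinese_modr.
have V24 : ((24 * k)%N%:Z %| V ^+ 2 - 1)%Z.
  rewrite (_ : (24 * k)%N = (8 * k * 3)%N); last by rewrite mulnAC.
  rewrite PoszM Gauss_dvdz // (_ : V ^+ 2 - 1 = (V - 1) * (V + 1)); last by ring.
  by rewrite dvdz_mulr // dvdz_mull.
have V5 : (V = 5 %[mod 12])%Z.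
  have h : (8 %| V - 1)%Z by apply: dvdz_trans V1; rewrite PoszM dvdz_mulr.
  clear -h V2; lia.
have cV : coprimez V (12 * k)%N%:Z.
  have /dvdzP [q hq] := V24; apply/coprimezP; exists (V, - (2 * q)) => /=.
  by rewrite -expr2 -[V ^+ 2](subrK 1) hq !PoszM; ring.
have /dvdzP [u hu] := V1.
have u3 : ~~ (3 %| u)%Z.
  apply/negP => h; have : (3 %| V - 1)%Z by rewrite hu dvdz_mulr.
  move: V2; clear; lia.
(* Since V = 1 + 8k u, the phase e(2r / 24k) changes by e(2ur / 3). This is a primitive cube root of
   unity w for every r that counts, as 3 divides neither u nor r; each term thus appears with a
   factor 1 - w of modulus sqrt 3. *)
have hV r : tterm k D (V * r + 0) = tterm k D r * - er ((2 * u * r)%:~R / 3).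
  rewrite addr0 /tterm.
  have h : ((24 * k)%N%:Z %| (V * r) ^+ 2 - r ^+ 2)%Z.
    by rewrite (_ : _ - _ = r ^+ 2 * (V ^+ 2 - 1)) ?dvdz_mull //; ring.
  rewrite (_ : _ ^+ 2 - D = ((V * r) ^+ 2 - r ^+ 2) + (r ^+ 2 - D)); last by ring.
  rewrite (rpredDl _ h); case: ifP => _; last by rewrite mul0r.
  rewrite chi12M (chi12_mod V5) mulN1r intrN mulNr mulrN; congr (- _).
  rewrite -mulrA; congr (_ * _).
  have -> : 2 * (V * r) = 2 * r + 2 * u * r * (8 * k)%N%:Z.
    by rewrite -[V](subrK 1) hu; ring.
  rewrite er24D; congr (_ * _); rewrite /er24; congr er.
  rewrite intrM !natrM -pmulrn natrM; field.
  by rewrite pnatr_eq0 -lt0n k0.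
have h2 : 2 * tsum k D = psum (12 * k) (fun r => tterm k D r * (1 - er ((2 * u * r)%:~R / 3))).
  rewrite mulr_natl mulr2n {2}/tsum -(psum_affine 0 (mul12_gt0 k0) cV); last by move=> n; exact: tterm_period.
  rewrite /tsum /psum -big_split /=; apply: eq_bigr => r _.
  by rewrite hV mulrBr mulr1 mulrN.
have : normc (2 * tsum k D) <= Num.sqrt 3 * #|dsqrt (12 * k) D|%:R.
  rewrite h2; apply: le_trans (normc_sum _ _ _) _.
  rewrite -sum1_card natr_sum mulr_sumr [leRHS]big_mkcond /=.
  apply: ler_sum => r _; rewrite normcM.
  rewrite mulr1 -[(r \in _)]/((2 * (12 * k))%N%:Z %| r%:Z ^+ 2 - D)%Z mulnA.
  case: (eqVneq (tterm k D r) 0) => [->|t0].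
    by rewrite ComplexField.Normc.normc0 mul0r; case: ifP => _; rewrite ?sqrtr_ge0.
  have t1 := tterm_norm k D r.
  have hd : ((24 * k)%N%:Z %| r%:Z ^+ 2 - D)%Z.
    by move: t0; rewrite /tterm; case: ifP => //; rewrite eqxx.
  rewrite hd in t1 *; rewrite normc_1_sub_er3; last first.
    move: t0; rewrite /tterm hd; case: (boolP (3 %| r%:Z)%Z) => [r3|r3 _].
      by rewrite (@chi12_eq0 r) ?r3 ?orbT // mul0r eqxx.
    by move: u3 r3; rewrite !dvdzE !abszM !Euclid_dvdM // => /negPf -> /negPf ->.
  by rewrite -[leRHS]mul1r ler_wpM2r // sqrtr_ge0.
rewrite normcM (_ : normc (2 : R[i]) = 2); last by rewrite complex_natr normcR normr_nat.
by move=> h; rewrite -mulrA [_^-1 * _]mulrC mulrA ler_pdivlMr // mulrC.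
Qed.

Lemma odd_prime_dvd24 (p : nat) : prime p -> odd p -> (p %| 24)%N -> p = 3%N.
Proof.
move=> pp po; rewrite (_ : 24%N = (2 ^ 3 * 3)%N) // Euclid_dvdM // => /orP[|].
  by rewrite Euclid_dvdX // dvdn_prime2 // andbT => /eqP p2; rewrite p2 in po.
by rewrite dvdn_prime2 // => /eqP.
Qed.

Lemma odd_primes24 (c : nat) : (0 < c)%N ->
  size [seq p <- primes (24 * c) | odd p] = (omega_odd c + ~~ (3 %| c))%N.
Proof.
move=> c0; rewrite /omega_odd.
have hf m : uniq [seq p <- primes m | odd p] by rewrite filter_uniq // primes_uniq.
have [h|h] := boolP (3 %| c)%N.
  rewrite addn0; apply/perm_size/uniq_perm => // p.
  rewrite !mem_filter !mem_primes muln_gt0 c0 /=; case: (boolP (odd p)) => //= po.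
  case: (boolP (prime p)) => //= pp; rewrite Euclid_dvdM //.
  by case: (boolP (p %| 24)%N) => //= /(odd_prime_dvd24 pp po) ->; rewrite h.
rewrite addn1; apply: (@perm_size _ _ (3%N :: [seq p <- primes c | odd p])).
apply: uniq_perm => //=; first by rewrite hf mem_filter mem_primes (negPf h) !andbF.
move=> p; rewrite in_cons !mem_filter !mem_primes muln_gt0 c0 /=.
case: (eqVneq p 3%N) => [->|p3] //=.
  by rewrite Euclid_dvdM.
case: (boolP (odd p)) => //= po; case: (boolP (prime p)) => //= pp; rewrite Euclid_dvdM //.
by case: (boolP (p %| 24)%N) => //= /(odd_prime_dvd24 pp po) h'; rewrite h' in p3.
Qed.

Lemma tsum_bound (c : nat) (n : int) : (0 < c)%N ->
  normc (tsum (2 * c) (1 - 24 * n)) <= 2 ^+ omega_odd c * Num.sqrt (12 / (gcdn 3 c)%:R).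
Proof.
move=> c0; set k := (2 * c)%N; set D := 1 - 24 * n.
have k0 : (0 < k)%N by rewrite muln_gt0.
have [[p [pp pk pD]]|hp] := pselect (exists p, [/\ prime p, (p ^ 2 %| k)%N & (p%:Z %| D)%Z]).
  by rewrite (tsum_square_prime k0 pp pk pD) ComplexField.Normc.normc0 mulr_ge0 ?exprn_ge0 ?sqrtr_ge0.
have D2 : ~~ (2 %| D)%Z by rewrite /D; clear; lia.
have D3 : ~~ (3 %| D)%Z by rewrite /D; clear; lia.
have hcard : (#|dsqrt (12 * k) D| <= 2 * 2 ^ (omega_odd c + ~~ (3 %| c)%N))%N.
  have -> : (omega_odd c + ~~ (3 %| c) = size [seq p <- primes (12 * k) | odd p])%N.
    by rewrite -odd_primes24 // /k mulnA.
  apply: card_sqrt_double => //; rewrite ?muln_gt0 //.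
    by rewrite dvdn_mulr.
  move=> p pp po pk pD; apply/negP => h; apply: hp; exists p; split => //.
  (* The count is over 12k while the vanishing criterion concerns k. As 3 does not divide D, the odd
     prime p is prime to 12, and p^2 | 12k gives p^2 | k. *)
  have h3 : coprime (p ^ 2) 12.
    rewrite coprimeXl // prime_coprime //; apply/negP => h12.
    have p3 := odd_prime_dvd24 pp po (dvdn_trans h12 (isT : 12 %| 24)%N).
    by rewrite p3 in pD; rewrite pD in D3.
  by rewrite Gauss_dvdr in h.
have h2 : 2 ^+ omega_odd c * Num.sqrt 12 = 2 * 2 ^+ omega_odd c * Num.sqrt 3 :> R.
  rewrite (_ : 12 = 2 ^+ 2 * 3 :> R); last by ring.
  by rewrite sqrtrM ?sqr_ge0 // sqrtr_sqr ger0_norm // mulrA [_ * 2]mulrC.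
have [h|h] := boolP (3 %| c)%N.
  rewrite (gcdn_idPl h); apply: le_trans (tsum_card _ _) _.
  move: hcard; rewrite h addn0 -(ler_nat R) natrM natrX => /le_trans; apply.
  rewrite (_ : 12 / 3 = 2 ^+ 2 :> R); last by field.
  by rewrite sqrtr_sqr ger0_norm // mulrC.
have -> : gcdn 3 c = 1%N by apply/eqP; rewrite -/(coprime 3 c) prime_coprime.
rewrite divr1 h2; apply: le_trans (tsum_not3 _ k0 _) _; first by rewrite Euclid_dvdM.
move: hcard; rewrite h addn1 expnS -(ler_nat R) !natrM natrX => h'.
have s0 : 0 <= Num.sqrt 3 / 2 :> R by rewrite divr_ge0 ?sqrtr_ge0.
apply: le_trans (ler_wpM2l s0 h') _.
by rewrite le_eqVlt; apply/orP; left; apply/eqP; field.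
Qed.

End GaussPeriods.

(** * The Kloosterman sum *)

Section KroneckerMinusOne.

Lemma fermat_Fp (p : nat) (x : 'F_p) : prime p -> x != 0 -> x ^+ p.-1 = 1.
Proof.
move=> pp x0; apply: (mulfI x0); rewrite -exprS prednK ?prime_gt0 // mulr1.
by have := expf_card x; rewrite card_Fp.
Qed.

Lemma dvdz_sqr1_Fp (p m : nat) : prime p ->
  (p%:Z %| m%:Z ^+ 2 - -1)%Z = ((m%:R : 'F_p) ^+ 2 == -1).
Proof.
move=> pp; rewrite opprK (_ : m%:Z ^+ 2 + 1 = (m ^ 2 + 1)%N%:Z); last by rewrite PoszD expr2 -PoszM mulnn.
by rewrite dvdzE /= (dvdn_pcharf (pchar_Fp pp)) natrD natrX addr_eq0.
Qed.

(** Here [p./2] is (p - 1) / 2. A root of -1 gives (-1)^((p-1)/2) = 1 by Fermat. Conversely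
    X^((p-1)/2) - 1 has too few roots to vanish at every nonzero y, and where it does not vanish
    y^((p-1)/4) is a root of -1. *)
Lemma sqrtN1_mod4 (p : nat) : prime p -> odd p ->
  (exists m : nat, (p%:Z %| m%:Z ^+ 2 - -1)%Z) <-> ~~ odd p./2.
Proof.
move=> pp po; have p2 : (p = p./2.*2.+1)%N by rewrite -[LHS]odd_double_half po.
have n1 : (1 : 'F_p) != -1.
  rewrite -subr_eq0 opprK -[1 + 1]/(2%:R) -(dvdn_pcharf (pchar_Fp pp)).
  by apply/negP => /(dvdn_leq (isT : (0 < 2)%N)) h; have := prime_gt1 pp; move: po; case: (p) h => [|[|[|]]].
split=> [[m]|ev].
  rewrite dvdz_sqr1_Fp // => /eqP h; apply/negP => od; move/negP: n1; apply.
  have m0 : (m%:R : 'F_p) != 0.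
    by apply/eqP => m0; move/eqP: h; rewrite m0 expr0n eq_sym oppr_eq0 oner_eq0.
  rewrite -{1}(fermat_Fp pp m0) (_ : p.-1 = 2 * p./2)%N; last by rewrite mul2n {1}p2.
  by rewrite exprM h -signr_odd od expr1.
have hE : p./2 = (p./2./2).*2 by rewrite -[LHS]odd_double_half (negPf ev).
set t := p./2./2 in hE.
have t0 : (0 < t)%N by have := prime_gt1 pp; rewrite p2 hE; case: (t).
suff [y y0 hy] : exists2 y : 'F_p, y != 0 & y ^+ p./2 != 1.
  exists (y ^+ t : 'F_p); rewrite dvdz_sqr1_Fp // natr_Zp -exprM muln2 -hE.
  have : (y ^+ p./2) ^+ 2 == 1 ^+ 2.
    by rewrite expr1n -exprM muln2 -[X in y ^+ X]/((p./2).*2.+1).-1 -p2 fermat_Fp.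
  by rewrite eqf_sqr (negPf hy).
apply: contrapT => hno.
have hall : all (root ('X^(p./2) - 1 : {poly 'F_p})) (enum [pred y : 'F_p | y != 0]).
  apply/allP => y; rewrite mem_enum inE => y0; rewrite rootE !hornerE subr_eq0.
  by apply: contrapT => hy; apply: hno; exists y => //; apply/negP.
have p20 : (0 < p./2)%N by rewrite hE double_gt0.
have hn0 : ('X^(p./2) - 1 : {poly 'F_p}) != 0 by rewrite -size_poly_gt0 size_XnsubC.
have := max_poly_roots hn0 hall (enum_uniq _).
rewrite size_XnsubC // -cardE (cardC1 (0 : 'F_p)) card_Fp // {1}p2 /= -addnn ltnS.
by rewrite leqNgt -{1}[p./2]addn0 ltn_add2l p20.
Qed.

Lemma legendreN1 (p : nat) : prime p -> odd p -> legendre (-1) p = (-1) ^+ p./2.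
Proof.
move=> pp po; rewrite /legendre.
have -> : (p%:Z %| -1)%Z = false.
  by rewrite dvdzE /= dvdn1; have := prime_gt1 pp; case: (p) => [|[|]].
have p0 := prime_gt0 pp.
rewrite -signr_odd; have [hs hs'] := sqrtN1_mod4 pp po.
case: existsP => [[x]|hno].
  by rewrite eqz_mod_dvd => h; rewrite (negPf (hs _)) //; exists x.
case: (boolP (odd p./2)) => // /hs' [m hm]; case: hno.
by exists (Ordinal (ltn_pmod m p0)); rewrite /= eqz_mod_dvd; exact: dvdz_sqr_modn.
Qed.

(** For odd a and b, (ab - 1) / 2 and (a - 1) / 2 + (b - 1) / 2 have the same parity. This carries
    the formula for (-1/p) from odd primes to all odd d. *)
Lemma signM_half (a b : nat) : odd a -> odd b ->
  (-1) ^+ (a * b)./2 = (-1) ^+ a./2 * (-1) ^+ b./2 :> int.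
Proof.
move=> oa ob; rewrite -exprD -signr_odd -[RHS]signr_odd; congr (_ ^+ (_ : bool)).
have ha : a = a./2.*2.+1 by rewrite -[LHS]odd_double_half oa.
have hb : b = b./2.*2.+1 by rewrite -[LHS]odd_double_half ob.
move: ha hb; move: (a./2) (b./2) => u v -> ->.
have -> : ((u.*2.+1 * v.*2.+1) = (u * v).*2.*2 + (u + v).*2.+1)%N by rewrite -!muln2; lia.
by rewrite addnS /= -doubleD uphalf_double oddD odd_double.
Qed.

Lemma signX_half (a i : nat) : odd a ->
  (-1) ^+ (a ^ i)./2 = ((-1) ^+ a./2) ^+ i :> int.
Proof.
move=> oa; elim: i => [|i IH]; first by rewrite expn0 !expr0.
by rewrite expnS signM_half ?oddX ?oa ?orbT // IH exprS.
Qed.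

Lemma kroneckerN1 (d : nat) : odd d -> kronecker (-1) d%:Z = (-1) ^+ d./2.
Proof.
move=> od; have d0 : (0 < d)%N by case: (d) od.
rewrite /kronecker eqz_nat gtn_eqF //= mul1r.
have h (s : seq nat) : all odd s ->
    odd (\prod_(p <- s) p ^ logn p d)%N /\
    (-1) ^+ (\prod_(p <- s) p ^ logn p d)%N./2 = \prod_(p <- s) ((-1) ^+ p./2) ^+ logn p d :> int.
  elim: s => [|p s IH] /=; first by rewrite !big_nil.
  move=> /andP[op /IH [h1 h2]]; rewrite !big_cons.
  have oX : odd (p ^ logn p d)%N by rewrite oddX op orbT.
  by rewrite oddM oX h1 signM_half // h2 signX_half.
have hodd : all odd (primes d).
  by apply/allP => p; rewrite mem_primes => /and3P[_ _ pd]; exact: dvdn_odd od.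
have [_] := h _ hodd.
have <- : d = (\prod_(p <- primes d) p ^ logn p d)%N.
  by rewrite {1}(prod_prime_decomp d0) prime_decompE big_map.
move=> ->; rewrite big_seq [RHS]big_seq; apply: eq_bigr => p hp.
have op := allP hodd _ hp; move: hp; rewrite mem_primes => /and3P[pp _ _].
rewrite legendreN1 //; case: eqP => [p2|//]; by rewrite p2 in op.
Qed.

End KroneckerMinusOne.

(** * Summation over the pairs (a, d) *)

Section Assembly.
Variable R : realType.
Variable k : nat.
Hypothesis k0 : (0 < k)%N.

Let kR : k%:R != 0 :> R.
Proof. by rewrite pnatr_eq0 -lt0n. Qed.

Lemma er24_mul24 (x : int) : er24 R k (24 * x) = er (x%:~R / k%:R).
Proof. by rewrite /er24 intrM natrM; congr er; field. Qed.

(** Shift r by 12k / p: as p divides d, the quadratic part changes by a multiple of 24k, while 2r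
    contributes e(1/p). So the sum equals e(1/p) times itself. *)
Lemma fsum_prime_common (p d : nat) : prime p -> (p %| k)%N -> (p %| d)%N -> fsum R k d = 0.
Proof.
move=> pp /dvdnP [q hq] /dvdnP [d' hd].
pose f (r : int) : R[i] := (chi12 r)%:~R * er24 R k (d%:Z * (r ^+ 2 - 1) + 2 * r).
have fper n : f (n + (12 * k)%N%:Z) = f n.
  rewrite /f chi12_add12k; congr (_ * _); apply: er24_dvd => //.
  rewrite (_ : _ - _ = (d%:Z * (n + 6 * k%:Z) + 1) * (24 * k)%N%:Z) ?dvdz_mull //.
  by rewrite !PoszM; ring.
have fs n : f (n + q%:Z * 12) = er p%:R^-1 * f n.
  rewrite /f chi12D [RHS]mulrCA; congr (_ * _).
  have -> : er p%:R^-1 = er24 R k (24 * q%:Z).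
    rewrite er24_mul24; congr er; rewrite hq natrM -pmulrn invfM mulrA divff ?mul1r //.
    by rewrite pnatr_eq0 -lt0n; move: k0; rewrite hq muln_gt0 => /andP[].
  rewrite -er24D; apply: er24_dvd => //.
  rewrite (_ : _ - _ = (d'%:Z * (n + 6 * q%:Z)) * (24 * k)%N%:Z) ?dvdz_mull //.
  by rewrite hd hq !PoszM; ring.
apply: (er_prime_fixed pp).
rewrite {2}/fsum -/f -psumZ -[LHS](psum_shift (q%:Z * 12) (mul12_gt0 k0) fper).
by apply: eq_bigr => r _; rewrite fs.
Qed.

Lemma fsum_noncoprime (d : nat) : ~~ coprime d k -> fsum R k d = 0.
Proof.
move=> h; have g1 : (1 < gcdn d k)%N.
  by rewrite ltn_neqAle eq_sym h gcdn_gt0 k0 orbT.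
have pp := pdiv_prime g1; have := pdiv_dvd (gcdn d k); rewrite dvdn_gcd => /andP[pd pk].
exact: fsum_prime_common pp pk pd.
Qed.

Lemma kl_mx_Gamma0 (a d : nat) : (2 %| k)%N ->
  (kl_mx a d k \in Gamma0 2) = (k%:Z %| a%:Z * d%:Z - 1)%Z.
Proof.
move=> k2; have [g00 g01 g10 g11] := kl_mxE a d k.
rewrite inE g10 dvdzE /= k2 andbT inE (expand_det_row _ 0) !big_ord_recl big_ord0.
rewrite /cofactor !det_mx11 /kl_mx /mx2 !mxE /=.
rewrite (_ : bump 0 0 = 1%N) // !add0n expr0 expr1 addr0 mul1r mulN1r mulrN.
by rewrite dvdz_eq [RHS]eq_sym subr_eq [RHS]subr_eq addrC.
Qed.

(** A unit d has one inverse a below k; for the other d the hypothesis on [z] makes both sides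
    vanish. This removes the coprimality condition from the sum over d. *)
Lemma sum_inverse (d : nat) (z : R[i]) : (~~ coprime d k -> z = 0) ->
  \sum_(a < k | (k%:Z %| a%:Z * d%:Z - 1)%Z) z = z.
Proof.
move=> hz; have [co|nco] := boolP (coprime d k); last first.
  by rewrite hz // big1.
have /coprimezP [[u v] /= huv] : coprimez d%:Z k%:Z by rewrite coprimezE.
have hm : 0 <= (u %% k%:Z)%Z by rewrite modz_ge0 // eqz_nat -lt0n.
have hu : (`|(u %% k%:Z)%Z| < k)%N.
  by rewrite -ltz_nat gez0_abs ?ltz_pmod.
rewrite (big_pred1 (Ordinal hu)) // => a.
have -> : pred1 (Ordinal hu) a = (a%:Z == (u %% k%:Z)%Z).
  by rewrite -[in RHS](gez0_abs hm) eqz_nat.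
rewrite (_ : _ - 1 = (a%:Z - u) * d%:Z - v * k%:Z); last by rewrite -huv; ring.
rewrite (rpredBr _ (dvdz_mull _ (dvdzz _))) Gauss_dvdzl; last first.
  by rewrite coprimezE coprime_sym.
by rewrite -eqz_mod_dvd modz_small // ltz_nat ltn_ord.
Qed.

(** Where [chi12 r] is nonzero, r^2 - 1 = 24 s, so the sum over d runs over k-th roots of unity and
    detects k | m + s, which is the same as 24k | r^2 - (1 - 24m). *)
Lemma sum_fsum (m : int) :
  \sum_(d < k) er24 R k (24 * m * d%:Z) * fsum R k d = k%:R * tsum R k (1 - 24 * m).
Proof.
rewrite /tsum -psumZ /fsum /psum.
under eq_bigr do rewrite mulr_sumr.
rewrite exchange_big /=; apply: eq_bigr => r _.
rewrite /tterm; case: (eqVneq (chi12 r) 0) => [->|hr].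
  by rewrite mul0r if_same mulr0 big1 // => d _; rewrite mul0r mulr0.
have /dvdzP [s hs] := chi12_neq0_sqr hr.
have hd (d : 'I_k) : er24 R k (24 * m * d%:Z) *
    ((chi12 r)%:~R * er24 R k (d%:Z * (r%:Z ^+ 2 - 1) + 2 * r%:Z)) =
    (chi12 r)%:~R * er24 R k (2 * r%:Z) * er (d%:R * ((m + s)%:~R / k%:R)).
  rewrite mulrCA -[RHS]mulrA -er24D hs; congr (_ * _).
  rewrite (_ : _ + (_ + _) = 2 * r%:Z + 24 * (d%:Z * (m + s))); last by ring.
  by rewrite er24D er24_mul24 intrM mulrA -pmulrn.
under eq_bigr do rewrite hd.
rewrite -mulr_sumr dft_orthogonal // [RHS]mulrC.
have -> : r%:Z ^+ 2 - (1 - 24 * m) = (m + s) * 24 by rewrite [RHS]mulrDl -hs; ring.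
rewrite [(24 * k)%N]mulnC PoszM dvdz_mul2r //.
by case: ifP => _; rewrite ?mulr0 ?mul0r.
Qed.

Lemma er_half : er (2^-1 : R) = -1.
Proof.
have h : er (2^-1 : R) ^+ 2 = 1.
  by rewrite -erX -[_ *+ 2]mulr_natr mulVf ?pnatr_eq0 // (er_int R 1).
move/eqP: h; rewrite sqrf_eq1 => /orP[/eqP h|/eqP //].
suff : er (2^-1 : R) != 1 by rewrite h eqxx.
by apply: er_neq1; lra.
Qed.

Lemma kronecker_er24 (d : nat) : odd d ->
  (kronecker (-1) d%:Z)%:~R = er24 R k (6 * k%:Z * (d%:Z - 1)).
Proof.
move=> od; rewrite kroneckerN1 // rmorphXn rmorphN rmorph1 /= -er_half -erX /er24.
have hd : d%:Z - 1 = 2 * (d./2)%:Z.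
  by have := odd_double_half d; rewrite od; clear; lia.
by congr er; rewrite hd !intrM natrM -mulr_natr -!pmulrn; field.
Qed.

Lemma e_weight (n : int) (a d : nat) :
  e (((0%:~R - 24%:R^-1) * a%:R + (n%:~R - 24%:R^-1) * d%:R) / k%:R) =
  er24 R k (24 * n * d%:Z - (a%:Z + d%:Z)).
Proof.
have kC : k%:R != 0 :> R[i] by rewrite pnatr_eq0 -lt0n.
rewrite /er24 erE; congr e.
rewrite rmorphM fmorphV rmorph_nat rmorph_int intrB intrD !intrM natrM -!pmulrn.
by field.
Qed.

(* For [4 %| k] the Kronecker symbol is [er24 R k (6 k (d - 1))], so that it amounts
   to replacing [n] with [m = n + k / 4]. *)
Lemma kl_term (n : int) : (2 %| k)%N -> exists (m : int) (U : R[i]),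
  normc U = (Num.sqrt (12 * k)%:R)^-1 /\
  forall a d : nat, (k%:Z %| a%:Z * d%:Z - 1)%Z ->
  (psi (kl_mx a d k))^*%C * e (((0%:~R - 24%:R^-1) * a%:R + (n%:~R - 24%:R^-1) * d%:R) / k%:R) =
  U * (er24 R k (24 * m * d%:Z) * fsum R k d).
Proof.
move=> k2; set W := ((Num.sqrt (12 * k)%:R : R)%:C * er 8^-1).
have nW : normc W^-1 = (Num.sqrt (12 * k)%:R)^-1.
  rewrite ComplexField.Normc.normcV normcM normc_er mulr1 normcR ger0_norm // sqrtr_ge0.
pose I0 : R[i] := ('i%C ^ (k%:Z %/ 2)%Z)^*%C.
have nI : normc I0 = 1.
  rewrite /I0 divz_nat -[_ ^ _]/('i%C ^+ (k %/ 2)) rmorphXn normcX.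
  by rewrite /= expr0n /= add0r sqrrN expr1n sqrtr1 expr1n.
(* The conjugate of [psi] contains nu_eta itself, whose factor e((a + d) / 24k) is cancelled by the
   weight; [a] disappears here. *)
have hmain a d : (k%:Z %| a%:Z * d%:Z - 1)%Z -> nu_eta (kl_mx a d k) *
   e (((0%:~R - 24%:R^-1) * a%:R + (n%:~R - 24%:R^-1) * d%:R) / k%:R) =
   W^-1 * (er24 R k (24 * n * d%:Z) * fsum R k d).
  move=> had; rewrite nu_etaE // -/W e_weight.
  rewrite mulrC mulrA mulrA -er24D subrK mulrC //.
have [k4|k4] := boolP (4 %| k)%N.
  exists (n + (k %/ 4)%N%:Z), (I0 * er24 R k (- (6 * k%:Z)) * W^-1); split.
    by rewrite normcM nW normcM nI normc_er !mul1r.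
  move=> a d had; have od : odd d.
    apply: contraT => nd; have : (2 %| 1)%Z; last by [].
    rewrite -[X in (_ %| X)%Z](subKr (a%:Z * d%:Z)) rpredB ?(dvdz_trans _ had) //.
    by rewrite dvdz_mull // dvdzE /= dvdn2.
  have [g00 g01 g10 g11] := kl_mxE a d k.
  rewrite /psi g10 g11 dvdzE /= k4 !rmorphM /= rmorph_int conjcK -/I0 -[LHS]mulrA hmain //.
  rewrite kronecker_er24 //.
  have -> : 24 * (n + (k %/ 4)%N%:Z) * d%:Z = 24 * n * d%:Z + 6 * k%:Z * d%:Z.
    by rewrite -{2}(divnK k4) PoszM; ring.
  have -> : 6 * k%:Z * (d%:Z - 1) = - (6 * k%:Z) + 6 * k%:Z * d%:Z by ring.
  by rewrite !er24D; ring.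
exists n, (I0 * W^-1); split; first by rewrite normcM nI mul1r.
move=> a d had; have [g00 g01 g10 g11] := kl_mxE a d k.
by rewrite /psi g10 dvdzE /= (negPf k4) rmorphM /= conjcK -/I0 -[LHS]mulrA hmain // -[RHS]mulrA.
Qed.

End Assembly.

Theorem corollary9p2 (R : realType) (c : nat) (n : int) (hc : (0 < c)%N) :
  `|kloosterman 0 n (2 * c) (@psi R)| <=
    (2%:R ^+ omega_odd c * Num.sqrt ((2 * c)%:R / (gcdn 3 c)%:R))%:C.
Proof.
set k := (2 * c)%N; have k0 : (0 < k)%N by rewrite muln_gt0.
have k2 : (2 %| k)%N by rewrite dvdn_mulr.
have [m [U [nU hU]]] := kl_term R k0 n k2.
have hS : kloosterman 0 n k (@psi R) = U * (k%:R * tsum R k (1 - 24 * m)).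
  rewrite -(sum_fsum R k0) mulr_sumr /kloosterman.
  under eq_bigr do under eq_bigl do rewrite kl_mx_Gamma0 //.
  rewrite (exchange_big_dep predT) //=; apply: eq_bigr => d _.
  rewrite -[RHS](@sum_inverse R k k0 d); last by move=> h; rewrite fsum_noncoprime ?mulr0.
  by apply: eq_bigr => a had; rewrite hU.
rewrite hS normrE lecR normcM nU normcM complex_natr normcR normr_nat.
have hb := tsum_bound R m hc.
have s0 : 0 < Num.sqrt (12 * k)%:R :> R by rewrite sqrtr_gt0 ltr0n muln_gt0.
have h0 : 0 <= (Num.sqrt (12 * k)%:R)^-1 * k%:R :> R by rewrite mulr_ge0 // invr_ge0 ltW.
rewrite mulrA; apply: le_trans (ler_wpM2l h0 hb) _.
(* No loss remains: k (12k)^(-1/2) sqrt(12 / g) = sqrt(k / g) with g = (3,c). *)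
rewrite le_eqVlt; apply/orP; left; apply/eqP.
have g0 : 0 < (gcdn 3 c)%:R :> R by rewrite ltr0n gcdn_gt0.
have kR : 0 < k%:R :> R by rewrite ltr0n.
rewrite mulrCA; congr (_ * _).
apply: (mulfI (lt0r_neq0 s0)); rewrite !mulrA divff ?lt0r_neq0 // mul1r.
rewrite -{1}[k%:R](ger0_norm (ltW kR)) -sqrtr_sqr -!sqrtrM ?sqr_ge0 ?ler0n //.
by rewrite natrM; congr Num.sqrt; ring.
Qed.
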